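(* For $\gamma>0$ let $\hat r_n = \hat r_n(\gamma)$ be defined by $\hat r_n^d = \frac{\gamma\log n}{\alpha n}$, and let $\delta_n$ denote the minimum vertex degree in $G_n(\hat r_n)$. (i) If $g(r) = o(e^{-cr})$ as $r\to\infty$ for some $c>0$, then for any $\gamma<1$, almost surely $\delta_n\to0$ as $n\to\infty$. (ii) If $g(r) = o(r^{-c})$ as $r\to\infty$ for some $c>d$, then for any $\gamma>1$, almost surely $$\liminf_{n\to\infty} \frac{\delta_n}{\log n} \ge \gamma H_-^{-1}\left(\frac1\gamma\right).$$ (iii) If $g(r) = o(e^{-cr})$ as $r\to\infty$ for some $c>0$, then for any $\gamma>1$, almost surely $$\lim_{n\to\infty} \frac{\delta_n}{\log n} = \gamma H_-^{-1}\left(\frac1\gamma\right).$$ (iv) If $g(r) = o(r^{-c})$ as $r\to\infty$ for some $c>3d$, then for any $\gamma>\frac{c-3d}{c-d}$, almost surely $$\limsup_{n\to\infty} \frac{\delta_n}{\log n} \le \gamma H_-^{-1}\left(\frac{c-3d}{\gamma(c-d)}\right).$$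
   Context: Let $d \ge 2$ and $S = \left(-\frac12,\frac12\right]^d$, equipped with the toroidal metric $d(x,y) = \inf\{|x-y-z| : z \in \mathbb{Z}^d\}$, where $|\cdot|$ is the Euclidean norm. (The letter $d$ denotes the dimension; $d(\cdot,\cdot)$ denotes the metric.) The connection function $g:[0,\infty)\to[0,1]$ is non-increasing with $0 < \alpha := \int_{\mathbb{R}^d} g(|x|)\,dx < \infty$. On one probability space $(\Omega,\mathcal{F},P)$ let $X_1,X_2,\ldots$ be independent and uniformly distributed on $S$; let $\{N_n\}_{n\ge1}$ be a non-decreasing sequence of random variables with $N_n$ Poisson of mean $n$; and let $\{U_{ij}\}$ be independent uniform random variables on $[0,1]$; these three families are independent of each other. Set $\mathcal{P}_n = \{X_1,\ldots,X_{N_n}\}$, a Poisson point process of intensity $n$ on $S$. For $r>0$, $G_n(r)$ is the (undirected) graph with vertex set $\mathcal{P}_n$ in which $X_i,X_j\in\mathcal{P}_n$, $i<j$, are joined by an edge iff $U_{ij} \le g\left(\frac{d(X_i,X_j)}{r}\right)$. The almost sure statements refer to this coupled family of graphs. The function $H:[0,\infty)\to[0,\infty)$ is defined by $H(0)=1$ and $H(x) = 1-x+x\log x$ for $x>0$; it is strictly decreasing on $[0,1]$, strictly increasing on $[1,\infty)$, and $H(1)=0$. $H_-^{-1}:[0,1]\to[0,1]$ is the inverse of the restriction of $H$ to $[0,1]$. *)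

(* Defs.v *)
From HB Require Import structures.
From mathcomp Require Import all_boot all_order all_algebra finmap.
From mathcomp Require Import all_classical all_reals all_analysis.
From mathcomp Require Import lra.

Set Implicit Arguments.
Unset Strict Implicit.
Unset Printing Implicit Defensive.

Import Order.TTheory GRing.Theory Num.Theory.
Import numFieldNormedType.Exports.

Local Open Scope classical_set_scope.
Local Open Scope ring_scope.

(* lets the Landau notations be used with the filter +oo *)
Canonical pinfty_filter_on (R : numFieldType) :=
  @FilterType R (pinfty_nbhs R) _.

(* Points of R^d are d.-tuples of reals, with the product sigma-algebra that
   the library puts on tuples. *)

(* Lebesgue measure on R^n, by recursion on n: the product of the Lebesgue
   measure on the first coordinate and of the one on the remaining n - 1. *)
Fixpoint lebesgue_tuple (R : realType) (n : nat) :
    set (n.-tuple R) -> \bar R :=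
  match n with
  | 0 => fun A => \d_([tuple] : 0.-tuple R) A
  | m.+1 => fun A => (@lebesgue_measure R \x @lebesgue_tuple R m)%E
      [set p : R * m.-tuple R | A [tuple of p.1 :: p.2]]
  end.


Section lebesgue_tuple_measure.
Context (R : realType).

Let pushforward_product d1 d2 d3 (T1 : measurableType d1)
    (T2 : measurableType d2) (T3 : measurableType d3)
    (m1 : {sigma_finite_measure set T1 -> \bar R})
    (m2 : {sigma_finite_measure set T2 -> \bar R})
    (f : T1 * T2 -> T3) (f' : T3 -> T1 * T2) :
  measurable_fun setT f -> measurable_fun setT f' -> cancel f f' ->
  {m : {sigma_finite_measure set T3 -> \bar R} |
     m = (fun A => (m1 \x m2)%E (f @^-1` A)) :> (set T3 -> \bar R)}.
Proof.
move=> mf mf' fK.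
pose mu0 := [the measure _ _ of pushforward (m1 \x m2)%E f].
pose mu : {measure set T3 -> \bar R} := mu0 mf.
have sf : sigma_finite setT mu.
  have [F FT Foo] : sigma_finite setT (m1 \x m2)%E.
    have /sigma_finiteP[F [FT ndF Foo]] := sigma_finiteT m1.
    have /sigma_finiteP[G [GT ndG Goo]] := sigma_finiteT m2.
    exists (fun n => F n `*` G n).
      apply/esym; rewrite -subTset => -[x y] _.
      have [i _ Fx] : (\bigcup_i F i) x by rewrite -FT.
      have [j _ Gy] : (\bigcup_i G i) y by rewrite -GT.
      exists (maxn i j) => //; split => /=.
      - by move: x Fx; exact/subsetPset/ndF/leq_maxl.
      - by move: y Gy; exact/subsetPset/ndG/leq_maxr.
    move=> k; have [? ?] := Foo k; have [? ?] := Goo k.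
    split; first exact: measurableX.
    by rewrite product_measure1E// lte_mul_pinfty// ge0_fin_numE.
  exists (fun k => f' @^-1` F k).
    by rewrite -preimage_bigcup -FT preimage_setT.
  move=> k; have [mF Fk] := Foo k; split.
    by rewrite -[X in measurable X]setTI; exact: mf'.
  rewrite /mu /= /pushforward (_ : _ @^-1` _ = F k)//.
  by apply/seteqP; split => p /=; rewrite fK.
pose mu' : {sigma_finite_measure set T3 -> \bar R} :=
  HB.pack (Measure.sort mu) (Measure.class mu) (Measure_isSigmaFinite.Build _ _ _ _ sf).
by exists mu'.
Qed.

Let lebesgue_tuple_packed n :
  {m : {sigma_finite_measure set (n.-tuple R) -> \bar R} |
     m = @lebesgue_tuple R n :> (set (n.-tuple R) -> \bar R)}.
Proof.
elim: n => [|n [m mE]].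
  by exists (\d_([tuple] : 0.-tuple R)).
have := @pushforward_product _ _ _ (measurableTypeR R) (n.-tuple R)
  (n.+1.-tuple R) lebesgue_measure m
  (fun p => [tuple of p.1 :: p.2])
  (fun t => (thead t, [tuple of behead t])).
case.
- exact: measurable_cons.
- by apply/measurable_fun_pairP; split;
    [exact: measurable_tnth|exact: measurable_behead].
- by move=> [x t]; congr pair; exact/val_inj.
- by move=> mu muE; exists mu; rewrite muE mE.
Qed.

Let lebesgue_tuple0 n : @lebesgue_tuple R n set0 = 0%E.
Proof. by case: (lebesgue_tuple_packed n) => m <-; exact: measure0. Qed.

Let lebesgue_tuple_ge0 n A : (0 <= @lebesgue_tuple R n A)%E.
Proof. by case: (lebesgue_tuple_packed n) => m <-; exact: measure_ge0. Qed.

Let lebesgue_tuple_sigma_additive n :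
  semi_sigma_additive (@lebesgue_tuple R n).
Proof.
by case: (lebesgue_tuple_packed n) => m <-; exact: measure_semi_sigma_additive.
Qed.

HB.instance Definition _ n := isMeasure.Build _ _ _ (@lebesgue_tuple R n)
  (lebesgue_tuple0 n) (@lebesgue_tuple_ge0 n) (@lebesgue_tuple_sigma_additive n).

Let lebesgue_tuple_sigma_finite n : sigma_finite setT (@lebesgue_tuple R n).
Proof. by case: (lebesgue_tuple_packed n) => m <-; exact: sigma_finiteT. Qed.

HB.instance Definition _ n := Measure_isSigmaFinite.Build _ _ _
  (@lebesgue_tuple R n) (lebesgue_tuple_sigma_finite n).

Lemma lebesgue_tuple_box n (A : 'I_n -> set R) :
  (forall i, measurable (A i)) ->
  @lebesgue_tuple R n [set x | forall i, A i (tnth x i)] =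
  (\prod_(i < n) lebesgue_measure (A i))%E.
Proof.
elim: n A => [|n IH] A mA.
  rewrite big_ord0 /= diracE mem_set// => i; by case: i.
rewrite big_ord_recl -IH; last by move=> i; exact: mA.
rewrite -product_measure1E//=.
  congr (product_measure1 _ _ _); apply/seteqP; split => [[x t] /= h|].
    split => /=; first exact: (h ord0).
    by move=> i; have := h (lift ord0 i); rewrite tnthS.
  move=> [x t] [/= h0 h] i.
  have [->//|[j ->]] : i = ord0 \/ exists j, i = lift ord0 j.
    by case: (unliftP ord0 i) => [j|] ->; [right; exists j|left].
  by rewrite tnthS.
  exact: (mA ord0).
rewrite [X in measurable X](_ : _ = \bigcap_(i in [set: 'I_n])
    ((fun x : n.-tuple R => tnth x i) @^-1` A (lift ord0 i))); last first.
  by apply/seteqP; split => x /= h i; [move=> _; exact: h|exact: h].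
apply: fin_bigcap_measurable; first exact: finite_finset.
by move=> i _; rewrite -[X in measurable X]setTI; exact: measurable_tnth.
Qed.

End lebesgue_tuple_measure.

Section torus.
Context (R : realType) (d : nat).
Implicit Types x y : d.-tuple R.

Definition euclidean_norm x : R := Num.sqrt (\sum_(k < d) tnth x k ^+ 2).

Definition torus : set (d.-tuple R) :=
  [set x | forall k, tnth x k \in `]- 2^-1, 2^-1] ].

Lemma lebesgue_tuple_torus : @lebesgue_tuple R d torus = 1%E.
Proof.
rewrite (@lebesgue_tuple_box R d (fun=> `]- 2^-1, 2^-1]%classic)) => [|i].
  apply: big1 => i _; rewrite lebesgue_measure_itv/= lte_fin gtrN ?invr_gt0//.
  by rewrite -EFinB opprK; congr EFin; lra.
exact: measurable_itv.
Qed.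

Definition torus_dist x y : R :=
  inf [set euclidean_norm [tuple tnth x k - tnth y k - (tnth z k)%:~R | k < d]
      | z in [set: d.-tuple int]].

Definition radial_integral (g : R -> R) : \bar R :=
  (\int[@lebesgue_tuple R d]_x (g (euclidean_norm x))%:E)%E.

End torus.

Section independence.
Context disp (T : measurableType disp) (R : realType) (P : probability T R).

Definition sigma_family I disp' (T' : measurableType disp') (D : set I)
    (Y : I -> T -> T') : set (set T) :=
  <<s \bigcup_(i in D) g_sigma_algebra_preimage (Y i) >>.

Definition independent_family (I : choiceType) disp'
    (T' : measurableType disp') (D : set I) (Y : I -> T -> T') : Prop :=
  forall J : {fset I}, [set` J] `<=` D ->
  forall A : I -> set T',
    (forall i, i \in J -> measurable (A i)) ->
    P (\bigcap_(i in [set` J]) Y i @^-1` A i) =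
    (\prod_(i <- J) P (Y i @^-1` A i))%E.

Definition independent3 (F1 F2 F3 : set (set T)) : Prop :=
  forall A1 A2 A3, F1 A1 -> F2 A2 -> F3 A3 ->
    P (A1 `&` A2 `&` A3) = (P A1 * P A2 * P A3)%E.

End independence.

(* The points are numbered from 0: X i is the (i+1)-st point.  Only the values
   N n with n >= 1 and U i j with i < j are constrained. *)
Record coupled_poisson_model (R : realType) (d : nat) disp
    (T : measurableType disp) (P : probability T R)
    (X : nat -> {RV P >-> d.-tuple R}) (N : nat -> {RV P >-> nat})
    (U : nat -> nat -> {RV P >-> R}) : Prop := {
  X_uniform : forall i (A : set (d.-tuple R)), measurable A ->
    distribution P (X i) A = @lebesgue_tuple R d (A `&` @torus R d);
  X_independent : independent_family P [set: nat] (fun i => X i);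
  N_poisson : forall n, (0 < n)%N -> forall k : nat,
    distribution P (N n) [set k] = (poisson_pmf (n%:R : R) k)%:E;
  N_nondecreasing : forall m n, (0 < m)%N -> (m <= n)%N ->
    forall w, (N m w <= N n w)%N;
  U_uniform : forall i j, (i < j)%N -> forall A : set R, measurable A ->
    distribution P (U i j) A = uniform_prob (@ltr01 R) A;
  U_independent : independent_family P [set p : nat * nat | (p.1 < p.2)%N]
    (fun p => U p.1 p.2);
  XNU_independent : independent3 P
    (sigma_family [set: nat] (fun i => X i))
    (sigma_family [set n | (0 < n)%N] (fun n => N n))
    (sigma_family [set p : nat * nat | (p.1 < p.2)%N] (fun p => U p.1 p.2))
}.

Definition degree (V : finType) (e : rel V) (v : V) : nat := #|[pred w | e v w]|.

(* As every degree is at most #|V|, this is the minimum of the degrees,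
   except that it is 0 for the graph without vertices. *)
Definition min_degree (V : finType) (e : rel V) : nat :=
  \big[minn/#|V|]_(v : V) degree e v.

Section geometric_graph.
Context (R : realType) (d : nat) (g : R -> R).

(* Adjacency relation of the graph on the points x 0, ..., x (m - 1), the
   points being identified with their indices. *)
Definition connection_graph (x : nat -> d.-tuple R) (u : nat -> nat -> R)
    (r : R) (m : nat) : rel 'I_m :=
  let edge i j := u i j <= g (torus_dist (x i) (x j) / r) in
  fun i j => ((i < j)%N && edge i j) || ((j < i)%N && edge j i).

Definition rhat (gamma : R) (n : nat) : R :=
  (gamma * ln n%:R / (fine (radial_integral d g) * n%:R)) `^ d%:R^-1.

Definition delta disp (T : measurableType disp) (P : probability T R)
    (X : nat -> {RV P >-> d.-tuple R}) (N : nat -> {RV P >-> nat})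
    (U : nat -> nat -> {RV P >-> R}) (gamma : R) (n : nat) (w : T) : nat :=
  min_degree (@connection_graph (fun i => X i w) (fun i j => U i j w)
    (rhat gamma n) (N n w)).

Lemma rhatX gamma n : (0 < d)%N -> 0 < gamma -> (0 < radial_integral d g)%E ->
  (0 < n)%N ->
  rhat gamma n ^+ d = gamma * ln n%:R / (fine (radial_integral d g) * n%:R).
Proof.
move=> d0 gamma0 a0 n0; rewrite /rhat -powR_mulrn ?powR_ge0// -powRrM.
rewrite mulVf ?pnatr_eq0 -?lt0n// powRr1//.
rewrite divr_ge0 ?mulr_ge0 ?ln_ge0 ?ler1n ?fine_ge0//; exact: ltW.
Qed.

End geometric_graph.

Section rate_function.
Context (R : realType).

Definition rateH (x : R) : R := if x == 0 then 1 else 1 - x + x * ln x.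

(* the inverse of the restriction of rateH to [0, 1] *)
Definition Hinv_minus : R -> R := 'pinv_(fun=> 0) `[0, 1] rateH.

End rate_function.

(* Main.v *)
Require Import Defs.
From HB Require Import structures.
From mathcomp Require Import all_boot all_order all_algebra finmap.
From mathcomp Require Import all_classical all_reals all_analysis.
From mathcomp Require Import measurable_realfun.
From mathcomp Require Import lra ring zify.

(** For gamma > 1 the minimum degree is asymptotic to gamma * h0 * log n, where
h0 in [0, 1] solves rateH h0 = 1/gamma, for the following reason.

The torus is homogeneous: conditionally on the position of a vertex, every other
point is joined to it independently with the same probability
p = link_prob d g r, whatever that position is.  Hence the degree of a vertex
towards m other points is exactly binomial (P_low_degree), and
p = alpha * r^d * (1 + o(1)) as r tends to 0 (link_prob_le, link_prob_ge), so
that at radius rhat the mean degree mu is asymptotic to gamma * log n.  Chernoff and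
Stirling bounds (binom_cdf_le_expR, binom_cdf_ge_expR) show that a given vertex
has degree at most a * mu with probability
exp(- mu * rateH a * (1 + o(1))), that is n to the power - gamma * rateH a.

If gamma * rateH a > 1, the expected number of vertices of degree at most
a * mu tends to 0 (P_some_low_degree).  If gamma * rateH a < 1, this number has
a large mean, and by Chebyshev it is unlikely to vanish (P_no_low_degree) as
soon as two vertices have low degree nearly independently (P_low_pair).  This
near independence is the delicate part.  Conditionally on both centres x and y,
the points are again independent and each is a neighbour of both centres with
probability q = overlap x y.  Two counters, for the neighbours of x and for
those of y that are not neighbours of x, perform a random walk whose kernel is
at most (1 + 4 * q) times a product of two kernels (iter_step2_le_square).
Since the average of q is only p^2 (integral_overlap), the correction is
negligible.

These probabilities are only powers of 1/n, and need not be summable over n.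
They are summable along n = exp(h * k), k = 0, 1, ....  Degrees increase with
the radius and with the set of points while rhat decreases, so one event per k
controls all n between exp(h * (k + 1)) and exp(h * (k + 2)); the random size
N n is within a factor exp h of n for all large n by Poisson concentration.
Borel-Cantelli gives as_min_degree_ge and as_min_degree_le, which are off by
factors exp(O(h)); letting h tend to 0, and a tend to h0 by strict monotonicity
of rateH on [0, 1], yields the asymptotics for gamma > 1.  For gamma < 1 the
level a = 0 is allowed in the upper bound, because rateH 0 = 1: there are
eventually isolated vertices.  In the last statement the target
level b solves rateH b = kappa / gamma with kappa = (c - 3d) / (c - d) < 1, so
that every a > b still satisfies gamma * rateH a < 1. *)

Set Implicit Arguments.
Unset Strict Implicit.
Unset Printing Implicit Defensive.

Import Order.TTheory GRing.Theory Num.Theory.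
Import numFieldNormedType.Exports.

Local Open Scope classical_set_scope.
Local Open Scope ring_scope.

(** * Freezing an independent variable *)

Section freeze.
Local Open Scope ereal_scope.
Context disp (T : measurableType disp) (R : realType) (P : probability T R).
Context disp' (E : measurableType disp') (Z : {RV P >-> E}).
Variables (G : set (set T)).
Hypotheses (mG : G `<=` measurable) (GI : setI_closed G).
Hypothesis (indGZ : forall A B, G A -> measurable B ->
  P (A `&` Z @^-1` B) = P A * P (Z @^-1` B)).

Let sGm : <<s G >> `<=` @measurable _ T.
Proof. exact: smallest_sub (@sigma_algebra_measurable _ T) mG. Qed.

Let indsGZ A B : <<s G >> A -> measurable B ->
  P (A `&` Z @^-1` B) = P A * P (Z @^-1` B).
Proof.
move=> sGA mB.
have mZB : measurable (Z @^-1` B) by rewrite -[_ @^-1` _]setTI; exact/measurable_funP.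
pose m1 : {measure set T -> \bar R} := mrestr P mZB.
pose c : {nonneg R} := NngNum (fine_ge0 (measure_ge0 P (Z @^-1` B))).
pose m2 : {measure set T -> \bar R} := mscale c P.
have cE : c%:num%:E = P (Z @^-1` B) by rewrite /= fineK// fin_num_measure.
suff /(_ _ (erefl _)) : forall A', A' = A -> m1 A' = m2 A'.
  by rewrite /m1 /m2 /= /mrestr /mscale/= => ->; rewrite cE muleC.
move=> _ ->.
pose H := [set X | G X /\ X `<=` setT].
have HG : H = G by apply/seteqP; split => [X []//|X GX]; split.
apply: (g_sigma_algebra_measure_unique_trace G setT) => //.
- by move=> X [/mG].
- by rewrite -/H HG.
- by rewrite /m1 /m2 /= /mrestr /mscale/= setTI probability_setT mule1 cE.
- by move=> X [GX _]; rewrite /m1 /m2 /= /mrestr /mscale/= indGZ// cE muleC.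
- by rewrite /m1 /= /mrestr (le_lt_trans (probability_le1 _ _))// ?ltry//; exact: measurableI.
- by rewrite -/H HG.
Qed.

Let GT : measurableType G.-sigma := g_sigma_algebraType G.

(** Substitution rule for conditional expectation: a variable Z independent of
a sigma-algebra may be integrated out under its own law, the rest being kept
fixed.  This is Fubini once the joint law of the identity, seen as a map into
(T, <<s G >>), and of Z is recognized as a product. *)
Lemma freeze (phi : GT * E -> \bar R) :
  measurable_fun setT phi -> (forall x, 0 <= phi x) ->
  \int[P]_w phi (w, Z w) = \int[P]_w \int[distribution P Z]_z phi (w, z).
Proof.
move=> mphi phi0.
have mid : measurable_fun setT (id : T -> GT).
  by move=> _ A mA; rewrite setTI; exact: sGm.
pose idG : {mfun T >-> GT} :=
  HB.pack (id : T -> GT) (isMeasurableFun.Build _ _ _ _ _ mid).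
have mpr : measurable_fun setT ((fun w => (w, Z w)) : T -> GT * E).
  by apply: measurable_fun_pair; [exact: mid|exact/measurable_funP].
pose pr : {mfun T >-> (GT * E)%type} :=
  HB.pack ((fun w => (w, Z w)) : T -> GT * E)
   (isMeasurableFun.Build _ _ _ _ _ mpr).
have prE X : measurable X -> (distribution P idG \x distribution P Z) X = distribution P pr X.
  apply: product_measure_unique => A B mA mB.
  rewrite /distribution /pushforward /= -indsGZ//.
transitivity (\int[distribution P pr]_x phi x).
  by rewrite ge0_integral_distribution.
transitivity (\int[distribution P idG \x distribution P Z]_x phi x).
  by apply: eq_measure_integral => A mA _; exact/esym/prE.
rewrite fubini_tonelli1// ge0_integral_distribution//.
  exact: measurable_fun_fubini_tonelli_F.
by move=> x; exact: integral_ge0.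
Qed.

End freeze.

(** * Wrapping the real line onto the unit cell *)

Section affine_change_of_variable.
Context (R : realType).
Implicit Types (f : R -> \bar R) (D : set R).
Local Notation lambda := (@lebesgue_measure R).

Lemma measurable_affine (s a : R) : measurable_fun setT (fun t : R => s * t + a).
Proof. by apply: measurable_funD => //; exact: measurable_funM. Qed.

Lemma lebesgue_measure_affine (s a : R) (A : set R) : 0 < s -> measurable A ->
  lambda ((fun t => s * t + a) @^-1` A) = (s^-1%:E * lambda A)%E.
Proof.
move=> s0 mA.
pose k : {nonneg R} := NngNum (ltW s0).
have mh : @measurable_fun _ _ (measurableTypeR R) (measurableTypeR R) setT
  (fun t : R => s * t + a) := measurable_affine s a.
pose pf0 := [the measure _ _ of pushforward lambda
  ((fun t : R => s * t + a) : measurableTypeR R -> measurableTypeR R)].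
pose pf : {measure set (measurableTypeR R) -> \bar R} := pf0 mh.
pose m : {measure set (measurableTypeR R) -> \bar R} := mscale k pf.
have -> : lambda A = m A.
  apply: lebesgue_measure_unique => // _ [[x y] _ <-].
  rewrite /m/= /mscale/= /pushforward /=.
  rewrite (_ : _ @^-1` _ = `](x - a) / s, (y - a) / s]%classic); last first.
    apply/seteqP; split => t /=;
    by rewrite !in_itv/= ltr_pdivrMr// ler_pdivlMr// ltrBlDr lerBrDr mulrC.
  rewrite !lebesgue_measure_itv/= !lte_fin ltr_pM2r ?invr_gt0// ltrD2r.
  case: ifPn => _; last by rewrite mule0.
  by rewrite -!EFinD -EFinM; congr EFin; field; rewrite gt_eqF.
by rewrite /m/= /mscale/= /pushforward /= muleA -EFinM mulVf ?gt_eqF// mul1e.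
Qed.

Lemma integral_affine (s a : R) D f : 0 < s -> measurable D ->
  measurable_fun setT f -> (forall x, 0 <= f x)%E ->
  (\int[lambda]_(t in (fun t => s * t + a)%R @^-1` D) f (s * t + a)%R =
   s^-1%:E * \int[lambda]_(t in D) f t)%E.
Proof.
move=> s0 mD mf f0.
have s0' : 0 <= s^-1 by rewrite invr_ge0 ltW.
pose k : {nonneg R} := NngNum s0'.
rewrite -[LHS](@ge0_integral_pushforward _ _ (measurableTypeR R)
  (measurableTypeR R) R _ (measurable_affine s a) lambda D f)//; last first.
  exact: measurable_funS mf.
rewrite -[RHS](ge0_integral_mscale lambda mD k)//; last exact: measurable_funS mf.
apply: eq_measure_integral => [|? A mA _]; first exact: measurable_affine.
exact: lebesgue_measure_affine.
Qed.

Lemma integral_opp D f : measurable D ->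
  measurable_fun setT f -> (forall x, 0 <= f x)%E ->
  (\int[lambda]_(t in -%R @^-1` D) f (- t)%R = \int[lambda]_(t in D) f t)%E.
Proof.
move=> mD mf f0.
rewrite -[LHS](@ge0_integral_pushforward _ _ (measurableTypeR R)
  (measurableTypeR R) R (-%R) _ lambda D f)//; last first.
  exact: measurable_funS mf.
by apply: eq_measure_integral => A mA _; exact: lebesgue_measureN.
Qed.

(** The ceiling selects the representative in the cell closed on the right. *)
Definition torus_rep (t : R) : R := t - (Num.ceil (t - 2^-1))%:~R.

Lemma torus_rep_itv t : torus_rep t \in `]- 2^-1, 2^-1].
Proof.
rewrite in_itv/= /torus_rep; have /andP[] := ceil_itv (t - 2^-1).
by rewrite rmorphB/= => h1 h2; apply/andP; split; lra.
Qed.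

Lemma torus_rep_id t : t \in `]- 2^-1, 2^-1] -> torus_rep t = t.
Proof.
rewrite in_itv/= => /andP[h1 h2]; rewrite /torus_rep (@ceil_def _ _ 0) ?subr0//.
rewrite sub0r mulrNz mulr0z; apply/andP; split; lra.
Qed.

Lemma torus_repDz t (k : int) : torus_rep (t + k%:~R) = torus_rep t.
Proof.
rewrite /torus_rep (addrAC t k%:~R (- 2^-1)) ceilDrz ?intr_int// intrD intrKceil.
by rewrite opprD addrACA subrr addr0.
Qed.

Lemma measurable_torus_rep : measurable_fun setT torus_rep.
Proof.
apply: measurable_funB => //; apply: nondecreasing_measurable => // x y xy.
by rewrite ler_int le_ceil// lerB.
Qed.

Definition unit_cell : set R := `]- 2^-1, 2^-1]%classic.

(** Invariance of the uniform law of the circle under t |-> a - t.  The image of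
the cell is an interval `[c, c + 1[ up to an integer translation; its part to the
right of 1/2 is moved back by one unit. *)
Lemma integral_torus_rep_sub (a : R) f :
  measurable_fun setT f -> (forall x, 0 <= f x)%E ->
  (\int[lambda]_(t in unit_cell) f (torus_rep (a - t)) =
   \int[lambda]_(t in unit_cell) f t)%E.
Proof.
move=> mf f0; pose F := f \o torus_rep.
have mF : measurable_fun setT F.
  by apply: measurableT_comp => //; exact: measurable_torus_rep.
have F0 x : (0 <= F x)%E by exact: f0.
pose c := torus_rep (a - 2^-1).
have /andP[c1 c2] : - 2^-1 < c <= 2^-1 by have := torus_rep_itv (a - 2^-1); rewrite in_itv.
pose k := Num.ceil (a - 2^-1 - 2^-1).
have ck : c = a - 2^-1 - k%:~R by [].
transitivity (\int[lambda]_(t in `[c, (c + 1)%R[) F t)%E.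
  have := @integral_affine 1 (a - k%:~R) `[c, c + 1[%classic F ltr01 (measurable_itv _) mF F0.
  rewrite invr1 mul1e => <-.
  have m2 : measurable_fun setT (fun t : R => F (1 * t + (a - k%:~R))).
    by apply: (measurableT_comp mF); exact: measurable_affine.
  rewrite -(integral_opp _ m2)//; last by rewrite -[X in measurable X]setTI; exact: measurable_affine.
  rewrite (_ : -%R @^-1` _ = `]- 2^-1, 2^-1]%classic); last first.
    apply/seteqP; split => t /=; rewrite !in_itv/= ck => /andP[h1 h2];
    by apply/andP; split; lra.
  apply: eq_integral => t _; rewrite /F /= -(torus_repDz _ (- k)); congr (f (torus_rep _)).
  by rewrite rmorphN /=; ring.
rewrite (_ : `[c, c + 1[%classic = `[c, 2^-1] `|` `]2^-1, c + 1[); last first.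
  apply/seteqP; split => t /=; rewrite !in_itv/=.
    move=> /andP[h1 h2]; case: (leP t 2^-1) => h; [left|right]; lra.
  by move=> [] /andP[h1 h2]; apply/andP; split; lra.
rewrite ge0_integral_setU//=; first last.
- apply/disj_setPS => t /= []; rewrite !in_itv/= => /andP[_ h] /andP[h' _]; lra.
- exact: measurable_funS mF.
have -> : (\int[lambda]_(t in `](2^-1)%R, (c + 1)%R[) F t =
    \int[lambda]_(t in `](- 2^-1)%R, c[) F t)%E.
  have := @integral_affine 1 1 `]2^-1, c + 1[%classic F ltr01 (measurable_itv _) mF F0.
  rewrite invr1 mul1e => <-.
  rewrite (_ : _ @^-1` _ = `]- 2^-1, c[%classic); last first.
    apply/seteqP; split => t /=; rewrite !in_itv/= => /andP[h1 h2];
    by apply/andP; split; lra.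
  by apply: eq_integral => t _; rewrite mul1r /F /= (torus_repDz t 1).
rewrite addeC -ge0_integral_setU//=; first last.
- apply/disj_setPS => t /= []; rewrite !in_itv/= => /andP[_ h] /andP[h' _]; lra.
- exact: measurable_funS mF.
rewrite (_ : _ `|` _ = `]- 2^-1, 2^-1]%classic); last first.
  apply/seteqP; split => t /=; rewrite !in_itv/=.
    by move=> [] /andP[h1 h2]; apply/andP; split; lra.
  move=> /andP[h1 h2]; case: (ltP t c) => h; [left|right]; lra.
by apply: eq_integral => t /[!inE] tI; rewrite /F/= torus_rep_id.
Qed.

End affine_change_of_variable.

(** * Boxes and coordinatewise changes of variables *)

Section tuple_integrals.
Context (R : realType).
Local Notation lambda := (@lebesgue_measure R).
Local Notation Lambda n := (@lebesgue_tuple R n).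

Definition box n (D : set R) : set (n.-tuple R) := [set x | forall i, D (tnth x i)].
Arguments box : clear implicits.

Lemma measurable_box n D : measurable D -> measurable (box n D).
Proof.
move=> mD.
rewrite [X in measurable X](_ : _ = \bigcap_(i in [set: 'I_n])
    ((fun x : n.-tuple R => tnth x i) @^-1` D)); last first.
  by apply/seteqP; split => x /= h i; [move=> _; exact: h|exact: h].
apply: fin_bigcap_measurable; first exact: finite_finset.
by move=> i _; rewrite -[X in measurable X]setTI; exact: measurable_tnth.
Qed.

Lemma measurable_torus n : measurable (@torus R n).
Proof. by have := @measurable_box n (@unit_cell R) (measurable_itv _). Qed.

Lemma box_cons n D (t : R) (y : n.-tuple R) :
  box n.+1 D [tuple of t :: y] <-> D t /\ box n D y.
Proof.
split => [h|[h0 h] i].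
  by split => [|i]; [exact: (h ord0)|have := h (lift ord0 i); rewrite tnthS].
by case: (unliftP ord0 i) => [j ->|-> //]; rewrite tnthS; exact: h.
Qed.

Lemma integral_tuple_cons n (f : n.+1.-tuple R -> \bar R) :
  measurable_fun setT f -> (forall x, 0 <= f x)%E ->
  (\int[Lambda n.+1]_x f x =
   \int[lambda]_t \int[Lambda n]_y f [tuple of t :: y])%E.
Proof.
move=> mf f0.
have mc : measurable_fun setT (fun p : measurableTypeR R * n.-tuple R =>
   [tuple of p.1 :: p.2] : n.+1.-tuple R) by exact: measurable_cons.
transitivity (\int[pushforward (lambda \x Lambda n)%E (fun p : measurableTypeR R * n.-tuple R =>
   [tuple of p.1 :: p.2] : n.+1.-tuple R)]_x f x)%E.
  exact: eq_measure_integral.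
rewrite (@ge0_integral_pushforward _ _ _ _ R _ mc _ setT f)//=.
rewrite preimage_setT fubini_tonelli1//.
exact: (measurableT_comp mf).
Qed.

Lemma integral_box_cons n D (f : n.+1.-tuple R -> \bar R) :
  measurable D ->
  measurable_fun setT f -> (forall x, 0 <= f x)%E ->
  (\int[Lambda n.+1]_(x in box n.+1 D) f x =
   \int[lambda]_(t in D) \int[Lambda n]_(y in box n D) f [tuple of t :: y])%E.
Proof.
move=> mD mf f0.
rewrite integral_mkcond integral_tuple_cons; last 2 first.
- by apply/(measurable_restrictT _ (measurable_box mD)); exact: measurable_funS mf.
- by move=> x; apply: erestrict_ge0 => y _.
rewrite [RHS]integral_mkcond; apply: eq_integral => t _; rewrite patchE.
case: ifPn => [/[!inE] Dt|].
  rewrite [RHS]integral_mkcond; apply: eq_integral => y _; rewrite !patchE.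
  rewrite (_ : (_ \in box n.+1 D) = (y \in box n D))//.
  by apply/idP/idP; rewrite !inE => h; [case/box_cons: h|exact/box_cons].
rewrite notin_setE => Dt; rewrite integral0_eq// => y _; rewrite patchE.
by rewrite ifF//; apply/negbTE; rewrite notin_setE => /box_cons[].
Qed.

Lemma measurable_map_tuple n (h : nat -> R -> R) :
  (forall k, measurable_fun setT (h k)) ->
  measurable_fun setT (fun x : n.-tuple R => [tuple h k (tnth x k) | k < n]).
Proof.
move=> mh; apply/measurable_fun_tnthP => i.
rewrite (_ : _ \o _ = h i \o (fun x : n.-tuple R => tnth x i)).
  by apply: measurableT_comp => //; exact: measurable_tnth.
by apply/funext => x /=; rewrite tnth_mktuple.
Qed.

(** A map that rescales one-dimensional Lebesgue measure by c in each coordinate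
rescales Lebesgue measure by c ^+ n.  It is used with torus wrapping (c = 1) and
with dilations. *)
Lemma integral_coordinatewise n (D D' : set R) (c : R) (h : nat -> R -> R) :
  0 <= c -> measurable D -> measurable D' ->
  (forall k, measurable_fun setT (h k)) ->
  (forall k f, measurable_fun setT f -> (forall x, 0 <= f x)%E ->
    \int[lambda]_(t in D) f (h k t) = c%:E * \int[lambda]_(t in D') f t)%E ->
  forall f : n.-tuple R -> \bar R,
  measurable_fun setT f -> (forall x, 0 <= f x)%E ->
  (\int[Lambda n]_(x in box n D) f [tuple h k (tnth x k) | k < n] =
   (c ^+ n)%:E * \int[Lambda n]_(x in box n D') f x)%E.
Proof.
move=> c0 mD mD'; elim: n h => [|n IH] h mh hh f mf f0.
  have bT E : box 0 E = setT by apply/seteqP; split => // x _ [].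
  rewrite !bT expr0 mul1e; apply: eq_integral => x _; congr f.
  by apply: eq_from_tnth => -[].
rewrite integral_box_cons//; first last.
  exact: (measurableT_comp mf (measurable_map_tuple mh)).
rewrite integral_box_cons//.
pose Phi t := (\int[Lambda n]_(y in box n D') f [tuple of t :: y])%E.
have mfc t : measurable_fun setT (fun y : n.-tuple R => f [tuple of t :: y]).
  by apply: (measurableT_comp mf); apply: measurable_cons.
have mPhi : measurable_fun setT Phi.
  rewrite (_ : Phi = fubini_F (Lambda n) (fun p : R * n.-tuple R =>
     (if p.2 \in box n D' then f [tuple of p.1 :: p.2] else 0)%E)).
    apply: measurable_fun_fubini_tonelli_F => [|x]; last by case: ifP.
    apply: measurable_fun_ifT => //.
      apply: (measurable_fun_bool true).
      rewrite (_ : _ @^-1` _ = setT `*` box n D'); last first.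
        by apply/seteqP; split => -[x y] /=; [move=> /set_mem|move=> [_ /mem_set]].
      by rewrite setTI; apply: measurableX => //; exact: measurable_box.
    by apply: (measurableT_comp mf); exact: measurable_cons.
  apply/funext => t; rewrite /Phi integral_mkcond /fubini_F.
  by apply: eq_integral => y _; rewrite patchE.
have Phi0 t : (0 <= Phi t)%E by exact: integral_ge0.
transitivity (\int[lambda]_(t in D) ((c ^+ n)%:E * Phi (h 0%N t)))%E.
  apply: eq_integral => t _.
  rewrite -(IH (fun k => h k.+1) (fun k => mh k.+1) (fun k => hh k.+1))//.
  apply: eq_integral => y _; congr f; apply: eq_from_tnth => i.
  rewrite tnth_mktuple; case: (unliftP ord0 i) => [j ->|-> //].
  by rewrite !tnthS tnth_mktuple.
rewrite ge0_integralZl//; last 2 first.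
- by apply: measurable_funTS; apply: (measurableT_comp mPhi); exact: mh.
- by rewrite lee_fin exprn_ge0.
by rewrite hh// muleA -EFinM exprSr.
Qed.

End tuple_integrals.

Arguments box {R} n D.

(** * Geometry of the torus and the connection probability *)

Section torus_geometry.
Context (R : realType) (d : nat).
Implicit Types x y : d.-tuple R.

Lemma euclidean_norm_ge0 x : 0 <= euclidean_norm x.
Proof. exact: sqrtr_ge0. Qed.

Lemma measurable_euclidean_norm : measurable_fun setT (@euclidean_norm R d).
Proof.
apply: (@measurableT_comp _ _ _ _ _ _ (@Num.sqrt R)).
  by apply: nondecreasing_measurable => // a b; exact: ler_wsqrtr.
apply: measurable_sum => i; apply: measurable_funX; exact: measurable_tnth.
Qed.

Lemma euclidean_normZ (s : R) x : 0 <= s ->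
  euclidean_norm [tuple s * tnth x k | k < d] = s * euclidean_norm x.
Proof.
move=> s0; rewrite /euclidean_norm.
under eq_bigr do rewrite tnth_mktuple exprMn.
by rewrite -mulr_sumr sqrtrM ?sqr_ge0// sqrtr_sqr ger0_norm.
Qed.

Lemma le_normr_torus_rep (t : R) (z : int) : `|torus_rep t| <= `|t - z%:~R|.
Proof.
have := torus_rep_itv t; rewrite in_itv/= => /andP[w1 w2].
have -> : t - z%:~R = torus_rep t + (Num.ceil (t - 2^-1) - z)%:~R.
  by rewrite /torus_rep rmorphB /=; ring.
set m := (_ - z); have [->|m0] := eqVneq m 0; first by rewrite mulr0z addr0.
have m1 : 1 <= `|m%:~R : R| by rewrite -intr_norm ler1z -gtz0_ge1 normr_gt0.
have w : `|torus_rep t| <= 2^-1 by rewrite ler_norml; apply/andP; split; lra.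
have := lerB_normD (m%:~R : R) (torus_rep t); rewrite (addrC (m%:~R)) => h; lra.
Qed.

(** The squared norm is a sum over coordinates, and in each coordinate the
wrapped difference is the shortest of the lattice translates; the infimum is
therefore attained. *)
Lemma torus_distE x y : torus_dist x y =
  euclidean_norm [tuple torus_rep (tnth x k - tnth y k) | k < d].
Proof.
rewrite /torus_dist; set S := (X in inf X).
have Slb : lbound S (euclidean_norm [tuple torus_rep (tnth x k - tnth y k) | k < d]).
  move=> _ [z _ <-]; rewrite /euclidean_norm ler_wsqrtr// ler_sum// => i _.
  rewrite !tnth_mktuple -[leLHS]real_normK ?num_real// -[leRHS]real_normK ?num_real//.
  by rewrite lerXn2r ?nnegrE//; exact: le_normr_torus_rep.
have Sm : S (euclidean_norm [tuple torus_rep (tnth x k - tnth y k) | k < d]).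
  exists [tuple Num.ceil (tnth x k - tnth y k - 2^-1) | k < d] => //.
  by congr euclidean_norm; apply: eq_from_tnth => i; rewrite !tnth_mktuple.
apply/eqP; rewrite eq_le; apply/andP; split.
  by apply: ge_inf => //; exists (euclidean_norm [tuple torus_rep (tnth x k - tnth y k) | k < d]).
by apply: lb_le_inf => //; exists (euclidean_norm [tuple torus_rep (tnth x k - tnth y k) | k < d]).
Qed.

Lemma torus_dist_ge0 x y : 0 <= torus_dist x y.
Proof. by rewrite torus_distE euclidean_norm_ge0. Qed.

Lemma torus_distC x y : torus_dist x y = torus_dist y x.
Proof.
rewrite /torus_dist; congr inf; apply/seteqP.
have H (a b : d.-tuple R) z : euclidean_norm
    [tuple tnth a k - tnth b k - (tnth z k)%:~R | k < d] = euclidean_norm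
    [tuple tnth b k - tnth a k -
      (tnth ([tuple - tnth z k | k < d] : d.-tuple int) k)%:~R | k < d].
  rewrite /euclidean_norm; congr Num.sqrt; apply: eq_bigr => i _.
  by rewrite !tnth_mktuple rmorphN /=; ring.
by split => _ [z _ <-]; exists [tuple - tnth z k | k < d] => //; rewrite -H.
Qed.

Lemma measurable_torus_dist :
  measurable_fun setT (fun p : d.-tuple R * d.-tuple R => torus_dist p.1 p.2).
Proof.
under eq_fun do rewrite torus_distE.
apply: (measurableT_comp measurable_euclidean_norm).
apply/measurable_fun_tnthP => i.
rewrite (_ : _ \o _ = @torus_rep R \o (fun p : d.-tuple R * d.-tuple R => tnth p.1 i - tnth p.2 i)).
  apply: (measurableT_comp (@measurable_torus_rep R)).
  by apply: measurable_funB; apply: (measurableT_comp (measurable_tnth i)).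
by apply/funext => x /=; rewrite tnth_mktuple.
Qed.

(** Homogeneity of the torus: the wrapped reflection y |-> x - y preserves
Lebesgue measure on the torus, so integrals of functions of the distance to x do
not depend on x. *)
Lemma integral_torus_dist x (f : R -> \bar R) :
  measurable_fun setT f -> (forall t, 0 <= f t)%E ->
  (\int[@lebesgue_tuple R d]_(y in @torus R d) f (torus_dist x y) =
   \int[@lebesgue_tuple R d]_(u in @torus R d) f (euclidean_norm u))%E.
Proof.
move=> mf f0.
have := @integral_coordinatewise R d (@unit_cell R) (@unit_cell R) 1
  (fun k t => torus_rep (nth 0 x k - t)) ler01 (measurable_itv _) (measurable_itv _).
move=> /(_ _ _ (fun u => f (euclidean_norm u))).
rewrite expr1n mul1e => <-//.
- by apply: eq_integral => y _; rewrite torus_distE; do 2 congr (_ _);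
    apply: eq_from_tnth => i; rewrite !tnth_mktuple (tnth_nth 0 x).
- by move=> k; apply: (measurableT_comp (@measurable_torus_rep R)); exact: measurable_funB.
- by move=> k h mh h0; rewrite mul1e integral_torus_rep_sub.
- by apply: (measurableT_comp mf); exact: measurable_euclidean_norm.
Qed.

End torus_geometry.

Section connection_probability.
Context (R : realType) (d : nat) (g : R -> R).
Hypotheses (g01 : forall x : R, 0 <= x -> 0 <= g x <= 1)
  (g_noninc : forall x y : R, 0 <= x -> x <= y -> g y <= g x)
  (alpha_pos : (0 < radial_integral d g)%E)
  (alpha_fin : (radial_integral d g < +oo)%E).
Local Notation Lambda := (@lebesgue_tuple R d).
Local Notation S := (@torus R d).

(** Nothing is known of g on the negative half-line; h agrees with g where g is
evaluated and is monotone, hence measurable, everywhere. *)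
Let h (t : R) := g (Num.max t 0).

Let hE t : 0 <= t -> h t = g t.
Proof. by move=> t0; rewrite /h max_l. Qed.

Let h01 t : 0 <= h t <= 1.
Proof. by apply: g01; rewrite le_max lexx orbT. Qed.

Let mh : measurable_fun setT h.
Proof.
apply: nonincreasing_measurable => // a b ab; apply: g_noninc.
  by rewrite le_max lexx orbT.
by rewrite ge_max !le_max ab lexx orbT.
Qed.

Definition link (r : R) (x y : d.-tuple R) : R := g (torus_dist x y / r).

Lemma link01 r x y : 0 < r -> 0 <= link r x y <= 1.
Proof. by move=> r0; apply: g01; rewrite divr_ge0 ?torus_dist_ge0// ltW. Qed.

Lemma measurable_link r : 0 < r ->
  measurable_fun setT (fun p : d.-tuple R * d.-tuple R => link r p.1 p.2).
Proof.
move=> r0; rewrite (_ : (fun _ => _) = (fun p => h (torus_dist p.1 p.2 / r))).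
  apply: (measurableT_comp mh); apply: measurable_funM => //.
  exact: measurable_torus_dist.
by apply/funext => p; rewrite hE// divr_ge0 ?torus_dist_ge0// ltW.
Qed.

(** The vertex is placed at the origin, where the distance on the torus is the
Euclidean norm; by integral_link this is the conditional probability of an edge
given either end. *)
Definition link_prob (r : R) : R :=
  fine (\int[Lambda]_(u in S) (g (euclidean_norm u / r))%:E).

Let msc r : measurable_fun setT (fun t : R => (h (t / r))%:E).
Proof. by apply/measurable_EFinP; apply: (measurableT_comp mh); exact: measurable_funM. Qed.

Let mng r : measurable_fun setT (fun u : d.-tuple R => (h (euclidean_norm u / r))%:E).
Proof. by apply: (measurableT_comp (msc r)); exact: measurable_euclidean_norm. Qed.

Let gh r (D : set (d.-tuple R)) : 0 <= r ->
  (\int[Lambda]_(u in D) (g (euclidean_norm u / r))%:E =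
  \int[Lambda]_(u in D) (h (euclidean_norm u / r))%:E)%E.
Proof.
by move=> r0; apply: eq_integral => u _; rewrite hE// divr_ge0// euclidean_norm_ge0.
Qed.

Lemma link_prob_integral r : 0 < r ->
  (\int[Lambda]_(u in S) (g (euclidean_norm u / r))%:E = (link_prob r)%:E)%E.
Proof.
move=> r0; rewrite /link_prob fineK// ge0_fin_numE; last first.
  by apply: integral_ge0 => u _; rewrite lee_fin; case/andP: (g01 (divr_ge0 (euclidean_norm_ge0 u) (ltW r0))).
apply: (@le_lt_trans _ _ (\int[Lambda]_(u in S) 1)%E).
  rewrite (gh _ (ltW r0)); apply: ge0_le_integral => //.
  - exact: (@measurable_torus R d).
  - by move=> u _; rewrite lee_fin; case/andP: (h01 (euclidean_norm u / r)).
  - exact: measurable_funTS.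
  - by move=> u _; rewrite lee_fin; case/andP: (h01 (euclidean_norm u / r)).
by rewrite (integral_cst _ (@measurable_torus R d)) mul1e [X in (X < _)%E](lebesgue_tuple_torus R d) ltry.
Qed.

Lemma link_prob_ge0 r : 0 < r -> 0 <= link_prob r.
Proof.
move=> r0; rewrite -lee_fin -link_prob_integral//; apply: integral_ge0 => u _.
by rewrite lee_fin; case/andP: (g01 (divr_ge0 (euclidean_norm_ge0 u) (ltW r0))).
Qed.

Lemma integral_link r x : 0 < r ->
  (\int[Lambda]_(y in S) (link r x y)%:E = (link_prob r)%:E)%E.
Proof.
move=> r0; rewrite -link_prob_integral// (gh _ (ltW r0)).
rewrite -(@integral_torus_dist _ _ x (fun t => (h (t / r))%:E))//.
  apply: eq_integral => y _; rewrite hE// divr_ge0 ?torus_dist_ge0// ltW//.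
by move=> t; rewrite lee_fin; case/andP: (h01 (t / r)).
Qed.

Let alpha := fine (radial_integral d g).

Let alphaE : radial_integral d g = (\int[Lambda]_u (h (euclidean_norm u / 1))%:E)%E.
Proof.
by rewrite -gh//; apply: eq_integral => u _; rewrite divr1.
Qed.

Let alphaK : alpha%:E = radial_integral d g.
Proof. by rewrite fineK// ge0_fin_numE// ltW. Qed.

(* A dilation is written as an affine map with zero constant term in order to
   use the affine change of variable. *)
Let scale (r : R) (D : set R) : 0 < r -> measurable D ->
  (\int[Lambda]_(u in box d ((fun t : R => r^-1 * t + 0)%R @^-1` D))
     (h (euclidean_norm u / r))%:E =
  (r ^+ d)%:E * \int[Lambda]_(u in box d D) (h (euclidean_norm u / 1))%:E)%E.
Proof.
move=> r0 mD.
have mD' : measurable ((fun t : R => r^-1 * t + 0) @^-1` D).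
  by rewrite -[X in measurable X]setTI; exact: measurable_affine.
have := @integral_coordinatewise R d _ _ r (fun (k : nat) (t : R) => r^-1 * t + 0) (ltW r0) mD' mD.
move=> /(_ _ _ (fun u => (h (euclidean_norm u / 1))%:E)) <-.
- apply: eq_integral => u _; rewrite divr1.
  under eq_mktuple do rewrite addr0.
  by rewrite euclidean_normZ ?invr_ge0 ?ltW// mulrC.
- by move=> k; exact: measurable_affine.
- move=> k f mf f0; rewrite (integral_affine _ _ mD mf f0) ?invr_gt0//.
  by rewrite invrK.
- exact: mng.
- by move=> u; rewrite lee_fin; case/andP: (h01 (euclidean_norm u / 1)).
Qed.

Let h0 r (u : d.-tuple R) : (0 <= (h (euclidean_norm u / r))%:E)%E.
Proof. by rewrite lee_fin; case/andP: (h01 (euclidean_norm u / r)). Qed.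

(** The torus is contained in R^d, where the integral is alpha * r ^+ d by
dilation. *)
Lemma link_prob_le r : 0 < r -> link_prob r <= alpha * r ^+ d.
Proof.
move=> r0; rewrite -lee_fin -link_prob_integral// (gh _ (ltW r0)) EFinM muleC alphaK alphaE.
have := @scale r setT r0 measurableT; rewrite preimage_setT.
have -> : box d (setT : set R) = setT by apply/seteqP.
move=> <-; apply: ge0_subset_integral => //.
- exact: (@measurable_torus R d).
Qed.

(** The torus dilated by 1/r exhausts R^d as r tends to 0, so that monotone
convergence gives the matching lower bound. *)
Lemma link_prob_ge (e : R) : 0 < e -> exists2 r0 : R, 0 < r0 &
  forall r, 0 < r -> r < r0 -> (1 - e) * alpha * r ^+ d <= link_prob r.
Proof.
move=> e0.
pose F (n : nat) : set (d.-tuple R) := box d `]- n%:R, n%:R]%classic.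
have mF n : measurable (F n) by apply: measurable_box; exact: measurable_itv.
have ndF : nondecreasing_seq F.
  move=> m n mn; rewrite subsetEset => u uF i; have := uF i; rewrite /= !in_itv/=.
  have : (m%:R : R) <= n%:R by rewrite ler_nat.
  by move=> ? /andP[? ?]; apply/andP; split; lra.
have UF : \bigcup_n F n = setT.
  apply/seteqP; split => // u _.
  pose b := \sum_(i < d) `|tnth u i|.
  exists (Num.truncn b).+1 => // i.
  have ub : `|tnth u i| <= b by rewrite /b (bigD1 i)//= lerDl sumr_ge0.
  have := truncnS_gt b => bt.
  have : `|tnth u i| < (Num.truncn b).+1%:R by exact: le_lt_trans bt.
  by rewrite ltr_norml /= in_itv/= => /andP[-> /ltW].
have cv := @ge0_nondecreasing_set_cvg_integral _ _ R F
   (fun u => (h (euclidean_norm u / 1))%:E) Lambda ndF mF.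
rewrite UF -alphaE -alphaK in cv.
have {}cv := cv (fun n => measurable_funTS (mng 1)) (fun n u _ => h0 1 u).
have alpha0 : 0 < alpha by rewrite -lte_fin alphaK.
have : \forall n \near \oo, (((1 - e) * alpha)%:E <=
   \int[Lambda]_(u in F n) (h (euclidean_norm u / 1))%:E)%E.
  have lt1 : (((1 - e) * alpha)%:E < alpha%:E)%E.
    by rewrite lte_fin mulrBl mul1r ltrBlDr ltrDl mulr_gt0.
  by have [m _ mP] := cv _ (open_ereal_gt' lt1); exists m => // n /mP /ltW.
move=> [n _ /(_ n (leqnn n)) nP].
exists ((2 * n.+1%:R)^-1); first by rewrite invr_gt0 mulr_gt0.
move=> r r0 rn; rewrite -lee_fin -link_prob_integral// (gh _ (ltW r0)).
rewrite mulrC EFinM.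
apply: (@le_trans _ _ ((r ^+ d)%:E * \int[Lambda]_(u in F n) (h (euclidean_norm u / 1))%:E)%E).
  by apply: lee_wpmul2l nP; rewrite lee_fin exprn_ge0// ltW.
rewrite -scale//.
apply: ge0_subset_integral => //.
- apply: measurable_box; rewrite -[X in measurable X]setTI; exact: measurable_affine.
- exact: (@measurable_torus R d).
- exact: measurable_funTS.
- move=> u uF i; have := uF i; rewrite /= !in_itv/= addr0.
  rewrite mulrC ltr_pdivlMr// ler_pdivrMr// => /andP[h1 h2].
  have nr : n%:R * r < 2^-1.
    have : r * (2 * n.+1%:R) < 1 by rewrite -ltr_pdivlMr ?mulr_gt0// div1r.
    by rewrite -[n.+1%:R]natr1 => ?; lra.
  by apply/andP; split; lra.
Qed.

End connection_probability.

(** * The sigma-algebra of all coordinates but one *)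

Section coordinates.
Context (R : realType) (d : nat) disp (T : measurableType disp)
  (P : probability T R) (X : nat -> {RV P >-> d.-tuple R})
  (N : nat -> {RV P >-> nat}) (U : nat -> nat -> {RV P >-> R})
  (model : coupled_poisson_model X N U).

(** Cylinders constrain positions and edge marks jointly.  Those that leave one
coordinate free form a pi-system which generates the sigma-algebra of all other
coordinates, and which is independent of the free coordinate. *)
Definition cylinder (E : nat -> set (d.-tuple R)) (F : nat * nat -> set R)
    : set T :=
  [set w | (forall i, E i (X i w)) /\ (forall p, F p (U p.1 p.2 w))].

(** J and K are the finite supports of the constraints; the marks U i j are
constrained only for i < j. *)
Definition cylinder_base (J : {fset nat}) (K : {fset nat * nat})
    (E : nat -> set (d.-tuple R)) (F : nat * nat -> set R) : Prop :=
  [/\ forall i, measurable (E i), forall p, measurable (F p),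
      forall i, i \notin J -> E i = setT, forall p, p \notin K -> F p = setT
    & forall p, p \in K -> (p.1 < p.2)%N].

Definition coordinate := (nat + nat * nat)%type.

Definition cylinders_avoiding (c : coordinate) : set (set T) :=
  [set A | exists J K E F, [/\ cylinder_base J K E F,
     match c with inl i => i \notin J | inr p => p \notin K end
     & A = cylinder E F]].

Lemma cylinderE J K E F : cylinder_base J K E F ->
  cylinder E F = (\bigcap_(i in [set` J]) X i @^-1` E i) `&`
                 (\bigcap_(p in [set` K]) U p.1 p.2 @^-1` F p).
Proof.
move=> [_ _ ET FT _]; apply/seteqP; split => w /= [h1 h2]; split => [i|i] //=.
- have [iJ|iJ] := boolP (i \in J); first exact: h1.
  by rewrite ET.
- have [iJ|iJ] := boolP (i \in K); first exact: h2.
  by rewrite FT.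
Qed.

Lemma sigma_family_bigcap (I : choiceType) d' (T' : measurableType d')
    (D : set I) (Y : I -> {RV P >-> T'}) (J : {fset I}) (A : I -> set T') :
  [set` J] `<=` D -> (forall i, measurable (A i)) ->
  sigma_family D (fun i => Y i : T -> T') (\bigcap_(i in [set` J]) Y i @^-1` A i).
Proof.
move=> JD mA.
have := @fin_bigcap_measurable _ (g_sigma_algebraType
  (\bigcup_(i in D) g_sigma_algebra_preimage (Y i : T -> T'))) I [set` J]
  (fun i => Y i @^-1` A i) (finite_fset J).
apply => i iJ; apply: sub_sigma_algebra; exists i; first exact: JD.
by exists (A i) => //; rewrite setTI.
Qed.

(** Joint independence of all coordinates, from the independence within each
family and between the families. *)
Lemma P_cylinder J K E F : cylinder_base J K E F ->
  P (cylinder E F) = (\prod_(i <- J) P (X i @^-1` E i) *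
                     \prod_(p <- K) P (U p.1 p.2 @^-1` F p))%E.
Proof.
move=> b; rewrite (cylinderE b); case: b => mE mF ET FT K12.
have sK : [set` K] `<=` [set p : nat * nat | (p.1 < p.2)%N] by move=> p /= /K12.
rewrite -(X_independent model)//.
rewrite -(U_independent model)//.
have := XNU_independent model (A1 := \bigcap_(i in [set` J]) X i @^-1` E i)
  (A2 := setT) (A3 := \bigcap_(i in [set` K]) (U i.1 i.2) @^-1` (F i)).
rewrite setIT probability_setT mule1; apply.
- exact: (@sigma_family_bigcap _ _ _ _ X).
- exact: (@measurableT _ (g_sigma_algebraType _)).
- exact: (@sigma_family_bigcap _ _ _ _ (fun p => U p.1 p.2)).
Qed.

Lemma measurable_cylinder J K E F : cylinder_base J K E F ->
  measurable (cylinder E F).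
Proof.
move=> b; rewrite (cylinderE b); case: b => mE mF _ _ _.
apply: measurableI; (apply: fin_bigcap_measurable; first exact: finite_fset);
  move=> i _; rewrite -[X in measurable X]setTI; exact: measurable_funP.
Qed.

Lemma cylinders_avoiding_measurable c : cylinders_avoiding c `<=` measurable.
Proof. by move=> _ [J [K [E [F [b _ ->]]]]]; exact: measurable_cylinder b. Qed.

Lemma cylinders_avoiding_setI c : setI_closed (cylinders_avoiding c).
Proof.
move=> _ _ [J [K [E [F [[mE mF ET FT K12] cJ ->]]]]]
  [J' [K' [E' [F' [[mE' mF' ET' FT' K12'] cJ' ->]]]]].
exists (J `|` J')%fset, (K `|` K')%fset,
  (fun i => E i `&` E' i), (fun p => F p `&` F' p); split.
- split => [i|p|i|p|p]; rewrite ?in_fsetU ?negb_or.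
  + exact: measurableI.
  + exact: measurableI.
  + by move=> /andP[? ?]; rewrite ET// ET'// setIT.
  + by move=> /andP[? ?]; rewrite FT// FT'// setIT.
  + by move=> /orP[/K12|/K12'].
- by case: c cJ cJ' => [i|p] h h'; rewrite in_fsetU negb_or h.
- apply/seteqP; split => w; rewrite /cylinder/=.
    by move=> [[h1 h2] [h3 h4]]; split.
  move=> [h1 h2]; split; split => i; by [case: (h1 i)|case: (h2 i)].
Qed.

Lemma cylinders_avoiding_X i A B : cylinders_avoiding (inl i) A ->
  measurable B -> P (A `&` X i @^-1` B) = (P A * P (X i @^-1` B))%E.
Proof.
move=> [J [K [E [F [b iJ ->]]]]] mB.
have [mE mF ET FT K12] := b.
have Ei k : k \in J -> (if k == i then B else E k) = E k.
  by case: eqP => // -> ; rewrite (negbTE iJ).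
have b' : cylinder_base (i |` J)%fset K (fun k => if k == i then B else E k) F.
  split => //= k; first by case: eqP.
  by rewrite in_fset1U negb_or => /andP[/negbTE -> /ET].
rewrite (_ : _ `&` _ = cylinder (fun k => if k == i then B else E k) F).
  rewrite (P_cylinder b') (P_cylinder b) big_fsetU1//= eqxx.
  rewrite [X in (_ * X * _)%E = _](_ : _ = \prod_(k <- J) P (X k @^-1` E k))%E.
    by rewrite -muleA muleC.
  by apply: eq_big_seq => k /Ei ->.
apply/seteqP; split => w; rewrite /cylinder/=.
  by move=> [[h1 h2] h3]; split => // k; case: eqP => // ->.
move=> [h1 h2]; split; last by have := h1 i; rewrite eqxx.
by split => // k; have := h1 k; case: eqP => [->|//]; rewrite ET.
Qed.

Lemma cylinders_avoiding_U p A B : (p.1 < p.2)%N ->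
  cylinders_avoiding (inr p) A ->
  measurable B ->
  P (A `&` U p.1 p.2 @^-1` B) = (P A * P (U p.1 p.2 @^-1` B))%E.
Proof.
move=> p12 [J [K [E [F [b pK ->]]]]] mB.
have [mE mF ET FT K12] := b.
have Fp k : k \in K -> (if k == p then B else F k) = F k.
  by case: eqP => // -> ; rewrite (negbTE pK).
have b' : cylinder_base J (p |` K)%fset E (fun k => if k == p then B else F k).
  split => //= k; first by case: eqP.
    by rewrite in_fset1U negb_or => /andP[/negbTE -> /FT].
  by rewrite in_fset1U => /orP[/eqP ->//|/K12].
rewrite (_ : _ `&` _ = cylinder E (fun k => if k == p then B else F k)).
  rewrite (P_cylinder b') (P_cylinder b) big_fsetU1//= eqxx.
  rewrite [X in (_ * (_ * X))%E = _](_ : _ =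
    \prod_(p <- K) P (U p.1 p.2 @^-1` F p))%E.
    by rewrite -muleA; congr (_ * _)%E; rewrite muleC.
  by apply: eq_big_seq => k /Fp ->.
apply/seteqP; split => w; rewrite /cylinder/=.
  by move=> [[h1 h2] h3]; split => // k; case: eqP => // ->.
move=> [h1 h2]; split; last by have := h2 p; rewrite eqxx.
by split => // k; have := h2 k; case: eqP => [->|//]; rewrite FT.
Qed.

Local Notation avoiding c := (g_sigma_algebraType (cylinders_avoiding c)).

Lemma measurable_avoiding_X c i : c != inl i ->
  measurable_fun setT (X i : avoiding c -> d.-tuple R).
Proof.
move=> ci _ A mA; rewrite setTI; apply: sub_sigma_algebra.
exists [fset i]%fset, fset0, (fun k => if k == i then A else setT), (fun=> setT).
split.
- split => //= k; first by case: ifP.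
  by rewrite in_fset1 => /negbTE ->.
- by case: c ci => // k; rewrite in_fset1; apply: contra => /eqP ->.
- apply/seteqP; split => w; rewrite /cylinder/=.
    by move=> Aw; split => // k; case: eqP => // ->.
  by move=> [/(_ i)]; rewrite eqxx.
Qed.

Lemma measurable_avoiding_U c p : (p.1 < p.2)%N -> c != inr p ->
  measurable_fun setT (U p.1 p.2 : avoiding c -> R).
Proof.
move=> p12 cp _ A mA; rewrite setTI; apply: sub_sigma_algebra.
exists fset0, [fset p]%fset, (fun=> setT), (fun k => if k == p then A else setT).
split.
- split => //= k; first by case: ifP.
    by rewrite in_fset1 => /negbTE ->.
  by rewrite in_fset1 => /eqP ->.
- by case: c cp => // k; rewrite in_fset1; apply: contra => /eqP ->.
- apply/seteqP; split => w; rewrite /cylinder/=.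
    by move=> Aw; split => // k; case: eqP => // ->.
  by move=> [_ /(_ p)]; rewrite eqxx.
Qed.

(** The position of one point may be integrated over the torus in any expression
whose other ingredients do not involve that point. *)
Lemma freeze_X i (phi : avoiding (inl i) * d.-tuple R -> \bar R) :
  measurable_fun setT phi -> (forall x, 0 <= phi x)%E ->
  (\int[P]_w phi (w, X i w) =
   \int[P]_w \int[@lebesgue_tuple R d]_(x in @torus R d) phi (w, x))%E.
Proof.
move=> mphi phi0; rewrite (@freeze _ _ _ P _ _ (X i) (cylinders_avoiding (inl i)))//.
- apply: eq_integral => w _.
  have mw : measurable_fun setT (fun x => phi (w, x)).
    by apply: (measurableT_comp mphi); exact: measurable_fun_pair.
  have mS := @measurable_torus R d.
  have P0 : distribution P (X i) (~` @torus R d) = 0%E.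
    rewrite (X_uniform model); last exact: measurableC.
    by rewrite setICl measure0.
  rewrite (@ge0_negligible_integral _ _ _ _ setT (~` @torus R d))//; last first.
    exact: measurableC.
  rewrite setTD setCK; apply: eq_measure_integral => A mA AS.
  transitivity (@lebesgue_tuple R d (A `&` @torus R d)); last by rewrite setIidl.
  exact: (X_uniform model i mA).
- exact: cylinders_avoiding_measurable.
- exact: cylinders_avoiding_setI.
- by move=> A B; exact: cylinders_avoiding_X.
Qed.

Lemma uniform_prob_le (a : R) : 0 <= a <= 1 ->
  uniform_prob (@ltr01 R) `]-oo, a]%classic = a%:E.
Proof.
move=> /andP[a0 a1]; rewrite /uniform_prob integral_uniform_pdf.
rewrite (_ : _ `&` _ = `[0, a]%classic); last first.
  apply/seteqP; split => x /=; rewrite !in_itv/=.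
    by move=> [h1 /andP[h2 h3]]; apply/andP; split; lra.
  by move=> /andP[h1 h2]; split; [|apply/andP; split]; lra.
rewrite (eq_integral (cst 1%E)); last first.
  move=> x; rewrite inE/= in_itv/= => /andP[h1 h2].
  by rewrite /uniform_pdf h1 (le_trans h2 a1) subr0 invr1.
rewrite integral_cst; last exact: measurable_itv.
rewrite mul1e [LHS]lebesgue_measure_itv/= lte_fin; case: ltP => h; first by rewrite oppr0 addr0.
by congr EFin; lra.
Qed.

(** Revealing one edge mark replaces a test against the threshold thr by the
corresponding convex combination. *)
Lemma freeze_U p (thr f1 f0 : avoiding (inr p) -> R) : (p.1 < p.2)%N ->
  measurable_fun setT thr -> measurable_fun setT f1 -> measurable_fun setT f0 ->
  (forall w, 0 <= thr w <= 1) -> (forall w, 0 <= f1 w) -> (forall w, 0 <= f0 w) ->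
  (\int[P]_w (if U p.1 p.2 w <= thr w then f1 w else f0 w)%:E =
   \int[P]_w (thr w * f1 w + (1 - thr w) * f0 w)%:E)%E.
Proof.
move=> p12 mt m1 m0 t01 f1_ge0 f0_ge0.
pose phi (z : avoiding (inr p) * R) : \bar R :=
  (if z.2 <= thr z.1 then f1 z.1 else f0 z.1)%:E.
have phi0 z : (0 <= phi z)%E by rewrite /phi lee_fin; case: ifP.
have mphi : measurable_fun setT phi.
  apply/measurable_EFinP; apply: measurable_fun_ifT.
  - by apply: measurable_fun_ler => //; exact: measurableT_comp.
  - exact: measurableT_comp.
  - exact: measurableT_comp.
rewrite -[LHS]/(\int[P]_w phi (w, U p.1 p.2 w))%E.
rewrite (@freeze _ _ _ P _ _ (U p.1 p.2) (cylinders_avoiding (inr p)))//.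
- apply: eq_integral => w _.
  have mw : measurable_fun setT (fun z : R => phi (w, z)).
    by apply: (measurableT_comp mphi); exact: measurable_fun_pair.
  pose A := `]-oo, thr w]%classic.
  have mA : measurable A by exact: measurable_itv.
  have DA : distribution P (U p.1 p.2) A = (thr w)%:E.
    by rewrite (U_uniform model)// uniform_prob_le.
  have DAc : distribution P (U p.1 p.2) (~` A) = (1 - thr w)%:E.
    by rewrite probability_setC// EFinB -DA.
  rewrite -(setUv A) ge0_integral_setU//=; first last.
  + by apply/disj_setPS; rewrite setICr.
  + exact: measurable_funTS mw.
  + exact: measurableC.
  rewrite (eq_integral (cst (f1 w)%:E)); last first.
    by move=> z; rewrite inE /A/= in_itv/= /phi/= => ->.
  rewrite [X in (_ + X)%E](eq_integral (cst (f0 w)%:E)); last first.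
    by move=> z; rewrite inE /A/= in_itv/= /phi/= => /negP/negbTE ->.
  rewrite !integral_cst//; last exact: measurableC.
  transitivity ((f1 w)%:E * (thr w)%:E + (f0 w)%:E * (1 - thr w)%:E)%E.
    by congr (_ * _ + _ * _)%E.
  by rewrite -!EFinM -EFinD mulrC [X in _ + X]mulrC.
- exact: cylinders_avoiding_measurable.
- exact: cylinders_avoiding_setI.
- by move=> A B; exact: cylinders_avoiding_U.
Qed.

End coordinates.

(** * Binomial and coupled binomial chains *)

Section binomial_chains.
Context (R : realType).
Implicit Types (p q : R) (phi : nat -> R).

(** One step of the binomial counter acting on functions: iterating it m times
gives the expectation of phi at a counter started from c. *)
Definition step1 p phi (c : nat) : R := p * phi c.+1 + (1 - p) * phi c.

Definition low (t c : nat) : R := (c <= t)%N%:R.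

(** Distribution function of the binomial law, in the backward form that the
exploration of the neighbours of a vertex produces. *)
Definition binom_cdf p (m t : nat) : R := iter m (step1 p) (low t) 0%N.

Lemma iter_step1S p m phi c : iter m.+1 (step1 p) phi c =
  p * iter m (step1 p) phi c.+1 + (1 - p) * iter m (step1 p) phi c.
Proof. by []. Qed.

Lemma low_ge0 t c : 0 <= low t c. Proof. exact: ler0n. Qed.

Lemma iter_step1_ge0 p m phi c : 0 <= p <= 1 -> (forall a, 0 <= phi a) ->
  0 <= iter m (step1 p) phi c.
Proof.
move=> /andP[p0 p1] h; elim: m c => [//|m IH] c.
by rewrite iterS /step1 addr_ge0// mulr_ge0// subr_ge0.
Qed.

Lemma le_iter_step1 p m phi psi c : 0 <= p <= 1 -> (forall a, phi a <= psi a) ->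
  iter m (step1 p) phi c <= iter m (step1 p) psi c.
Proof.
move=> /andP[p0 p1] h; elim: m c => [//|m IH] c.
by rewrite !iterS /step1 lerD// ler_wpM2l// subr_ge0.
Qed.

Lemma binom_cdf_ge0 p m t : 0 <= p <= 1 -> 0 <= binom_cdf p m t.
Proof. by move=> p01; apply: iter_step1_ge0 => // a; exact: low_ge0. Qed.

Lemma binom_cdf_le1 p m t : 0 <= p <= 1 -> binom_cdf p m t <= 1.
Proof.
move=> p01; apply: le_trans (le_iter_step1 m 0 (psi := fun=> 1) p01 _) _.
  by move=> a; rewrite /low; case: leqP.
by elim: m 0%N => [//|m IH] c; rewrite iter_step1S; have := IH c; have := IH c.+1;
  have /andP[? ?] := p01; nra.
Qed.

Lemma iter_step1_expr p (s : R) m c :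
  iter m (step1 p) (fun a => s ^+ a) c = (1 - p + p * s) ^+ m * s ^+ c.
Proof.
elim: m c => [|m IH] c; first by rewrite expr0 mul1r.
by rewrite iterS /step1 !IH !exprS; ring.
Qed.

(** Exponential Markov inequality: the indicator of c <= t is at most
s ^+ c / s ^+ t when s <= 1. *)
Lemma binom_cdf_chernoff p (s : R) m t : 0 <= p <= 1 -> 0 < s -> s <= 1 ->
  binom_cdf p m t <= (1 - p + p * s) ^+ m / s ^+ t.
Proof.
move=> p01 s0 s1; rewrite /binom_cdf.
have /(le_iter_step1 m 0 p01) : forall a, low t a * s ^+ t <= s ^+ a.
  move=> a; rewrite /low; case: leqP => [at_|_]; last by rewrite mul0r exprn_ge0// ltW.
  by rewrite mul1r ler_wiXn2l// ltW.
rewrite iter_step1_expr expr0 mulr1 ler_pdivlMr ?exprn_gt0//; apply: le_trans.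
rewrite le_eqVlt; apply/orP; left; apply/eqP.
by elim: m 0%N => [//|m IH] c; rewrite !iterS /step1 -!IH; ring.
Qed.

Lemma iter_step1_ge_term p m phi c j : 0 <= p <= 1 -> (forall a, 0 <= phi a) ->
  1 <= phi (c + j)%N ->
  'C(m, j)%:R * p ^+ j * (1 - p) ^+ (m - j) <= iter m (step1 p) phi c.
Proof.
move=> p01 phi0; have /andP[p0 p1] := p01.
have q0 : 0 <= 1 - p by rewrite subr_ge0.
elim: m c j => [|m IH] c [|j] h.
- by rewrite bin0 expr0 subnn expr0 !mulr1 -(addn0 c).
- by rewrite bin0n/= !mul0r.
- have := IH c 0%N h; rewrite !bin0 !expr0 !subn0 !mulr1 !mul1r => {}IH.
  rewrite exprS iter_step1S; apply: (@le_trans _ _ ((1 - p) * iter m (step1 p) phi c)).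
    exact: ler_wpM2l.
  by rewrite lerDr mulr_ge0//; exact: iter_step1_ge0.
rewrite binS natrD iter_step1S subSS.
rewrite (mulrDl _ _ (p ^+ j.+1)) (mulrDl _ _ ((1 - p) ^+ (m - j))) [leLHS]addrC.
apply: lerD.
  have := IH c.+1 j; rewrite addSnnS => /(_ h) /(ler_wpM2l p0); apply: le_trans.
  by rewrite exprS le_eqVlt; apply/orP; left; apply/eqP; ring.
have [jm|mj] := ltnP j m; last first.
  by rewrite bin_small// !mul0r mulr_ge0// iter_step1_ge0.
have := IH c j.+1 h => /(ler_wpM2l q0); apply: le_trans.
by rewrite -[(m - j)%N]subnSK// (exprS (1 - p)) le_eqVlt; apply/orP; left; apply/eqP; ring.
Qed.

Lemma binom_cdf_ge_term p m t k : 0 <= p <= 1 -> (k <= t)%N ->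
  'C(m, k)%:R * p ^+ k * (1 - p) ^+ (m - k) <= binom_cdf p m t.
Proof.
move=> p01 kt; apply: iter_step1_ge_term => //.
by rewrite add0n /low kt.
Qed.

Lemma binom_cdfS p m t : 0 <= p <= 1 -> (1 - p) * binom_cdf p m t <= binom_cdf p m.+1 t.
Proof.
move=> /[dup] p01 /andP[p0 p1].
by rewrite {2}/binom_cdf iterS /step1 lerDr mulr_ge0// iter_step1_ge0// => a; exact: low_ge0.
Qed.

(** Backward step of a pair of counters.  A point falls in the first
neighbourhood with probability p, in the second but not in the first with
probability p - q, and in neither with probability 1 - 2p + q, where q is the
probability of both.  Points in both neighbourhoods are counted only once, which
is harmless for an upper bound on the probability of two low counts. *)
Definition step2 p q (phi : nat -> nat -> R) (c1 c2 : nat) : R :=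
  p * phi c1.+1 c2 + (p - q) * phi c1 c2.+1 + (1 - 2 * p + q) * phi c1 c2.

(** The factor 1 + 4 * q absorbs the positive correlation: the excess
q - p ^+ 2 of the weight of the empty outcome over its product value is at most
4 * q * (1 - p) ^+ 2, because 1 - p >= 1/2. *)
Lemma third_weight_le p q : 0 <= p -> p <= 2^-1 -> 0 <= q ->
  1 - 2 * p + q <= (1 + 4 * q) * (1 - p) ^+ 2.
Proof.
move=> p0 p2 q0; have h : 1 <= 4 * (1 - p) ^+ 2 by nra.
by have := ler_wpM2l q0 h; nra.
Qed.

Lemma weights_le p q (A B C D x y : R) : 0 <= p -> 0 <= q ->
  0 <= A -> 0 <= B -> 0 <= C -> x * D <= (1 + 4 * q) * y * D ->
  p * B + (p - q) * C + x * D <= (1 + 4 * q) * (A + p * (B + C) + y * D).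
Proof.
move=> p0 q0 A0 B0 C0 xy.
have qA := mulr_ge0 q0 A0; have qC := mulr_ge0 q0 C0.
have qB := mulr_ge0 (mulr_ge0 q0 p0) B0.
have qpC := mulr_ge0 (mulr_ge0 q0 p0) C0.
lra.
Qed.

(** From (1 + x) ^+ m * (1 - m x) <= 1 and 1 / (1 - y) <= 1 + 2 y for
0 <= y <= 1/2. *)
Lemma exprD1_le (x : R) m : 0 <= x -> m%:R * x <= 2^-1 ->
  (1 + x) ^+ m <= 1 + 2 * (m%:R * x).
Proof.
move=> x0 mx.
have B n : (1 + x) ^+ n * (1 - n%:R * x) <= 1.
  elim: n => [|n]; first by rewrite expr0 mul0r subr0 mulr1.
  apply: le_trans; rewrite exprSr -mulrA ler_wpM2l ?exprn_ge0//; first exact: addr_ge0.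
  have := ler0n R n; rewrite -natr1 => n0; have := mulr_ge0 n0 (mulr_ge0 x0 x0).
  have := mulr_ge0 x0 x0; lra.
have y0 : 0 <= m%:R * x by rewrite mulr_ge0.
have Q0 : 0 <= (1 + x) ^+ m by rewrite exprn_ge0// addr_ge0.
have := B m; move: (m%:R * x) ((1 + x) ^+ m) mx y0 Q0 => y Q y2 y0 Q0 h.
have y1 : 0 < 1 - y by lra.
rewrite -(ler_pM2r y1); apply: le_trans h _; nra.
Qed.

Section step2_bounds.
Variables (p q : R).
Hypotheses (p0 : 0 <= p) (q0 : 0 <= q) (qp : q <= p) (pq : 0 <= 1 - 2 * p + q).

Lemma le_iter_step2 m (phi psi : nat -> nat -> R) c1 c2 : (forall a b, phi a b <= psi a b) ->
  iter m (step2 p q) phi c1 c2 <= iter m (step2 p q) psi c1 c2.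
Proof.
move=> h; elim: m c1 c2 => [//|m IH] c1 c2.
by rewrite !iterS /step2 !lerD// ler_wpM2l// subr_ge0.
Qed.

Lemma iter_step2_fst m phi c1 c2 :
  iter m (step2 p q) (fun a _ => phi a) c1 c2 = iter m (step1 p) phi c1.
Proof.
elim: m c1 c2 => [//|m IH] c1 c2; rewrite !iterS /step2 !IH /step1; ring.
Qed.

Lemma iter_step2_le_cdf m t :
  iter m (step2 p q) (fun a b => low t a * low t b) 0%N 0%N <= binom_cdf p m t.
Proof.
rewrite /binom_cdf -(iter_step2_fst _ _ 0 0%N); apply: le_iter_step2 => a b.
by rewrite ler_piMr ?low_ge0// /low; case: leqP.
Qed.

(** The weight p - q of the second counter does not factorize against p, but it
is at most p = (p / (1 - p)) * (1 - p): with the weights p / (1 - p) and 1 - p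
the product of two one-dimensional kernels dominates every weight of step2 up to
the factor 1 + 4 * q. *)
Let tilted (phi : nat -> R) c := p / (1 - p) * phi c.+1 + (1 - p) * phi c.

(** Comparison with two independent binomial counters, at the price of
(1 + 4 * q) per step for the correlation and (1 - p) ^- t per counter for the
tilting. *)
Lemma iter_step2_le_square m t : p <= 2^-1 ->
  iter m (step2 p q) (fun a b => low t a * low t b) 0%N 0%N <=
  (1 + 4 * q) ^+ m * ((1 - p) ^- t * binom_cdf p m t) ^+ 2.
Proof.
move=> p2; have p1 : 0 < 1 - p by lra.
have a0 : 0 <= p / (1 - p) by rewrite divr_ge0// ltW.
have ab : p / (1 - p) * (1 - p) = p by rewrite divfK// gt_eqF.
(* conjugating by (1 - p) ^+ c turns the tilted kernel into step1; f >= low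
   because low t c vanishes for c > t *)
pose f c := (1 - p) ^+ c / (1 - p) ^+ t * low t c.
have f_ge0 c : 0 <= f c by rewrite /f mulr_ge0 ?low_ge0// divr_ge0// exprn_ge0// ltW.
have lowf c : low t c <= f c.
  rewrite /f {1}/low; case: leqP => ct; last by rewrite f_ge0.
  rewrite /low ct mulr1 ler_pdivlMr ?exprn_gt0// mul1r.
  by rewrite ler_wiXn2l ?(ltW p1)// lerBlDr lerDl.
have tf n c : iter n tilted f c = (1 - p) ^+ c / (1 - p) ^+ t * iter n (step1 p) (low t) c.
  elim: n c => [//|n IH] c; rewrite !iterS /tilted !IH /step1 exprS.
  by field; rewrite ?expf_neq0 ?gt_eqF.
have tf0 n c : 0 <= iter n tilted f c.
  elim: n c => [//|n IH] c; rewrite iterS /tilted addr_ge0// mulr_ge0// ltW//.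
have -> : (1 - p) ^- t * binom_cdf p m t = iter m tilted f 0%N.
  by rewrite tf expr0 div1r.
apply: (@le_trans _ _ (iter m (step2 p q) (fun a b => f a * f b) 0%N 0%N)).
  by apply: le_iter_step2 => a b; rewrite ler_pM ?low_ge0.
suff H c1 c2 : iter m (step2 p q) (fun a b => f a * f b) c1 c2 <=
    (1 + 4 * q) ^+ m * (iter m tilted f c1 * iter m tilted f c2) by exact: H.
have q4 : 0 <= 1 + 4 * q by rewrite addr_ge0// mulr_ge0.
elim: m c1 c2 => [|m IH] c1 c2; first by rewrite expr0 mul1r.
have Q0 : 0 <= (1 + 4 * q) ^+ m by rewrite exprn_ge0.
rewrite !iterS [X in X <= _]/step2.
set F1 := iter m tilted f c1; set F1' := iter m tilted f c1.+1.
set F2 := iter m tilted f c2; set F2' := iter m tilted f c2.+1.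
apply: (@le_trans _ _ ((1 + 4 * q) ^+ m *
   (p * (F1' * F2) + (p - q) * (F1 * F2') + (1 - 2 * p + q) * (F1 * F2)))).
  have K (k : R) a b : 0 <= k ->
      k * iter m (step2 p q) (fun a b => f a * f b) a b <=
      (1 + 4 * q) ^+ m * (k * (iter m tilted f a * iter m tilted f b)).
    by move=> k0; rewrite mulrCA ler_wpM2l.
  rewrite !(mulrDr ((1 + 4 * q) ^+ m)).
  by apply: lerD; [apply: lerD|]; apply: K => //; rewrite subr_ge0.
rewrite exprSr -!mulrA ler_wpM2l// /tilted -/F1 -/F1' -/F2 -/F2'.
have [h1 h2 h3 h4] : [/\ 0 <= F1, 0 <= F1', 0 <= F2 & 0 <= F2'] by split; exact: tf0.
have -> : (p / (1 - p) * F1' + (1 - p) * F1) * (p / (1 - p) * F2' + (1 - p) * F2) =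
  (p / (1 - p)) ^+ 2 * (F1' * F2') + (p / (1 - p) * (1 - p)) * (F1' * F2 + F1 * F2') +
  (1 - p) ^+ 2 * (F1 * F2) by ring.
rewrite ab; set A := _ ^+ 2 * (F1' * F2').
have A0 : 0 <= A by rewrite mulr_ge0 ?exprn_ge0// mulr_ge0.
have B0 : 0 <= F1' * F2 by rewrite mulr_ge0.
have C0 : 0 <= F1 * F2' by rewrite mulr_ge0.
have D0 : 0 <= F1 * F2 by rewrite mulr_ge0.
have E' := ler_wpM2r D0 (third_weight_le p0 p2 q0).
exact: weights_le.
Qed.

(** A bound affine in q, so that it can be averaged over the two centres.  When
m * q is small the factor (1 + 4 * q) ^+ m is linearized; otherwise m * q is
bounded below and the trivial bound by the first counter alone is at most a
multiple of m * q. *)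
Lemma iter_step2_le m t : p <= 2^-1 ->
  iter m (step2 p q) (fun a b => low t a * low t b) 0%N 0%N <=
  (1 - p) ^- (2 * t) * binom_cdf p m t ^+ 2 +
  (1 - p) ^- (2 * t) * (8 * m%:R * binom_cdf p m t ^+ 2 +
    8 * m%:R * binom_cdf p m t) * q.
Proof.
move=> p2; have p1 : 0 < 1 - p by lra.
have p01 : 0 <= p <= 1 by rewrite p0/=; lra.
have b0 := binom_cdf_ge0 m t p01.
have k1 : 1 <= (1 - p) ^- (2 * t).
  by rewrite invr_ge1 ?unitfE ?expf_neq0 ?gt_eqF// ?exprn_gt0// exprn_ile1 ?(ltW p1)// lerBlDr lerDl.
have [h|h] := leP (m%:R * (4 * q)) 2^-1.
  apply: le_trans (iter_step2_le_square m t p2) _.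
  have q4 : 0 <= 4 * q by rewrite mulr_ge0.
  rewrite exprMn -exprVn -exprM mulnC exprVn.
  move: (binom_cdf p m t) ((1 - p) ^- (2 * t)) b0 k1 (exprD1_le q4 h) => b k b0 k1 E.
  have k0 : 0 <= k by lra.
  have := ler_wpM2r (mulr_ge0 k0 (sqr_ge0 b)) E.
  have := mulr_ge0 (mulr_ge0 k0 (mulr_ge0 (ler0n R m) b0)) q0; lra.
apply: le_trans (iter_step2_le_cdf m t) _.
move: (binom_cdf p m t) ((1 - p) ^- (2 * t)) b0 k1 => b k b0 k1.
have k0 : 0 <= k by lra.
have B0 : 0 <= k * b ^+ 2 by rewrite mulr_ge0 ?sqr_ge0.
have := mulr_ge0 B0 (mulr_ge0 (ler0n R m) q0).
have h8 : 1 <= 8 * (m%:R * q) by lra.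
have := ler_wpM2l b0 h8; rewrite mulr1 => h8b.
have b8 : 0 <= b * (8 * (m%:R * q)) by lra.
have := ler_wpM2r b8 k1; lra.
Qed.

End step2_bounds.

End binomial_chains.

(** * Exploring the neighbourhoods of two vertices *)

Section two_centers.
Context (R : realType) (d : nat) disp (T : measurableType disp)
  (P : probability T R) (X : nat -> {RV P >-> d.-tuple R})
  (N : nat -> {RV P >-> nat}) (U : nat -> nat -> {RV P >-> R})
  (model : coupled_poisson_model X N U).
Context (g : R -> R).
Hypotheses (g01 : forall x : R, 0 <= x -> 0 <= g x <= 1)
  (g_noninc : forall x y : R, 0 <= x -> x <= y -> g y <= g x).
Context (r : R).
Hypothesis r0 : 0 < r.
Local Notation S := (@torus R d).
Local Notation Lambda := (@lebesgue_tuple R d).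
Local Notation avoiding c := (g_sigma_algebraType (cylinders_avoiding X U c)).
Local Notation ell := (link g r).
Local Notation p := (link_prob d g r).

(** The marks are indexed by increasing pairs. *)
Definition pair_of (i j : nat) : nat * nat := if (i < j)%N then (i, j) else (j, i).

Definition edge i j (w : T) : bool :=
  U (pair_of i j).1 (pair_of i j).2 w <= ell (X i w) (X j w).

Lemma pair_of_lt i j : i != j -> ((pair_of i j).1 < (pair_of i j).2)%N.
Proof. by rewrite /pair_of neq_ltn; case: ltnP => [->|_ /= ji]. Qed.

Lemma pair_of_inj i j k l : pair_of i j = pair_of k l ->
  (i = k /\ j = l) \/ (i = l /\ j = k).
Proof. by rewrite /pair_of; do 2 case: ifP => _; move=> [-> ->]; tauto. Qed.

Let mell : measurable_fun setT (fun z : d.-tuple R * d.-tuple R => ell z.1 z.2).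
Proof. exact: (measurable_link g_noninc r0). Qed.

Let mell2 d' (T' : measurableType d') (h1 h2 : T' -> d.-tuple R) :
  measurable_fun setT h1 -> measurable_fun setT h2 ->
  measurable_fun setT (fun w => ell (h1 w) (h2 w)).
Proof. by move=> m1 m2; exact: (measurableT_comp mell (measurable_fun_pair m1 m2)). Qed.

Let ell01 (x y : d.-tuple R) : 0 <= ell x y <= 1. Proof. exact: (link01 g01 _ _ r0). Qed.

Section in_avoiding.
Variable c : coordinate.

Lemma measurable_link_avoiding i j : c != inl i -> c != inl j ->
  measurable_fun setT (fun w : avoiding c => ell (X i w) (X j w)).
Proof.
by move=> ci cj; apply: mell2; exact: measurable_avoiding_X.
Qed.

Lemma measurable_edge i j : i != j ->
  c != inl i -> c != inl j -> c != inr (pair_of i j) ->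
  measurable_fun setT (edge i j : avoiding c -> bool).
Proof.
move=> ij ci cj cij; apply: measurable_fun_ler.
  by apply: measurable_avoiding_U => //; exact: pair_of_lt.
exact: measurable_link_avoiding.
Qed.

End in_avoiding.

Variables i1 i2 : nat.
Hypothesis i12 : i1 != i2.

(** Reads the points of L one by one, incrementing the first counter for a
neighbour of i1 and the second for a neighbour of i2 that is not one of i1.  The
recursion isolates the coordinates of the point being read, which is what the
freezing lemmas need; exploreE gives the closed form. *)
Fixpoint explore (psi : nat -> nat -> T -> R) (L : seq nat) (c1 c2 : nat) (w : T) : R :=
  if L is j :: L' then
    if edge i1 j w then explore psi L' c1.+1 c2 w
    else if edge i2 j w then explore psi L' c1 c2.+1 w
    else explore psi L' c1 c2 w
  else psi c1 c2 w.

Definition degree1 (L : seq nat) w := count (fun j => edge i1 j w) L.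
Definition degree2 (L : seq nat) w :=
  count (fun j => ~~ edge i1 j w && edge i2 j w) L.

Lemma exploreE psi L c1 c2 w :
  explore psi L c1 c2 w = psi (c1 + degree1 L w)%N (c2 + degree2 L w)%N w.
Proof.
elim: L c1 c2 => [|j L IH] c1 c2 /=; first by rewrite !addn0.
rewrite /degree1 /degree2/=; case: (edge i1 j w) => /=.
  by rewrite IH addSnnS add0n.
by case: (edge i2 j w) => /=; rewrite IH ?add0n// addSnnS.
Qed.

Lemma explore_ge0 psi L c1 c2 w : (forall a b w, 0 <= psi a b w) ->
  0 <= explore psi L c1 c2 w.
Proof. by move=> h; rewrite exploreE. Qed.

Lemma measurable_explore c psi L c1 c2 :
  i1 \notin L -> i2 \notin L ->
  c != inl i1 -> c != inl i2 ->
  (forall j, j \in L -> [/\ c != inl j, c != inr (pair_of i1 j)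
    & c != inr (pair_of i2 j)]) ->
  (forall a b, measurable_fun setT (psi a b : avoiding c -> R)) ->
  measurable_fun setT (explore psi L c1 c2 : avoiding c -> R).
Proof.
move=> + + ci1 ci2 + mpsi.
elim: L c1 c2 => [|j L IH] c1 c2 n1 n2 hL; first exact: mpsi.
move: n1 n2; rewrite !inE !negb_or => /andP[n1 m1] /andP[n2 m2].
have [cj c1j c2j] := hL j (mem_head _ _).
have {}hL k : k \in L -> [/\ c != inl k, c != inr (pair_of i1 k)
    & c != inr (pair_of i2 k)] by move=> kL; apply: hL; rewrite inE kL orbT.
apply: measurable_fun_ifT; first exact: measurable_edge.
  exact: IH.
apply: measurable_fun_ifT; first exact: measurable_edge.
  exact: IH.
exact: IH.
Qed.

Definition overlap (x y : d.-tuple R) : R :=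
  fine (\int[Lambda]_(z in S) (ell x z * ell y z)%:E).

Let mellx (x : d.-tuple R) : measurable_fun setT (fun z => ell x z).
Proof. exact: mell2. Qed.

Lemma overlap_integral x y :
  (\int[Lambda]_(z in S) (ell x z * ell y z)%:E = (overlap x y)%:E)%E.
Proof.
rewrite /overlap fineK// ge0_fin_numE; last first.
  by apply: integral_ge0 => z _; have := ell01 x z; have := ell01 y z;
    rewrite lee_fin => /andP[? _] /andP[? _]; exact: mulr_ge0.
apply: (@le_lt_trans _ _ (\int[Lambda]_(z in S) (ell x z)%:E)%E); last first.
  by rewrite integral_link// ltry.
apply: ge0_le_integral => //.
- exact: measurable_torus.
- by move=> z _; have := ell01 x z; have := ell01 y z;
    rewrite lee_fin => /andP[? _] /andP[? _]; exact: mulr_ge0.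
- by apply: measurable_funTS; apply/measurable_EFinP; exact: measurable_funM.
- by apply: measurable_funTS; exact/measurable_EFinP.
- move=> z _; have := ell01 x z; have := ell01 y z.
  by rewrite lee_fin => /andP[? ?] /andP[? ?]; rewrite ler_piMr.
Qed.

Lemma measurable_overlap :
  measurable_fun setT (fun z : d.-tuple R * d.-tuple R => overlap z.1 z.2).
Proof.
apply/measurable_EFinP.
rewrite (_ : _ \o _ = fubini_F Lambda
  (fun t : (d.-tuple R * d.-tuple R) * d.-tuple R =>
     if t.2 \in S then (ell t.1.1 t.2 * ell t.1.2 t.2)%:E else 0)%E).
  apply: measurable_fun_fubini_tonelli_F => [|[[x y] z]/=]; last first.
    case: ifP => // _; rewrite lee_fin.
    by have /andP[? _] := ell01 x z; have /andP[? _] := ell01 y z; exact: mulr_ge0.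
  apply: measurable_fun_ifT => //.
    apply: (measurable_fun_bool true).
    rewrite (_ : _ @^-1` _ = setT `*` S); last first.
      by apply/seteqP; split => -[x y] /=; [move=> /set_mem|move=> [_ /mem_set]].
    by rewrite setTI; apply: measurableX => //; exact: measurable_torus.
  apply/measurable_EFinP; apply: measurable_funM.
    by apply: mell2 => //; exact: measurableT_comp.
  by apply: mell2 => //; exact: measurableT_comp.
apply/funext => -[x y]; rewrite /= -overlap_integral /fubini_F [LHS]integral_mkcond.
by apply: eq_integral => z _; rewrite patchE.
Qed.

Lemma overlap_ge0 x y : 0 <= overlap x y.
Proof.
by apply: fine_ge0; apply: integral_ge0 => z _; rewrite lee_fin mulr_ge0//;
  [case/andP: (ell01 x z)|case/andP: (ell01 y z)].
Qed.

Let integral_torusD (f h : d.-tuple R -> R) :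
  measurable_fun setT f -> measurable_fun setT h ->
  (forall z, 0 <= f z) -> (forall z, 0 <= h z) ->
  (\int[Lambda]_(z in S) (f z + h z)%:E =
   \int[Lambda]_(z in S) (f z)%:E + \int[Lambda]_(z in S) (h z)%:E)%E.
Proof.
move=> mf mh f0 h0; rewrite -ge0_integralD//.
- exact: measurable_torus.
- by move=> z _; rewrite lee_fin.
- by apply: measurable_funTS; exact/measurable_EFinP.
- by move=> z _; rewrite lee_fin.
- by apply: measurable_funTS; exact/measurable_EFinP.
Qed.

Lemma integral_second x y :
  (\int[Lambda]_(z in S) ((1 - ell x z) * ell y z)%:E = (p - overlap x y)%:E)%E.
Proof.
have h z := ell01 x z; have h' z := ell01 y z.
have m1 : measurable_fun setT (fun z => ell x z * ell y z) by exact: measurable_funM.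
have m2 : measurable_fun setT (fun z => (1 - ell x z) * ell y z).
  by apply: measurable_funM => //; exact: measurable_funB.
have : (\int[Lambda]_(z in S) (ell x z * ell y z + (1 - ell x z) * ell y z)%:E = p%:E)%E.
  by rewrite -(integral_link g01 g_noninc y r0); apply: eq_integral => z _; congr EFin; ring.
rewrite integral_torusD//; last 2 first.
- by move=> z; have /andP[? ?] := h z; have /andP[? ?] := h' z; exact: mulr_ge0.
- by move=> z; have /andP[? ?] := h z; have /andP[? ?] := h' z;
    rewrite mulr_ge0// subr_ge0.
rewrite overlap_integral => e; rewrite EFinB -e addeAC subee ?add0e//.
Qed.

Lemma integral_third x y :
  (\int[Lambda]_(z in S) ((1 - ell x z) * (1 - ell y z))%:E =
    (1 - 2 * p + overlap x y)%:E)%E.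
Proof.
have h z := ell01 x z; have h' z := ell01 y z.
have m1 : measurable_fun setT (fun z => (1 - ell x z) * ell y z).
  by apply: measurable_funM => //; exact: measurable_funB.
have m2 : measurable_fun setT (fun z => (1 - ell x z) * (1 - ell y z)).
  by apply: measurable_funM => //; exact: measurable_funB.
have one : (\int[Lambda]_(z in S) (1 : R)%:E = 1%:E)%E.
  rewrite (integral_cst _ (@measurable_torus R d)) mul1e.
  exact: lebesgue_tuple_torus.
have : (\int[Lambda]_(z in S) (ell x z + ((1 - ell x z) * ell y z +
   (1 - ell x z) * (1 - ell y z)))%:E = 1%:E)%E.
  by rewrite -one; apply: eq_integral => z _; congr EFin; ring.
rewrite integral_torusD//; last 3 first.
- exact: measurable_funD.
- by move=> z; case/andP: (h z).
- by move=> z; have /andP[? ?] := h z; have /andP[? ?] := h' z;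
    rewrite addr_ge0// mulr_ge0// subr_ge0.
rewrite integral_torusD//; last 2 first.
- by move=> z; have /andP[? ?] := h z; have /andP[? ?] := h' z;
    rewrite mulr_ge0// subr_ge0.
- by move=> z; have /andP[? ?] := h z; have /andP[? ?] := h' z;
    rewrite mulr_ge0// subr_ge0.
rewrite integral_second integral_link//.
set I := (\int[_]_(_ in _) _)%E.
have I0 : (0 <= I)%E.
  apply: integral_ge0 => z _; have /andP[? ?] := h z; have /andP[? ?] := h' z.
  by rewrite lee_fin mulr_ge0// subr_ge0.
case: I I0 => [i| |]//= _ [] e; congr EFin; lra.
Qed.

(** The step of the two counters with the pair of centres as a parameter: the
weight q is their overlap. *)
Definition step2s (phi : d.-tuple R -> d.-tuple R -> nat -> nat -> R) x y :=
  step2 p (overlap x y) (phi x y).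

Lemma overlap_le x y : overlap x y <= p.
Proof.
rewrite -subr_ge0 -lee_fin -integral_second; apply: integral_ge0 => z _.
by rewrite lee_fin mulr_ge0 ?subr_ge0//; [case/andP: (ell01 x z)|case/andP: (ell01 y z)].
Qed.

Lemma overlap_third x y : 0 <= 1 - 2 * p + overlap x y.
Proof.
rewrite -lee_fin -integral_third; apply: integral_ge0 => z _.
by rewrite lee_fin mulr_ge0 ?subr_ge0//; [case/andP: (ell01 x z)|case/andP: (ell01 y z)].
Qed.

Lemma measurable_step2s (phi : d.-tuple R -> d.-tuple R -> nat -> nat -> R) :
  (forall a b, measurable_fun setT (fun z : d.-tuple R * d.-tuple R => phi z.1 z.2 a b)) ->
  forall a b, measurable_fun setT
    (fun z : d.-tuple R * d.-tuple R => step2s phi z.1 z.2 a b).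
Proof.
move=> mphi a b; rewrite /step2s /step2.
have mo := measurable_overlap.
apply: measurable_funD; [apply: measurable_funD|]; apply: measurable_funM => //.
  exact: measurable_funB.
exact: measurable_funD.
Qed.

Lemma step2s_ge0 (phi : d.-tuple R -> d.-tuple R -> nat -> nat -> R) :
  (forall x y a b, 0 <= phi x y a b) -> forall x y a b, 0 <= step2s phi x y a b.
Proof.
move=> phi0 x y a b; rewrite /step2s /step2.
by rewrite !addr_ge0// mulr_ge0// ?overlap_third ?link_prob_ge0// subr_ge0 overlap_le.
Qed.

(** The conditional law of the two counters given the centres.  For each point j
the marks of its edges to i1 and to i2 are revealed, then its position is
integrated over the torus, where the three outcomes have measures p, p - q and
1 - 2p + q.  The function phi depends on the centres as well, so that the
induction can absorb one step into it. *)
Lemma two_centers (L : seq nat) (phi : d.-tuple R -> d.-tuple R -> nat -> nat -> R) :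
  i1 \notin L -> i2 \notin L -> uniq L ->
  (forall a b, measurable_fun setT (fun z : d.-tuple R * d.-tuple R => phi z.1 z.2 a b)) ->
  (forall x y a b, 0 <= phi x y a b) ->
  (\int[P]_w (phi (X i1 w) (X i2 w) (degree1 L w) (degree2 L w))%:E =
   \int[P]_w (iter (size L) step2s phi (X i1 w) (X i2 w) 0%N 0%N)%:E)%E.
Proof.
elim: L phi => [//|j L IH] phi.
rewrite !inE !negb_or => /andP[n1 m1] /andP[n2 m2] /andP[jL uL] mphi phi0.
pose psi a b w := phi (X i1 w) (X i2 w) a b.
have psi0 a b w : 0 <= psi a b w by exact: phi0.
have mpsi c a b : c != inl i1 -> c != inl i2 -> measurable_fun setT (psi a b : avoiding c -> R).
  move=> ci1 ci2.
  have mX1 : measurable_fun setT (X i1 : avoiding c -> _) by exact: measurable_avoiding_X.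
  have mX2 : measurable_fun setT (X i2 : avoiding c -> _) by exact: measurable_avoiding_X.
  exact: (measurableT_comp (mphi a b) (measurable_fun_pair mX1 mX2)).
pose A := explore psi L 1 0; pose B := explore psi L 0 1; pose C := explore psi L 0 0.
have A0 w : 0 <= A w by exact: explore_ge0.
have B0 w : 0 <= B w by exact: explore_ge0.
have C0 w : 0 <= C w by exact: explore_ge0.
pose l1 w := ell (X i1 w) (X j w); pose l2 w := ell (X i2 w) (X j w).
have l101 w : 0 <= l1 w <= 1 by exact: ell01.
have l201 w : 0 <= l2 w <= 1 by exact: ell01.
have mexpl c a b : c != inl i1 -> c != inl i2 ->
    (forall k, k \in L -> [/\ c != inl k, c != inr (pair_of i1 k)
    & c != inr (pair_of i2 k)]) ->
    measurable_fun setT (explore psi L a b : avoiding c -> R).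
  by move=> ? ? ?; apply: measurable_explore => // *; exact: mpsi.
have kj k : k \in L -> k != j by apply: contraTneq => ->.
have k1 k : k \in L -> k != i1 by apply: contraTneq => ->.
have k2 k : k \in L -> k != i2 by apply: contraTneq => ->.
transitivity (\int[P]_w (if edge i1 j w then A w else
    if edge i2 j w then B w else C w)%:E)%E.
  apply: eq_integral => w _; congr EFin.
  by rewrite -[RHS]/(explore psi (j :: L) 0 0 w) exploreE.
transitivity (\int[P]_w (l1 w * A w + (1 - l1 w) *
    (if edge i2 j w then B w else C w))%:E)%E.
  pose c : coordinate := inr (pair_of i1 j).
  have hc k : k \in L -> [/\ c != inl k, c != inr (pair_of i1 k)
    & c != inr (pair_of i2 k)].
    move=> kL; split => //; apply/eqP => -[] /pair_of_inj.
      by move=> [[_ e]|[e _]]; [have := kj _ kL|have := k1 _ kL]; rewrite e eqxx.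
    by move=> [[e _]|[e _]]; [move: i12|have := k1 _ kL]; rewrite e eqxx.
  apply: (@freeze_U _ _ _ _ P X N U model (pair_of i1 j) l1 A
     (fun w => if edge i2 j w then B w else C w)) => //.
  - exact: pair_of_lt.
  - exact: measurable_link_avoiding.
  - exact: mexpl.
  - apply: measurable_fun_ifT; [|exact: mexpl|exact: mexpl].
    apply: measurable_edge => //.
    apply/eqP => -[] /pair_of_inj [[e _]|[_ e]]; first by move: i12; rewrite e eqxx.
    by move: n2; rewrite e eqxx.
  - by move=> w; case: ifP.
transitivity (\int[P]_w (l1 w * A w + ((1 - l1 w) * l2 w) * B w +
    ((1 - l1 w) * (1 - l2 w)) * C w)%:E)%E.
  pose c : coordinate := inr (pair_of i2 j).
  have hc k : k \in L -> [/\ c != inl k, c != inr (pair_of i1 k)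
    & c != inr (pair_of i2 k)].
    move=> kL; split => //; apply/eqP => -[] /pair_of_inj.
      by move=> [[e _]|[e _]]; [move: i12|have := k2 _ kL]; rewrite e eqxx.
    by move=> [[_ e]|[e _]]; [have := kj _ kL|have := k2 _ kL]; rewrite e eqxx.
  have ml1 : measurable_fun setT (l1 : avoiding c -> R) by exact: measurable_link_avoiding.
  have ml2 : measurable_fun setT (l2 : avoiding c -> R) by exact: measurable_link_avoiding.
  have mA : measurable_fun setT (A : avoiding c -> R) by exact: mexpl.
  have mB : measurable_fun setT (B : avoiding c -> R) by exact: mexpl.
  have mC : measurable_fun setT (C : avoiding c -> R) by exact: mexpl.
  have key := @freeze_U _ _ _ _ P X N U model (pair_of i2 j) l2
     (fun w => l1 w * A w + (1 - l1 w) * B w)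
     (fun w => l1 w * A w + (1 - l1 w) * C w).
  transitivity (\int[P]_w (if edge i2 j w then l1 w * A w + (1 - l1 w) * B w
     else l1 w * A w + (1 - l1 w) * C w)%:E)%E.
    by apply: eq_integral => w _; case: ifP.
  rewrite -[LHS]/(\int[P]_w (if U (pair_of i2 j).1 (pair_of i2 j).2 w <= l2 w then
    l1 w * A w + (1 - l1 w) * B w else l1 w * A w + (1 - l1 w) * C w)%:E)%E.
  rewrite {}key//.
  - by apply: eq_integral => w _; congr EFin; ring.
  - exact: pair_of_lt.
  - by apply: measurable_funD; apply: measurable_funM => //; exact: measurable_funB.
  - by apply: measurable_funD; apply: measurable_funM => //; exact: measurable_funB.
  - by move=> w; have /andP[? ?] := l101 w; rewrite addr_ge0 ?mulr_ge0 ?subr_ge0.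
  - by move=> w; have /andP[? ?] := l101 w; rewrite addr_ge0 ?mulr_ge0 ?subr_ge0.
transitivity (\int[P]_w (p * A w + (p - overlap (X i1 w) (X i2 w)) * B w +
    (1 - 2 * p + overlap (X i1 w) (X i2 w)) * C w)%:E)%E.
  pose c : coordinate := inl j.
  have cI1 : c != inl i1 by apply/eqP => -[] e; move: n1; rewrite e eqxx.
  have cI2 : c != inl i2 by apply/eqP => -[] e; move: n2; rewrite e eqxx.
  have hc k : k \in L -> [/\ c != inl k, c != inr (pair_of i1 k)
    & c != inr (pair_of i2 k)].
    by move=> kL; split => //; apply/eqP => -[] e; have := kj _ kL; rewrite e eqxx.
  have mA : measurable_fun setT (A : avoiding c -> R) by exact: mexpl.
  have mB : measurable_fun setT (B : avoiding c -> R) by exact: mexpl.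
  have mC : measurable_fun setT (C : avoiding c -> R) by exact: mexpl.
  pose F (z : avoiding c * d.-tuple R) : R :=
    ell (X i1 z.1) z.2 * A z.1 + ((1 - ell (X i1 z.1) z.2) * ell (X i2 z.1) z.2) * B z.1 +
    ((1 - ell (X i1 z.1) z.2) * (1 - ell (X i2 z.1) z.2)) * C z.1.
  have ml i : c != inl i -> measurable_fun setT
      (fun z : avoiding c * d.-tuple R => ell (X i z.1) z.2).
    move=> ci; apply: mell2 => //.
    have mX : measurable_fun setT (X i : avoiding c -> _) by exact: measurable_avoiding_X.
    exact: (measurableT_comp mX (@measurable_fst _ _ _ _)).
  have ml1 := ml _ cI1; have ml2 := ml _ cI2.
  have mF : measurable_fun setT F.
    apply: measurable_funD; [apply: measurable_funD|]; (apply: measurable_funM; last exact: measurableT_comp) => //.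
      by apply: measurable_funM => //; exact: measurable_funB.
    by apply: measurable_funM => //; exact: measurable_funB.
  have F0 z : 0 <= F z.
    have /andP[? ?] := ell01 (X i1 z.1) z.2; have /andP[? ?] := ell01 (X i2 z.1) z.2.
    have ? := A0 z.1; have ? := B0 z.1; have ? := C0 z.1.
    by rewrite /F !addr_ge0 ?mulr_ge0 ?subr_ge0.
  rewrite -[LHS]/(\int[P]_w (F (w, X j w))%:E)%E.
  rewrite (@freeze_X _ _ _ _ P X N U model j (EFin \o F)) /=; last 2 first.
  - exact/measurable_EFinP.
  - by move=> z; rewrite lee_fin.
  apply: eq_integral => w _; rewrite /F/=.
  have := ell01 (X i1 w); have := ell01 (X i2 w); move: (X i1 w) (X i2 w) => x y hy hx.
  have mx : measurable_fun setT (ell x) by exact: mellx.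
  have my : measurable_fun setT (ell y) by exact: mellx.
  have mx' : measurable_fun setT (fun z => 1 - ell x z) by exact: measurable_funB.
  have my' : measurable_fun setT (fun z => 1 - ell y z) by exact: measurable_funB.
  have nx z : 0 <= ell x z by case/andP: (hx z).
  have ny z : 0 <= ell y z by case/andP: (hy z).
  have nx' z : 0 <= 1 - ell x z by rewrite subr_ge0; case/andP: (hx z).
  have ny' z : 0 <= 1 - ell y z by rewrite subr_ge0; case/andP: (hy z).
  have mxy2 : measurable_fun setT (fun z => (1 - ell x z) * ell y z) by exact: measurable_funM.
  have mxy3 : measurable_fun setT (fun z => (1 - ell x z) * (1 - ell y z)) by exact: measurable_funM.
  have ZR (f : d.-tuple R -> R) k : measurable_fun setT f -> (forall z, 0 <= f z) -> 0 <= k ->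
     (\int[Lambda]_(z in S) (f z * k)%:E = \int[Lambda]_(z in S) (f z)%:E * k%:E)%E.
    move=> mf f0 k0; under eq_integral do rewrite EFinM.
    rewrite ge0_integralZr//.
    - exact: measurable_torus.
    - by apply: measurable_funTS; exact/measurable_EFinP.
    - by move=> z _; rewrite lee_fin.
  rewrite integral_torusD//; last 4 first.
  - by apply: measurable_funD; exact: measurable_funM.
  - exact: measurable_funM.
  - by move=> z; rewrite addr_ge0// ?mulr_ge0.
  - by move=> z; rewrite ?mulr_ge0.
  rewrite integral_torusD//; last 4 first.
  - exact: measurable_funM.
  - exact: measurable_funM.
  - by move=> z; rewrite ?mulr_ge0.
  - by move=> z; rewrite ?mulr_ge0.
  rewrite !ZR//; last 2 first.
  - by move=> z; rewrite mulr_ge0.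
  - by move=> z; rewrite mulr_ge0.
  by rewrite integral_link// integral_second integral_third -!EFinM -!EFinD.
rewrite [size _]/= iterSr -IH//; last 2 first.
- exact: measurable_step2s.
- exact: step2s_ge0.
apply: eq_integral => w _; congr EFin; rewrite /A /B /C !exploreE /psi.
by rewrite /step2s /step2 !add1n !add0n.
Qed.

End two_centers.

(** * The second moment method *)

Section second_moment.
Context disp (T : measurableType disp) (R : realType) (P : probability T R).

(** Chebyshev inequality for the number Z of events E i that occur:
P (Z = 0) <= E[(Z - mu)^2] / mu^2 with mu = m * b and
E[Z^2] <= mu + m^2 * Q. *)
Lemma second_moment (m : nat) (E : 'I_m -> set T) (b Q : R) :
  (0 < m)%N -> 0 < b -> 0 <= Q ->
  (forall i, measurable (E i)) -> (forall i, P (E i) = b%:E) ->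
  (forall i j, i != j -> P (E i `&` E j) <= Q%:E)%E ->
  (P [set w | forall i, ~ E i w] <= ((m%:R * b)^-1 + Q / b ^+ 2 - 1)%:E)%E.
Proof.
move=> m0 b0 Q0 mE PE PQ.
have mI i : measurable_fun setT (\1_(E i) : T -> R) by exact: measurable_indic.
pose Z w : R := \sum_(i < m) \1_(E i) w.
have mZ : measurable_fun setT Z by exact: measurable_sum.
have I0 i w : 0 <= \1_(E i) w :> R by [].
have Z0 w : 0 <= Z w by exact: sumr_ge0.
pose mu := m%:R * b.
have mu0 : 0 < mu by rewrite mulr_gt0 ?ltr0n.
have EZ : (\int[P]_w (Z w)%:E = mu%:E)%E.
  under eq_integral do rewrite /Z -sumEFin.
  rewrite ge0_integral_sum//; last by move=> i; exact/measurable_EFinP.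
  transitivity (\sum_(i < m) b%:E)%E.
    by apply: eq_bigr => i _; rewrite integral_indic// setIT; exact: PE.
  by rewrite sumEFin sumr_const card_ord -mulr_natl.
have EZ2 : (\int[P]_w (Z w ^+ 2)%:E <= (mu + m%:R ^+ 2 * Q)%:E)%E.
  have -> : (\int[P]_w (Z w ^+ 2)%:E =
     \sum_(i < m) \sum_(j < m) P (E i `&` E j))%E.
    under eq_integral => w _.
      rewrite expr2 /Z big_distrlr/= -sumEFin.
      under eq_bigr do rewrite -sumEFin.
      over.
    rewrite ge0_integral_sum//; last 2 first.
    - by move=> i; apply: emeasurable_sum => j; apply/measurable_EFinP; exact: measurable_funM.
    - by move=> i w _; apply: sume_ge0 => j _; rewrite lee_fin mulr_ge0.
    apply: eq_bigr => i _; rewrite ge0_integral_sum//; last first.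
      by move=> j; apply/measurable_EFinP; exact: measurable_funM.
    apply: eq_bigr => j _.
    rewrite -[in RHS](setIT (E i `&` E j)) -integral_indic//; last exact: measurableI.
    by apply: eq_integral => w _; rewrite indicI.
  apply: (@le_trans _ _ (\sum_(i < m) (b + m%:R * Q)%:E)%E).
    apply: lee_sum => i _; rewrite (bigD1 i)//= setIid PE EFinD leeD2l//.
    apply: (@le_trans _ _ (\sum_(j < m | j != i) Q%:E)%E).
      by apply: lee_sum => j ji; apply: PQ; rewrite eq_sym.
    rewrite sumEFin lee_fin sumr_const -[leLHS]mulr_natl.
    by rewrite ler_wpM2r// ler_nat -[leqRHS]card_ord max_card.
  rewrite sumEFin lee_fin sumr_const card_ord -mulr_natl /mu; nra.
pose A := [set w | forall i, ~ E i w].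
have mA : measurable A.
  rewrite (_ : A = \bigcap_(i in [set: 'I_m]) ~` E i).
    by apply: fin_bigcap_measurable => // i _; exact: measurableC.
  by apply/seteqP; split => w /= h i; [move=> _; exact: h|exact: h].
have mV : measurable_fun setT (fun w => (Z w - mu) ^+ 2).
  by apply: measurable_funX; exact: measurable_funB.
have AV : ((mu ^+ 2)%:E * P A <= \int[P]_w ((Z w - mu) ^+ 2)%:E)%E.
  rewrite -[A in P A]setIT -integral_indic// -ge0_integralZl//; last 2 first.
  - by apply/measurable_EFinP; exact: measurable_indic.
  - by rewrite lee_fin exprn_ge0// ltW.
  apply: ge0_le_integral => //.
  - by move=> w _; rewrite mule_ge0// lee_fin// exprn_ge0// ltW.
  - by apply: measurable_funeM; apply/measurable_EFinP; exact: measurable_indic.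
  - exact/measurable_EFinP.
  - move=> w _; rewrite -EFinM lee_fin; have [Aw|Aw] := boolP (w \in A); last first.
      by rewrite indicE (negbTE Aw) mulr0 sqr_ge0.
    rewrite indicE Aw mulr1 (_ : Z w = 0) ?sub0r ?sqrrN//.
    rewrite /Z big1// => i _; rewrite indicE memNset//.
    by move: Aw; rewrite inE; exact.
have VE : (\int[P]_w ((Z w - mu) ^+ 2)%:E + (2 * mu ^+ 2)%:E =
    \int[P]_w (Z w ^+ 2)%:E + (mu ^+ 2)%:E)%E.
  transitivity (\int[P]_w ((Z w - mu) ^+ 2 + 2 * mu * Z w)%:E)%E.
    under [RHS]eq_integral do rewrite EFinD.
    rewrite ge0_integralD//; last 4 first.
    - by move=> w _; rewrite lee_fin sqr_ge0.
    - exact/measurable_EFinP.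
    - by move=> w _; rewrite lee_fin !mulr_ge0// ltW.
    - by apply/measurable_EFinP; exact: measurable_funM.
    congr (_ + _)%E; under [RHS]eq_integral do rewrite EFinM.
    rewrite ge0_integralZl//; last 3 first.
    - exact/measurable_EFinP.
    - by move=> w _; rewrite lee_fin.
    - by rewrite lee_fin mulr_ge0// ltW.
    by rewrite EZ -EFinM expr2 mulrA.
  transitivity (\int[P]_w (Z w ^+ 2 + mu ^+ 2)%:E)%E.
    by apply: eq_integral => w _; congr EFin; ring.
  under eq_integral do rewrite EFinD.
  rewrite ge0_integralD//; last 3 first.
  - by move=> w _; rewrite lee_fin sqr_ge0.
  - by apply/measurable_EFinP; exact: measurable_funX.
  - by move=> w _; rewrite lee_fin sqr_ge0.
  congr (_ + _)%E; rewrite integral_cst// -[RHS]mule1; congr (_ * _)%E.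
  exact: probability_setT.
have PA : P A = (fine (P A))%:E by rewrite fineK// fin_num_measure.
rewrite -/A PA lee_fin.
have : ((mu ^+ 2)%:E * P A + (2 * mu ^+ 2)%:E <=
   (mu + m%:R ^+ 2 * Q)%:E + (mu ^+ 2)%:E)%E.
  by apply: (le_trans (leeD2r _ AV)); rewrite VE leeD2r.
rewrite PA -EFinM -!EFinD lee_fin => h.
have mu20 : 0 < mu ^+ 2 by rewrite exprn_gt0.
rewrite -(ler_pM2l mu20).
have mn0 : m%:R != 0 :> R by rewrite pnatr_eq0 -lt0n.
have bn0 : b != 0 by rewrite gt_eqF.
have -> : mu ^+ 2 * ((m%:R * b)^-1 + Q / b ^+ 2 - 1) = mu + m%:R ^+ 2 * Q - mu ^+ 2.
  by rewrite /mu; field; rewrite mn0 bn0.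
lra.
Qed.

End second_moment.

(** * Probability that one or two given vertices have low degree *)

Lemma measurable_fun_count_le d (T : measurableType d) (e : nat -> T -> bool)
    (L : seq nat) (c t : nat) :
  (forall j, j \in L -> measurable_fun setT (e j)) ->
  measurable_fun setT (fun w => (c + count (e^~ w) L <= t)%N).
Proof.
elim: L c => [|j L IH] c he /=; first exact: measurable_cst.
rewrite (_ : (fun _ => _) = (fun w => if e j w
    then (c.+1 + count (e^~ w) L <= t)%N else (c + count (e^~ w) L <= t)%N)).
  have h k : k \in L -> measurable_fun setT (e k) by move=> kL; apply: he; rewrite inE kL orbT.
  by apply: measurable_fun_ifT; [exact: he (mem_head _ _)|exact: IH|exact: IH].
by apply/funext => w /=; case: (e j w); rewrite ?add0n// addSnnS.
Qed.

Section low_degree.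
Context (R : realType) (d : nat) disp (T : measurableType disp)
  (P : probability T R) (X : nat -> {RV P >-> d.-tuple R})
  (N : nat -> {RV P >-> nat}) (U : nat -> nat -> {RV P >-> R})
  (model : coupled_poisson_model X N U).
Context (g : R -> R).
Hypotheses (g01 : forall x : R, 0 <= x -> 0 <= g x <= 1)
  (g_noninc : forall x y : R, 0 <= x -> x <= y -> g y <= g x).
Context (r : R).
Hypothesis r0 : 0 < r.
Local Notation S := (@torus R d).
Local Notation Lambda := (@lebesgue_tuple R d).
Local Notation ell := (link g r).
Local Notation p := (link_prob d g r).
Local Notation edge := (edge X U g r).
Local Notation overlap := (overlap g r).

Lemma link_prob01 : 0 <= p <= 1.
Proof.
rewrite link_prob_ge0//= -lee_fin -(integral_link g01 g_noninc (nseq_tuple d 0) r0).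
rewrite -(lebesgue_tuple_torus R d) -[leRHS]mul1e.
rewrite -(integral_cst _ (@measurable_torus R d)).
have l01 (x z : d.-tuple R) := link01 g01 x z r0.
apply: ge0_le_integral => //.
- exact: measurable_torus.
- by move=> z _; rewrite lee_fin; case/andP: (l01 (nseq_tuple d 0) z).
- apply: measurable_funTS; apply/measurable_EFinP.
  exact: (measurableT_comp (measurable_link g_noninc r0) (measurable_fun_pair (measurable_cst _) (@measurable_id _ _ _))).
- by move=> z _; rewrite lee_fin; case/andP: (l01 (nseq_tuple d 0) z).
Qed.

Lemma measurable_edgeT i j : i != j -> measurable_fun setT (edge i j).
Proof.
move=> ij; apply: measurable_fun_ler; first exact: measurable_funP.
exact: (measurableT_comp (measurable_link g_noninc r0)
  (measurable_fun_pair (measurable_funP (X i)) (measurable_funP (X j)))).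
Qed.

Lemma measurable_low_degree i L t : i \notin L ->
  measurable [set w | (degree1 X U g r i L w <= t)%N].
Proof.
move=> iL; rewrite -[X in measurable X]setTI.
have : measurable_fun setT (fun w => (0 + degree1 X U g r i L w <= t)%N).
  apply: (@measurable_fun_count_le _ _ (edge i)) => j jL; apply: measurable_edgeT.
  by apply: contraNneq iL => ->.
by move=> /(_ measurableT [set true]); apply.
Qed.

Lemma iter_step2s m (phi : nat -> nat -> R) (x y : d.-tuple R) :
  iter m (step2s g r) (fun _ _ => phi) x y = iter m (step2 p (overlap x y)) phi.
Proof. by elim: m => [//|m IH]; rewrite !iterS /step2s IH. Qed.

(** The degree towards L is binomial: a single vertex is explored as a pair of
which the second counter is ignored. *)
Lemma P_low_degree i L t : i \notin L -> uniq L ->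
  P [set w | (degree1 X U g r i L w <= t)%N] = (binom_cdf p (size L) t)%:E.
Proof.
move=> iL uL.
(* any index different from i and outside L can play the second centre *)
pose i2 := (i + \sum_(j <- L) j).+1.
have i2L : i2 \notin L.
  apply/negP => h; have : (i2 <= \sum_(j <- L) j)%N.
    by rewrite (bigD1_seq i2)//= leq_addr.
  by rewrite /i2 leqNgt ltnS leq_addl.
have i12 : i != i2 by rewrite neq_ltn /i2 ltnS leq_addr.
have mE := measurable_low_degree t iL.
rewrite -[X in P X]setIT -integral_indic//.
have H := @two_centers _ _ _ _ P X N U model g g01 g_noninc r r0 i i2 i12 L
  (fun _ _ a _ => low R t a) iL i2L uL (fun a _ => measurable_cst _)
  (fun _ _ a _ => low_ge0 R t a).
transitivity (\int[P]_w (low R t (degree1 X U g r i L w))%:E)%E.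
  apply: eq_integral => w _; congr EFin; rewrite indicE /low; congr (_%:R).
  by congr nat_of_bool; apply/idP/idP; rewrite inE.
rewrite {}H (eq_integral (cst (binom_cdf p (size L) t)%:E)); last first.
  by move=> w _; rewrite iter_step2s iter_step2_fst.
by rewrite integral_cst// [X in (_ * X)%E]probability_setT mule1.
Qed.

(** By Fubini the overlap of a fixed y with a uniform x averages to the square of
p: integrating first over x gives p for every common neighbour z. *)
Lemma integral_overlap i1 i2 : i1 != i2 ->
  (\int[P]_w (overlap (X i1 w) (X i2 w))%:E = (p ^+ 2)%:E)%E.
Proof.
move=> i12.
pose c : coordinate := inl i1.
have c2 : c != inl i2 by apply/eqP => -[] e; move: i12; rewrite e eqxx.
have mX2 : measurable_fun setT (X i2 : g_sigma_algebraType (cylinders_avoiding X U c) -> _).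
  exact: measurable_avoiding_X.
have mo := measurable_overlap g01 g_noninc r0.
rewrite (@freeze_X _ _ _ _ P X N U model i1 (fun z => (overlap z.2 (X i2 z.1))%:E))/=; last 2 first.
- apply/measurable_EFinP.
  pose TT := (g_sigma_algebraType (cylinders_avoiding X U c) * d.-tuple R)%type.
  have m2 : measurable_fun setT (fun z : TT => X i2 z.1).
    exact: (measurableT_comp mX2 (@measurable_fst _ _ _ _)).
  have mp : measurable_fun setT (fun z : TT => (z.2, X i2 z.1)).
    by apply: measurable_fun_pair.
  exact: (measurableT_comp (mo d) mp).
- by move=> z; rewrite lee_fin; exact: overlap_ge0.
rewrite (eq_integral (cst (p ^+ 2)%:E)); last first.
  move=> w _; move: (X i2 w) => y.
  have l01 (x z : d.-tuple R) := link01 g01 x z r0.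
  have ml d' (T' : measurableType d') (h1 h2 : T' -> d.-tuple R) :
      measurable_fun setT h1 -> measurable_fun setT h2 ->
      measurable_fun setT (fun w => ell (h1 w) (h2 w)).
    move=> m1 m2; exact: (measurableT_comp (measurable_link g_noninc r0) (measurable_fun_pair m1 m2)).
  pose F (z : d.-tuple R * d.-tuple R) : \bar R :=
    if (z.1 \in S) && (z.2 \in S) then (ell z.1 z.2 * ell y z.2)%:E else 0%E.
  have F0 z : (0 <= F z)%E.
    rewrite /F; case: ifP => // _; rewrite lee_fin mulr_ge0//.
      by case/andP: (l01 z.1 z.2).
    by case/andP: (l01 y z.2).
  have mS : measurable_fun setT (fun x => x \in S).
    apply: (measurable_fun_bool true).
    rewrite setTI (_ : _ @^-1` _ = S); first exact: measurable_torus.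
    by apply/seteqP; split => x /=; [move=> /set_mem|move=> /mem_set].
  have mF : measurable_fun setT F.
    apply: measurable_fun_ifT => //.
      apply: measurable_and.
        exact: (measurableT_comp mS (@measurable_fst _ _ _ _)).
      exact: (measurableT_comp mS (@measurable_snd _ _ _ _)).
    apply/measurable_EFinP; apply: measurable_funM.
      exact: ml.
    exact: ml.
  transitivity (\int[Lambda]_x \int[Lambda]_z F (x, z))%E.
    rewrite integral_mkcond; apply: eq_integral => x _; rewrite patchE.
    case: ifPn => xS; last first.
      by rewrite integral0_eq// => z _; rewrite /F /= (negbTE xS).
    rewrite -overlap_integral// integral_mkcond; apply: eq_integral => z _.
    by rewrite patchE /F /= xS.
  rewrite -fubini_tonelli1// fubini_tonelli2//.
  transitivity (\int[Lambda]_(z in S) (p%:E * (ell y z)%:E))%E.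
    rewrite [RHS]integral_mkcond; apply: eq_integral => z _; rewrite patchE /fubini_G.
    case: ifPn => zS; last first.
      by rewrite integral0_eq// => x _; rewrite /F /= (negbTE zS) andbF.
    rewrite -(integral_link g01 g_noninc z r0) -ge0_integralZr//; last 4 first.
    - exact: measurable_torus.
    - by apply: measurable_funTS; apply/measurable_EFinP; exact: ml.
    - by move=> x _; rewrite lee_fin; case/andP: (l01 z x).
    - by rewrite lee_fin; case/andP: (l01 y z).
    rewrite [RHS]integral_mkcond; apply: eq_integral => x _; rewrite patchE /F/= zS andbT.
    by case: ifP => // _; rewrite -EFinM /link (torus_distC x z).
  rewrite ge0_integralZl//; last 4 first.
  - exact: measurable_torus.
  - by apply: measurable_funTS; apply/measurable_EFinP; exact: ml.
  - by move=> x _; rewrite lee_fin; case/andP: (l01 y x).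
  - by rewrite lee_fin; case/andP: link_prob01.
  by rewrite integral_link// -EFinM expr2.
by rewrite integral_cst// [X in (_ * X)%E]probability_setT mule1.
Qed.

(** Averaging the affine bound of iter_step2_le over the two centres, with the
mean p ^+ 2 of the overlap. *)
Lemma P_low_pair i1 i2 L t : i1 != i2 -> i1 \notin L -> i2 \notin L -> uniq L ->
  p <= 2^-1 ->
  (P [set w | (degree1 X U g r i1 L w <= t)%N /\ (degree1 X U g r i2 L w <= t)%N] <=
   ((1 - p) ^- (2 * t) *
    (binom_cdf p (size L) t ^+ 2 * (1 + 8 * (size L)%:R * p ^+ 2) +
     8 * (size L)%:R * p ^+ 2 * binom_cdf p (size L) t))%:E)%E.
Proof.
move=> i12 i1L i2L uL p2.
have /andP[p0 p1] := link_prob01.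
set beta := binom_cdf p (size L) t; set m := size L.
have beta0 : 0 <= beta by apply: binom_cdf_ge0; exact: link_prob01.
set A := [set w | _].
have mA : measurable A.
  by apply: measurableI; exact: measurable_low_degree.
have mphi a b : measurable_fun setT (fun z : d.-tuple R * d.-tuple R =>
    low R t a * low R t b : R) by exact: measurable_cst.
have phi0 (x y : d.-tuple R) a b : 0 <= low R t a * low R t b by rewrite mulr_ge0 ?low_ge0.
have := @two_centers _ _ _ _ P X N U model g g01 g_noninc r r0 i1 i2 i12 L
  (fun _ _ a b => low R t a * low R t b) i1L i2L uL mphi phi0.
set lhs := (X in X = _ -> _) => lhsE.
have mo : measurable_fun setT (fun w => overlap (X i1 w) (X i2 w)).
  exact: (measurableT_comp (measurable_overlap g01 g_noninc r0 (d := d))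
    (measurable_fun_pair (measurable_funP (X i1)) (measurable_funP (X i2)))).
pose q w := overlap (X i1 w) (X i2 w).
have q0 w : 0 <= q w by exact: overlap_ge0.
have qp w : q w <= p by exact: overlap_le.
have pq w : 0 <= 1 - 2 * p + q w by exact: overlap_third.
pose k := (1 - p) ^- (2 * t).
have k0 : 0 <= k by rewrite invr_ge0 exprn_ge0// subr_ge0.
apply: (@le_trans _ _ lhs).
  pose B := [set w | (degree1 X U g r i1 L w <= t)%N /\
                     (degree2 X U g r i1 i2 L w <= t)%N].
  have nL i j : i \notin L -> j \in L -> i != j by move=> iL; apply: contraTneq => <-.
  have mB : measurable B.
    apply: measurableI; first exact: measurable_low_degree.
    rewrite -[X in measurable X]setTI.
    have : measurable_fun setT (fun w => (0 + degree2 X U g r i1 i2 L w <= t)%N).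
      apply: (@measurable_fun_count_le _ _ (fun j w => ~~ edge i1 j w && edge i2 j w)) => j jL.
      apply: measurable_and; last exact: measurable_edgeT (nL _ _ i2L jL).
      by apply: measurable_neg; exact: measurable_edgeT (nL _ _ i1L jL).
    by move=> /(_ measurableT [set true]); apply.
  apply: (@le_trans _ _ (P B)).
    rewrite le_measure ?inE// => w [h1 h2]; split => //.
    apply: leq_trans h2; apply: sub_count => j; by case/andP.
  rewrite -[B in leLHS]setIT -integral_indic// /lhs le_eqVlt; apply/orP; left; apply/eqP.
  apply: eq_integral => w _; congr EFin; rewrite indicE /low -natrM mulnb.
  by congr (_%:R); congr nat_of_bool; apply/idP/idP; rewrite inE; [case=> -> ->|case/andP].
rewrite lhsE.
have mG : forall n a b, measurable_fun setT (fun z : d.-tuple R * d.-tuple R =>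
    iter n (step2s g r) (fun _ _ a b => low R t a * low R t b) z.1 z.2 a b).
  elim=> [|n IHn] a b; first exact: measurable_cst.
  by rewrite iterS; exact: (measurable_step2s g01 g_noninc r0 IHn).
have mGw : measurable_fun setT (fun w => iter m (step2s g r)
    (fun _ _ a b => low R t a * low R t b) (X i1 w) (X i2 w) 0%N 0%N).
  exact: (measurableT_comp (mG m 0%N 0%N)
    (measurable_fun_pair (measurable_funP (X i1)) (measurable_funP (X i2)))).
have G0 n (x y : d.-tuple R) a b : 0 <= iter n (step2s g r)
    (fun _ _ a b => low R t a * low R t b) x y a b.
  elim: n x y a b => [|n IHn] x y a b; first exact: phi0.
  by rewrite iterS; exact: (step2s_ge0 g01 g_noninc r0 IHn).
pose a := k * beta ^+ 2; pose b := k * (8 * m%:R * beta ^+ 2 + 8 * m%:R * beta).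
have a0 : 0 <= a by rewrite mulr_ge0 ?sqr_ge0.
have b0 : 0 <= b by rewrite mulr_ge0// addr_ge0// !mulr_ge0// ?sqr_ge0.
apply: (@le_trans _ _ (\int[P]_w (a + b * q w)%:E)%E).
  apply: ge0_le_integral => //.
  - by move=> w _; rewrite lee_fin.
  - exact/measurable_EFinP.
  - by apply/measurable_EFinP; apply: measurable_funD => //; exact: measurable_funM.
  - by move=> w _; rewrite lee_fin iter_step2s; exact: (iter_step2_le p0 (q0 w) (qp w) (pq w) m t p2).
have aE : a = k * beta ^+ 2 by [].
have bE : b = k * (8 * m%:R * beta ^+ 2 + 8 * m%:R * beta) by [].
clearbody a b.
have mq : measurable_fun setT (fun w => (q w)%:E) by exact/measurable_EFinP.
have -> : (\int[P]_w (a + b * q w)%:E = a%:E + b%:E * (p ^+ 2)%:E)%E.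
  rewrite -(integral_overlap i12) -ge0_integralZl//; last by move=> w _; rewrite lee_fin; exact: q0.
  have -> : (a%:E = \int[P]_w (cst a%:E) w)%E.
    by rewrite integral_cst// [X in (_ * X)%E]probability_setT mule1.
  rewrite -ge0_integralD//.
  - by move=> w _; rewrite -EFinM lee_fin mulr_ge0//; exact: q0.
  - exact: measurable_funeM.
rewrite -EFinM -EFinD lee_fin aE bE /k le_eqVlt; apply/orP; left; apply/eqP; ring.
Qed.

End low_degree.

(** * Existence of vertices of low degree *)

Definition others (i m : nat) : seq nat := [seq j <- iota 0 m | j != i].

Lemma others_notin i m : i \notin others i m.
Proof. by rewrite mem_filter eqxx. Qed.

Lemma others_uniq i m : uniq (others i m).
Proof. by rewrite filter_uniq// iota_uniq. Qed.

(** The term (i < m) accounts for indices i outside the range, for which nothing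
is removed. *)
Lemma size_others i m : (size (others i m) + (i < m) = m)%N.
Proof.
have := count_predC (pred1 i) (iota 0 m); rewrite size_iota.
rewrite (count_uniq_mem _ (iota_uniq _ _)) mem_iota/= add0n => e.
by rewrite -[RHS]e size_filter addnC.
Qed.

Lemma others2E i j m :
  [seq k <- others i m | k != j] = [seq k <- others j m | k != i].
Proof. by rewrite -!filter_predI; apply: eq_filter => k /=; rewrite andbC. Qed.

Lemma size_others2 i j m : i != j -> (i < m)%N -> (j < m)%N ->
  size [seq k <- others i m | k != j] = (m - 2)%N.
Proof.
move=> ij im jm; have jo : j \in others i m by rewrite mem_filter eq_sym ij mem_iota.
have := count_predC (pred1 j) (others i m).
rewrite (count_uniq_mem _ (others_uniq _ _)) jo size_filter.
have := size_others i m; rewrite im.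
rewrite (_ : count (predC _) _ = count (fun k => k != j) (others i m))//.
move: (size _) (count _ _) => a c /=; lia.
Qed.

Section low_degree_vertices.
Context (R : realType) (d : nat) disp (T : measurableType disp)
  (P : probability T R) (X : nat -> {RV P >-> d.-tuple R})
  (N : nat -> {RV P >-> nat}) (U : nat -> nat -> {RV P >-> R})
  (model : coupled_poisson_model X N U).
Context (g : R -> R).
Hypotheses (g01 : forall x : R, 0 <= x -> 0 <= g x <= 1)
  (g_noninc : forall x y : R, 0 <= x -> x <= y -> g y <= g x).
Context (r : R).
Hypothesis r0 : 0 < r.
Local Notation p := (link_prob d g r).
Local Notation deg i m w := (degree1 X U g r i (others i m) w).

(** The two events that control a whole range of sizes n between m and M.  By
monotonicity in the set of points, a vertex of low degree at size n has low
degree towards the first m points, and a vertex among the first m whose degree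
towards M points is low has low degree at size n. *)
Definition some_low_degree (M m t : nat) : set T :=
  [set w | exists2 i, (i < M)%N & (deg i m w <= t)%N].

Definition no_low_degree (M m t : nat) : set T :=
  [set w | forall i, (i < m)%N -> (t < deg i M w)%N].

Lemma measurable_some_low_degree M m t : measurable (some_low_degree M m t).
Proof.
rewrite (_ : some_low_degree M m t = \bigcup_(i in `I_M) [set w | (deg i m w <= t)%N]).
  apply: fin_bigcup_measurable; first exact: finite_II.
  by move=> i _; apply: measurable_low_degree => //; exact: others_notin.
by apply/seteqP; split => w [i iM h]; exists i.
Qed.

Lemma measurable_no_low_degree M m t : measurable (no_low_degree M m t).
Proof.
rewrite (_ : no_low_degree M m t = \bigcap_(i in `I_m) ~` [set w | (deg i M w <= t)%N]).
  apply: fin_bigcap_measurable; first exact: finite_II.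
  move=> i _; apply: measurableC; apply: measurable_low_degree => //; exact: others_notin.
by apply/seteqP; split => w h i im; have := h i im; rewrite /= ltnNge => /negP.
Qed.

(** Union bound.  Only m.-1 of the other points are kept for every i, so that the
degrees have the same law whether i < m or not. *)
Lemma P_some_low_degree M m t : (0 < m)%N ->
  (P (some_low_degree M m t) <= (M%:R * binom_cdf p m.-1 t)%:E)%E.
Proof.
move=> m0; pose L i := take m.-1 (others i m).
pose E i := [set w | (degree1 X U g r i (L i) w <= t)%N].
have LN i : i \notin L i by apply: contra (others_notin i m); exact: mem_take.
have sL i : size (L i) = m.-1.
  by rewrite size_takel//; have := size_others i m; case: (i < m)%N => /=; lia.
have mE i : measurable (E i) by exact: measurable_low_degree.
have PE i : P (E i) = (binom_cdf p m.-1 t)%:E.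
  by rewrite (P_low_degree model g01 g_noninc r0 _ (LN i)) ?sL// take_uniq ?others_uniq.
apply: (@le_trans _ _ (\sum_(i < M) P (E i))%E).
  apply: content_subadditive => //; first exact: measurable_some_low_degree.
  move=> w [i iM h]; rewrite -bigcup_mkord; exists i => //=.
  apply: leq_trans h; rewrite /degree1 -[in leqRHS](cat_take_drop m.-1 (others i m)).
  by rewrite count_cat leq_addr.
under eq_bigr do rewrite PE.
by rewrite sumEFin sumr_const card_ord lee_fin mulr_natl.
Qed.

(** Second moment method for the vertices i < m.  For a pair of vertices both are
removed from the list of explored points, which lowers its size to M - 2;
binom_cdfS compares the distribution functions for M - 1 and M - 2 points. *)
Lemma P_no_low_degree M m t : (0 < m)%N -> (m <= M)%N -> (2 <= M)%N -> p <= 2^-1 ->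
  0 < binom_cdf p (M - 2) t ->
  (P (no_low_degree M m t) <=
   ((m%:R * ((1 - p) * binom_cdf p (M - 2) t))^-1 +
    (1 - p) ^- (2 * t + 2) * (1 + 8 * (M - 2)%:R * p ^+ 2 +
       8 * (M - 2)%:R * p ^+ 2 / binom_cdf p (M - 2) t) - 1)%:E)%E.
Proof.
move=> m0 mM M2 p2 beta0; have /andP[p0 p1] := link_prob01 d g01 g_noninc r0.
have p01 : 0 <= p <= 1 by apply/andP.
set beta := binom_cdf p (M - 2) t.
have q0 : 0 < 1 - p by lra.
pose E (i : 'I_m) := [set w | (deg i M w <= t)%N].
pose b := binom_cdf p M.-1 t.
have bb : (1 - p) * beta <= b.
  have -> : b = binom_cdf p (M - 2).+1 t by rewrite /b; congr binom_cdf; lia.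
  exact: binom_cdfS.
have b0 : 0 < b by apply: lt_le_trans bb; rewrite mulr_gt0.
have mE i : measurable (E i) by apply: measurable_low_degree => //; exact: others_notin.
have PE i : P (E i) = b%:E.
  rewrite (P_low_degree model g01 g_noninc r0 _ (others_notin i M)) ?others_uniq//.
  by congr (binom_cdf _ _ _)%:E; have := size_others i M; rewrite (leq_trans (ltn_ord i) mM) /=; lia.
pose Q := (1 - p) ^- (2 * t) * (beta ^+ 2 * (1 + 8 * (M - 2)%:R * p ^+ 2) +
     8 * (M - 2)%:R * p ^+ 2 * beta).
have Q0 : 0 <= Q.
  by rewrite mulr_ge0 ?invr_ge0 ?exprn_ge0 ?(ltW q0)// addr_ge0// !mulr_ge0 ?exprn_ge0 ?addr_ge0// ?mulr_ge0 ?exprn_ge0// ltW.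
have PQ i j : i != j -> (P (E i `&` E j) <= Q%:E)%E.
  move=> ij; pose L : seq nat := [seq k <- others (nat_of_ord i) M | k != nat_of_ord j].
  have iM := leq_trans (ltn_ord i) mM; have jM := leq_trans (ltn_ord j) mM.
  have ijn : i != j :> nat by [].
  have iL : (i : nat) \notin L by rewrite mem_filter (negbTE (others_notin _ _)) andbF.
  have jL : (j : nat) \notin L by rewrite mem_filter eqxx.
  have uL : uniq L by rewrite filter_uniq// others_uniq.
  have := P_low_pair model g01 g_noninc r0 t ijn iL jL uL p2.
  rewrite size_others2//; apply: le_trans; rewrite le_measure ?inE//.
  - exact: measurableI.
  - by apply: measurableI; apply: measurable_low_degree.
  - move=> w [h1 h2]; split; [apply: leq_trans h1|apply: leq_trans h2].
      by rewrite /degree1 /L count_filter; apply: sub_count => k /= /andP[].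
    by rewrite /degree1 /L others2E count_filter; apply: sub_count => k /= /andP[].
have -> : no_low_degree M m t = [set w | forall i, ~ E i w].
  apply/seteqP; split => w h i; first by rewrite /E/=; apply/negP; rewrite -ltnNge; exact: h.
  by move=> im; have := h (Ordinal im); rewrite /E/= => /negP; rewrite -ltnNge.
apply: le_trans (second_moment m0 b0 Q0 mE PE PQ) _.
rewrite lee_fin lerB// lerD//.
  rewrite lef_pV2 ?posrE ?mulr_gt0 ?ltr0n//.
  by rewrite ler_wpM2l// ltW.
apply: (@le_trans _ _ (Q / ((1 - p) * beta) ^+ 2)).
  rewrite ler_wpM2l// lef_pV2 ?posrE ?exprn_gt0 ?mulr_gt0//.
  by rewrite lerXn2r// nnegrE ltW// mulr_gt0.
rewrite le_eqVlt; apply/orP; left; apply/eqP; rewrite /Q exprD; field.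
by rewrite ?expf_neq0 ?gt_eqF.
Qed.

End low_degree_vertices.

(** * The rate function and a factorial bound *)

Section rate_function_facts.
Context (R : realType).
Implicit Types x y : R.

(** The convention ln 0 = 0 makes the formula valid at 0. *)
Lemma rateHE x : rateH x = 1 - x + x * ln x.
Proof. by rewrite /rateH; case: eqP => [->|//]; rewrite subr0 mul0r addr0. Qed.

Lemma ln_lt_subr1 x : 0 < x -> x != 1 -> ln x < x - 1.
Proof.
move=> x0 x1; have l0 : ln x != 0 by rewrite ln_eq0.
by have := expR_gt1Dx l0; rewrite lnK ?posrE//; lra.
Qed.

Lemma ln_le_subr1 x : 0 < x -> ln x <= x - 1.
Proof. by move=> x0; have := expR_ge1Dx (ln x); rewrite lnK ?posrE//; lra. Qed.

Lemma rateH_gt0 x : 0 < x -> x != 1 -> 0 < rateH x.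
Proof.
move=> x0 x1; rewrite rateHE.
have xV : 0 < x^-1 by rewrite invr_gt0.
have xV1 : x^-1 != 1 by rewrite invr_eq1.
have := ln_lt_subr1 xV xV1; rewrite lnV ?posrE// => h.
have h' : x * - ln x < 1 - x.
  by rewrite (_ : 1 - x = x * (x^-1 - 1)) ?ltr_pM2l//; field; rewrite gt_eqF.
lra.
Qed.

(** The strict inequality ln u < u - 1 at u = y / x replaces differentiation. *)
Lemma rateH_decr x y : 0 <= x -> x < y -> y <= 1 -> rateH y < rateH x.
Proof.
move=> x0 xy y1; have y0 : 0 < y by exact: le_lt_trans xy.
have ly : ln y <= 0 by exact: ln_le0.
rewrite !rateHE; have [->|xn0] := eqVneq x 0; first nra.
have {}x0 : 0 < x by rewrite lt_neqAle eq_sym xn0.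
have q0 : 0 < y / x by rewrite divr_gt0.
have q1 : y / x != 1.
  by apply: contraTneq xy => /(congr1 (fun z => z * x)); rewrite divfK// mul1r => ->; rewrite ltxx.
have := ln_lt_subr1 q0 q1; rewrite ln_div ?posrE// => h.
have h' : x * (ln y - ln x) < y - x.
  by rewrite (_ : y - x = x * (y / x - 1)) ?ltr_pM2l//; field.
have : 0 <= (y - x) * - ln y by rewrite mulr_ge0 ?oppr_ge0// subr_ge0 ltW.
lra.
Qed.

Lemma ln_le_eps (c : R) : 0 < c -> exists2 x0 : R, 0 < x0 &
  forall x, x0 <= x -> ln x <= c * x.
Proof.
move=> c0; exists (1 + `|ln (c / 2)| * (2 / c)).
  by rewrite ltr_pwDl// mulr_ge0// divr_ge0// ltW.
move=> x xx; have x0 : 0 < x.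
  by apply: lt_le_trans xx; rewrite ltr_pwDl// mulr_ge0// divr_ge0// ltW.
have c2 : 0 < c / 2 by rewrite divr_gt0.
have := ln_le_subr1 (mulr_gt0 c2 x0); rewrite lnM ?posrE//.
have := ler_norm (- ln (c / 2)); rewrite normrN => h1 h2.
have : `|ln (c / 2)| <= c / 2 * x.
  have : `|ln (c / 2)| * (2 / c) <= x by lra.
  by rewrite mulrA ler_pdivrMr// => ?; lra.
lra.
Qed.

(** Intermediate value theorem on `[e, 1] for a small e > 0: the logarithm is
continuous there. *)
Lemma rateH_surj (y : R) : 0 < y -> y < 1 -> exists2 x, 0 < x < 1 & rateH x = y.
Proof.
move=> y0 y1.
(* rateH (exp (- s)) = 1 - exp (- s) * (1 + s) is at least y as soon as
   s * (1 - y) >= 4 *)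
pose s := 4 / (1 - y); have s0 : 0 < s by rewrite divr_gt0// subr_gt0.
pose e := expR (- s); have e0 : 0 < e by exact: expR_gt0.
have e1 : e < 1 by rewrite -expR0 ltr_expR oppr_lt0.
have lne : ln e = - s by rewrite /e expRK.
have sy : s * (1 - y) = 4 by rewrite /s divfK// subr_eq0 gt_eqF.
have h1 : 1 + s / 2 <= expR (s / 2) by exact: expR_ge1Dx.
have h2 : e * expR (s / 2) ^+ 2 = 1.
  by rewrite -expRM_natl -expRD -expR0; congr expR; field.
clearbody e s.
have He : y <= rateH e.
  rewrite rateHE lne.
  suff : e * (1 + s) <= 1 - y by lra.
  have h3 : e * (1 + s / 2) ^+ 2 <= 1.
    have hs : 0 <= 1 + s / 2 by lra.
    by rewrite -[leRHS]h2 ler_wpM2l ?(ltW e0)// lerXn2r// ?nnegrE ?expR_ge0.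
  have : e * (1 + s / 2) ^+ 2 * (1 - y) <= 1 - y by rewrite ler_piMl ?subr_ge0 ?(ltW y1).
  apply: le_trans; rewrite -mulrA ler_wpM2l ?(ltW e0)//.
  have -> : (1 + s / 2) ^+ 2 * (1 - y) =
    (1 - y) + s * (1 - y) + s * (1 - y) * s / 4 by field.
  rewrite sy; lra.
have H1 : rateH 1 = 0 :> R by rewrite rateHE ln1; lra.
have cont : {within `[e, 1], continuous (@rateH R)}.
  apply: (@continuous_in_subspaceT _ _ `[e, 1]%classic) => x /[!inE]/=.
  rewrite in_itv/= => /andP[ex _]; have x0 : 0 < x by exact: lt_le_trans ex.
  rewrite (_ : @rateH R = fun x => 1 - x + x * ln x); last by apply/funext => z; rewrite rateHE.
  apply: cvgD; first by apply: cvgB; [exact: cvg_cst|exact: cvg_id].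
  by apply: cvgM; [exact: cvg_id|exact: continuous_ln].
have [|c] := @IVT _ _ e 1 y (ltW e1) cont.
  by rewrite H1 ge_min le_max (ltW y0) He orbT.
rewrite in_itv/= => /andP[ec c1] Hc; exists c => //.
rewrite (lt_le_trans e0 ec)/= lt_neqAle c1 andbT; apply/eqP => c1'.
by move: y0; rewrite -Hc c1' H1 ltxx.
Qed.

Lemma Hinv_minusP (y : R) : 0 < y -> y < 1 ->
  0 < Hinv_minus y < 1 /\ rateH (Hinv_minus y) = y.
Proof.
move=> y0 y1; have [x /andP[x0 x1] <-] := rateH_surj y0 y1.
suff -> : Hinv_minus (rateH x) = x by rewrite x0 x1.
rewrite /Hinv_minus pinvKV//; last by rewrite inE/= in_itv/= (ltW x0) ltW.
move=> a b; rewrite !inE/= !in_itv/= => /andP[a0 a1] /andP[b0 b1] ab.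
by case: (ltgtP a b) => // h; [have := rateH_decr a0 h b1|have := rateH_decr b0 h a1];
  rewrite ab ltxx.
Qed.

End rate_function_facts.

Section stirling.
Context (R : realType).

(** A crude Stirling bound, sharp up to polynomial factors: the induction step
is (1 - 1/(k+2)) ^+ (k+2) <= 1/e. *)
Lemma fact_le_expR (k : nat) : k`!%:R <= k.+1%:R ^+ k.+1 * expR (- k%:R) :> R.
Proof.
elim: k => [|k IH]; first by rewrite expr1 mul1r oppr0 expR0.
rewrite factS natrM; apply: (le_trans (ler_wpM2l (ler0n _ _) IH)).
rewrite mulrA -exprS.
have k0 : (0 : R) < k.+1%:R by rewrite ltr0n.
have k2 : (0 : R) < k.+2%:R by rewrite ltr0n.
have h : k.+1%:R / k.+2%:R <= expR (- (k.+2%:R)^-1) :> R.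
  apply: le_trans (expR_ge1Dx _); rewrite ler_pdivrMr// mulrDl mulNr mulVf ?gt_eqF//.
  by rewrite mul1r -(natr1 k.+1); lra.
have : (k.+1%:R / k.+2%:R) ^+ k.+2 <= expR (- 1) :> R.
  rewrite (le_trans (lerXn2r k.+2 _ _ h)) ?nnegrE ?expR_ge0 ?divr_ge0//.
  by rewrite -expRM_natl mulrN mulfV ?gt_eqF.
rewrite expr_div_n ler_pdivrMr ?exprn_gt0// => h2.
have := ler_wpM2r (expR_ge0 (- k%:R)) h2; move=> /le_trans; apply.
rewrite mulrAC -expRD mulrC ler_wpM2l ?exprn_ge0//.
by rewrite ler_expR -natr1; lra.
Qed.

End stirling.

(** * Large deviations of the binomial distribution *)

Section binomial_large_deviations.
Context (R : realType).

(** The Chernoff bound at s = a, the optimal choice for the level a * tau. *)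
Lemma binom_cdf_le_expR (p tau a : R) (m t : nat) : 0 <= p <= 1 ->
  0 < a -> a <= 1 -> t%:R <= a * tau -> tau <= m%:R * p ->
  binom_cdf p m t <= expR (- tau * rateH a).
Proof.
move=> p01 a0 a1 ta taum; have /andP[p0 p1] := p01.
apply: (le_trans (binom_cdf_chernoff m t p01 a0 a1)).
have la : ln a <= 0 by exact: ln_le0.
have -> : a ^+ t = expR (t%:R * ln a) by rewrite expRM_natl lnK.
rewrite -expRN.
have base : 1 - p + p * a <= expR (- (p * (1 - a))).
  by apply: le_trans (expR_ge1Dx _); rewrite le_eqVlt; apply/orP; left; apply/eqP; ring.
have base0 : 0 <= 1 - p + p * a by rewrite addr_ge0 ?mulr_ge0 ?subr_ge0// ltW.
apply: (@le_trans _ _ (expR (- (p * (1 - a))) ^+ m * expR (- (t%:R * ln a)))).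
  by rewrite ler_wpM2r ?expR_ge0// lerXn2r// nnegrE expR_ge0.
rewrite -expRM_natl -expRD ler_expR rateHE.
have h1 : tau * (1 - a) <= m%:R * p * (1 - a) by rewrite ler_wpM2r// subr_ge0.
have h2 : t%:R * - ln a <= a * tau * - ln a by rewrite ler_wpM2r// oppr_ge0.
lra.
Qed.

Lemma bin_ge_expn (m k : nat) : ((m - k) ^ k <= 'C(m, k) * k`!)%N.
Proof.
rewrite bin_ffact; elim: k m => [|k IH] m; first by rewrite expn0 ffactn0.
case: m => [|m]; first by rewrite exp0n.
rewrite subSS ffactSS expnS; apply: leq_mul; last exact: IH.
by rewrite (leq_trans (leq_subr _ _)).
Qed.

Lemma expR_le_subr1 (p : R) : p <= 2^-1 -> 0 <= p -> expR (- (p + 2 * p ^+ 2)) <= 1 - p.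
Proof.
move=> p2 p0; have h : 0 < 1 - p by lra.
have : expR (p + 2 * p ^+ 2) >= (1 - p)^-1.
  apply: le_trans (expR_ge1Dx _); rewrite -[leLHS]mul1r ler_pdivrMr//.
  have : 0 <= p ^+ 2 * (1 - 2 * p) by rewrite mulr_ge0 ?sqr_ge0//; lra.
  by move=> ?; nra.
by rewrite expRN -[leRHS]invrK lef_pV2 ?posrE ?invr_gt0 ?expR_gt0.
Qed.

(** Stirling lower bound for a single Poisson weight at level k close to a * mu;
the error 2 + 2 * ln mu is negligible before mu. *)
Lemma poisson_term_ge (a mu : R) (k : nat) : 0 <= a -> a < 1 -> (1 - a)^-1 <= mu ->
  k%:R <= a * mu -> a * mu < k.+1%:R ->
  expR (mu * (a - a * ln a) - 2 - 2 * ln mu) <= mu ^+ k / k`!%:R.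
Proof.
move=> a0 a1 muge kle ltk.
have a10 : 0 < 1 - a by rewrite subr_gt0.
have mu0 : 0 < mu by apply: lt_le_trans muge; rewrite invr_gt0.
have mua : 1 <= mu * (1 - a) by rewrite -ler_pdivrMr// div1r.
have mu1 : 1 <= mu by nra.
have lmu : 0 <= ln mu by rewrite ln_ge0.
have f0 : 0 < k`!%:R :> R by rewrite ltr0n fact_gt0.
have k1 : 0 < k.+1%:R :> R by rewrite ltr0n.
rewrite ler_pdivlMr//.
apply: (le_trans (ler_wpM2l (expR_ge0 _) (fact_le_expR R k))).
have -> : k.+1%:R ^+ k.+1 = expR (k.+1%:R * ln k.+1%:R) :> R by rewrite expRM_natl lnK.
have -> : mu ^+ k = expR (k%:R * ln mu) by rewrite expRM_natl lnK.
rewrite -!expRD ler_expR.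
pose l := ln k.+1%:R - ln mu.
have lE : ln k.+1%:R = ln mu + l by rewrite /l; ring.
have k1mu : k.+1%:R <= mu by rewrite -natr1; lra.
have l0 : l <= 0 by rewrite subr_le0 ler_ln ?posrE.
have lmul : - l <= ln mu by rewrite /l opprB lerBlDr lerDl ln_ge0// ler1n.
have key : mu * (a - a * ln a) - 1 <= a * mu * (1 - l).
  have [->|an0] := eqVneq a 0; first by rewrite !mul0r; lra.
  have {}a0 : 0 < a by rewrite lt_neqAle eq_sym an0.
  have amu0 : 0 < a * mu by rewrite mulr_gt0.
  have : l <= ln a + (a * mu)^-1.
    rewrite /l lerBlDr.
    have : ln k.+1%:R <= ln ((a * mu) * (1 + (a * mu)^-1)) :> R.
      have -> : a * mu * (1 + (a * mu)^-1) = a * mu + 1.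
        by rewrite mulrDr mulr1 divff// gt_eqF.
      by rewrite ler_ln ?posrE ?addr_gt0// -natr1 lerD2r.
    rewrite !lnM ?posrE ?mulr_gt0 ?addr_gt0 ?invr_gt0//.
    have := @le_ln1Dx R (a * mu)^-1; rewrite (lt_trans _ (_ : 0 < (a * mu)^-1)) ?invr_gt0 ?ltrN10//.
    by move=> /(_ isT); lra.
  move=> /(ler_wpM2l (ltW amu0)); rewrite (mulrDr (a * mu) (ln a)) divff ?gt_eqF//; lra.
have kl : (a * mu - 1) * (1 - l) <= k%:R * (1 - l).
  by rewrite ler_wpM2r//; [lra|rewrite -natr1 in ltk; lra].
rewrite -natr1 lE; lra.
Qed.

(** The single binomial term k = floor (a * m p) already has the right
exponential order, and for small p it is comparable with a Poisson weight. *)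
Lemma binom_cdf_ge_expR (a eps : R) : 0 <= a -> a < 1 -> 0 < eps ->
  exists mu0 p0 : R, 0 < p0 /\
  forall (p : R) (m : nat), 0 < p -> p <= p0 -> mu0 <= m%:R * p ->
  expR (- (m%:R * p) * (rateH a + eps)) <=
  binom_cdf p m (Num.truncn (a * (m%:R * p))).
Proof.
move=> a0 a1 e0.
have e8 : 0 < eps / 8 by rewrite divr_gt0.
have [x0 x00 lnx] := ln_le_eps e8.
exists (Num.max x0 (Num.max (1 - a)^-1 (8 / eps))).
exists (Num.min 2^-1 (eps / 16)); split.
  by rewrite lt_min invr_gt0 ltr0n divr_gt0.
move=> p m p0; rewrite le_min => /andP[p2 pe].
pose mu := m%:R * p; rewrite -/mu !ge_max => /andP[hx0 /andP[ha he]].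
pose k := Num.truncn (a * mu).
have a10 : 0 < 1 - a by rewrite subr_gt0.
have mu0 : 0 < mu by apply: lt_le_trans ha; rewrite invr_gt0.
have p01 : 0 <= p <= 1 by apply/andP; split; lra.
have amu : 0 <= a * mu by rewrite mulr_ge0// ltW.
have /andP[kle ltk] := truncn_itv amu; rewrite -/k in kle ltk.
apply: le_trans (binom_cdf_ge_term m p01 (leqnn k)).
have f0 : 0 < k`!%:R :> R by rewrite ltr0n fact_gt0.
have m0 : 0 < m%:R :> R by move: mu0; rewrite /mu pmulr_lgt0.
have km : k%:R <= m%:R * p.
  by apply: le_trans kle _; rewrite -/mu ler_piMl// ltW.
have kmn : (k <= m)%N by rewrite -(ler_nat R); nra.
have q0 : 0 <= 1 - p by lra.
have bin : (m%:R * (1 - p)) ^+ k / k`!%:R <= 'C(m, k)%:R :> R.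
  rewrite ler_pdivrMr// -natrM.
  apply: (@le_trans _ _ ((m - k)%N%:R ^+ k)); last by rewrite -natrX ler_nat bin_ge_expn.
  rewrite lerXn2r ?nnegrE ?mulr_ge0// natrB//; nra.
apply: (@le_trans _ _ ((m%:R * (1 - p)) ^+ k / k`!%:R * p ^+ k * (1 - p) ^+ m)).
  have -> : (m%:R * (1 - p)) ^+ k / k`!%:R * p ^+ k * (1 - p) ^+ m =
     mu ^+ k / k`!%:R * (1 - p) ^+ (m + k).
    by rewrite exprD /mu !exprMn; ring.
  have T := poisson_term_ge a0 a1 ha kle ltk.
  have E : expR (- (mu * (1 + eps / 2))) <= (1 - p) ^+ (m + k).
    apply: (@le_trans _ _ (expR (- (p + 2 * p ^+ 2)) ^+ (m + k))); last first.
      by rewrite lerXn2r ?nnegrE ?expR_ge0//; apply: expR_le_subr1 => //; exact: ltW.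
    rewrite -expRM_natl ler_expR natrD.
    have h1 : (m%:R + k%:R) * p <= mu * (1 + p).
      by have := ler_wpM2r (ltW p0) km; rewrite /mu; lra.
    have h2 : (m%:R + k%:R) * p * (1 + 2 * p) <= mu * (1 + p) * (1 + 2 * p).
      by rewrite ler_wpM2r//; lra.
    have h3 : (1 + p) * (1 + 2 * p) <= 1 + eps / 2 by nra.
    have := ler_wpM2l (ltW mu0) h3; lra.
  apply: le_trans (ler_pM (expR_ge0 _) (expR_ge0 _) T E).
  rewrite -expRD ler_expR rateHE.
  have := lnx mu hx0.
  have : 8 <= eps * mu by rewrite -ler_pdivrMl// mulrC.
  lra.
rewrite ler_pM ?exprn_ge0//.
- by rewrite mulr_ge0 ?exprn_ge0 ?(ltW p0)// divr_ge0 ?(ltW f0)// exprn_ge0// mulr_ge0.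
- by rewrite ler_wpM2r// exprn_ge0// ltW.
- by rewrite ler_wiXn2l ?leq_subr//; lra.
Qed.

End binomial_large_deviations.

(** * Borel-Cantelli and Poisson concentration *)

Section borel_cantelli_geometric.
Context disp (T : measurableType disp) (R : realType) (P : probability T R).

(** The events are required to be measurable only from k0 on, because the radii
of the graphs are positive only for large indices. *)
Lemma borel_cantelli_geometric (F : nat -> set T) (K z : R) (k0 : nat) :
  (forall k, (k0 <= k)%N -> measurable (F k)) -> 0 <= K -> 0 <= z -> z < 1 ->
  (forall k, (k0 <= k)%N -> (P (F k) <= (K * z ^+ k)%:E)%E) ->
  {ae P, forall w, \forall k \near \oo, ~ F k w}.
Proof.
move=> mF K0 z0 z1 PF.
pose F' k := if (k < k0)%N then set0 else F k.
have mF' k : measurable (F' k).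
  by rewrite /F'; case: ltnP => // h; exact: mF.
have PF' k : (P (F' k) <= (K * z ^+ k)%:E)%E.
  rewrite /F'; case: ltnP => h; last exact: PF.
  by rewrite measure0 lee_fin mulr_ge0// exprn_ge0.
have S : (\sum_(k <oo) P (F' k) < +oo)%E.
  apply: (@le_lt_trans _ _ (\sum_(k <oo) (K * z ^+ k)%:E)%E).
    by apply: lee_nneseries => // k _; exact: measure_ge0.
  have cg : series (geometric K z) @ \oo --> K * (1 - z)^-1.
    by apply: cvg_geometric_series; rewrite ger0_norm.
  rewrite (_ : (\sum_(k <oo) _)%E = (limn (series (geometric K z)))%:E) ?ltry//.
  rewrite -EFin_lim; last by apply/cvg_ex; exists (K * (1 - z)^-1).
  by congr (limn _); apply/funext => n; rewrite /= /series/= -sumEFin.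
have := lim_sup_set_cvg0 mF' S => Z.
exists (lim_sup_set F'); split => //.
  apply: bigcap_measurable => // n _; exact: bigcup_measurable.
move=> w /= h n _ /=; apply: contrapT => h2; apply: h.
exists (maxn n k0) => // k /= ; rewrite geq_max => /andP[nk k0k] Fw.
by apply: h2; exists k => //; rewrite /F' ltnNge k0k.
Qed.

End borel_cantelli_geometric.

Section poisson_tails.
Context disp (T : measurableType disp) (R : realType) (P : probability T R).

(** Tilting: the Poisson weight of mean n at k is at most exp (- n * rateH x)
times the Poisson weight of mean n * x, whenever k lies beyond n * x on the side
given by the sign of ln x; both tails are covered at once. *)
Lemma poisson_deviation (N : {RV P >-> nat}) (n : nat) (x : R) (A : set nat) :
  (0 < n)%N -> 0 < x ->
  (forall k : nat, distribution P N [set k] = (poisson_pmf (n%:R : R) k)%:E) ->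
  (forall k, A k -> n%:R * x * ln x <= k%:R * ln x) ->
  (P (N @^-1` A) <= (expR (- n%:R * rateH x))%:E)%E.
Proof.
move=> n0 x0 Npmf hA.
have nx0 : 0 < n%:R * x :> R by rewrite mulr_gt0 ?ltr0n.
pose m : {measure set nat -> \bar R} := distribution P N.
pose m' : {measure set nat -> \bar R} := poisson_prob (n%:R * x) 0.
pose C := expR (- n%:R * rateH x).
have tr (B : set nat) : trivIset setT (fun k => B `&` [set k]).
  by apply/trivIsetP => i j _ _ ij; rewrite -subset0 => k /= [[_ ->] [_ e]]; move: ij; rewrite e eqxx.
have cov (B : set nat) : B = \bigcup_k (B `&` [set k]).
  by apply/seteqP; split => [k Bk|k [j _ []//]]; exists k.
have sum (mu : {measure set nat -> \bar R}) (B : set nat) :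
    mu B = (\sum_(k <oo) mu (B `&` [set k]))%E.
  by rewrite {1}(cov B) measure_semi_bigcup.
have bound k : (m (A `&` [set k]) <= C%:E * m' (setT `&` [set k]))%E.
  have [Ak|Ak] := pselect (A k); last first.
    rewrite (_ : _ `&` _ = set0) ?measure0; last by rewrite -subset0 => j /= [+ jk]; rewrite jk.
    by rewrite mule_ge0// lee_fin expR_ge0.
  rewrite setIidr => [|j ->//]; rewrite setTI.
  rewrite [leLHS]Npmf [X in (_ * X)%E](_ : _ = (poisson_pmf (n%:R * x) k)%:E); last first.
    rewrite /m' /= /poisson_prob nx0 esum_set1// lee_fin poisson_pmf_ge0//.
  rewrite -EFinM lee_fin /poisson_pmf ltr0n n0 nx0 exprMn.
  have xk : x ^+ k = expR (k%:R * ln x) by rewrite expRM_natl lnK.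
  have -> : C * (n%:R ^+ k * x ^+ k / k`!%:R * expR (- (n%:R * x))) =
     n%:R ^+ k / k`!%:R * (C * x ^+ k * expR (- (n%:R * x))) by ring.
  rewrite ler_wpM2l ?divr_ge0 ?exprn_ge0//.
  rewrite /C xk -!expRD ler_expR rateHE.
  have := hA k Ak; lra.
rewrite -[leLHS]/(m A) (sum m).
apply: (@le_trans _ _ (\sum_(k <oo) C%:E * m' (setT `&` [set k]))%E).
  by apply: lee_nneseries => // k _; exact: measure_ge0.
rewrite nneseriesZl; last by move=> k _; exact: measure_ge0.
rewrite -(sum m') [X in (_ * X)%E](_ : _ = 1%E) ?mule1//.
exact: (@probability_setT _ _ _ (poisson_prob (n%:R * x) 0)).
Qed.

Lemma poisson_concentration (N : nat -> {RV P >-> nat}) (rho : R) : 1 < rho ->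
  (forall n, (0 < n)%N -> forall k : nat,
    distribution P (N n) [set k] = (poisson_pmf (n%:R : R) k)%:E) ->
  {ae P, forall w, \forall n \near \oo,
    n%:R / rho < (N n w)%:R /\ (N n w)%:R < n%:R * rho}.
Proof.
move=> rho1 Npmf.
have rho0 : 0 < rho by lra.
have tail (x : R) (A : nat -> set nat) : 0 < x -> x != 1 ->
    (forall n k, A n k -> n%:R * x * ln x <= k%:R * ln x) ->
    {ae P, forall w, \forall n \near \oo, ~ A n (N n w)}.
  move=> x0 x1 hA.
  have Hx := rateH_gt0 x0 x1.
  apply: (@borel_cantelli_geometric _ _ _ P (fun n => N n @^-1` A n) 1
    (expR (- rateH x)) 1) => //.
  - by move=> k _; rewrite -[X in measurable X]setTI; exact: measurable_funP.
  - by rewrite -expR0 ltr_expR oppr_lt0.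
  - move=> n n0; rewrite mul1r -expRM_natl mulrN -mulNr.
    by apply: (poisson_deviation n0 x0 (Npmf n n0)) => k; exact: hA.
have tup := tail rho (fun n => [set k | n%:R * rho <= k%:R]) rho0.
have tlo := tail rho^-1 (fun n => [set k | k%:R <= n%:R / rho]).
have up : {ae P, forall w, \forall n \near \oo, ~ (n%:R * rho <= (N n w)%:R)}.
  apply: tup; first by rewrite gt_eqF.
  by move=> n k /= h; rewrite ler_wpM2r// ln_ge0// ltW.
have lo : {ae P, forall w, \forall n \near \oo, ~ ((N n w)%:R <= n%:R / rho)}.
  apply: tlo; first by rewrite invr_gt0.
    by rewrite invr_eq1 gt_eqF.
  by move=> n k /= h; rewrite lnV ?posrE// !mulrN lerN2 ler_wpM2r// ln_ge0// ltW.
apply: filterS2 up lo => w h1 h2.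
near=> n; split; rewrite ltNge; apply/negP.
- by near: n.
- by near: n.
Unshelve. all: by end_near. Qed.

End poisson_tails.

(** * Monotonicity of the minimum degree *)

Lemma bigmin_leq (I : eqType) (s : seq I) (F : I -> nat) (x : nat) j : j \in s ->
  (\big[minn/x]_(i <- s) F i <= F j)%N.
Proof.
elim: s => // i s IH; rewrite inE big_cons => /orP[/eqP ->|/IH h].
  exact: geq_minl.
exact: leq_trans (geq_minr _ _) h.
Qed.

Lemma min_degree_le (V : finType) (e : rel V) v : (min_degree e <= degree e v)%N.
Proof. by apply: bigmin_leq; rewrite mem_index_enum. Qed.

Lemma min_degree_gt (V : finType) (e : rel V) t : (t < #|V|)%N ->
  (forall v, t < degree e v)%N -> (t < min_degree e)%N.
Proof.
move=> tV h; apply: (big_ind (fun x => t < x)%N) => // x y tx ty.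
by rewrite leq_min tx.
Qed.

Lemma card_ord_count (m : nat) (Q : pred nat) :
  #|[pred j : 'I_m | Q j]| = count Q (iota 0 m).
Proof. by rewrite -val_enum_ord count_map cardE enumT size_filter. Qed.

Section graph_degrees.
Context (R : realType) (d : nat) disp (T : measurableType disp)
  (P : probability T R) (X : nat -> {RV P >-> d.-tuple R})
  (U : nat -> nat -> {RV P >-> R}) (g : R -> R).
Hypothesis g_noninc : forall x y : R, 0 <= x -> x <= y -> g y <= g x.
Local Notation deg r i m w := (degree1 X U g r i (others i m) w).
Local Notation graph r m w :=
  (@connection_graph R d g (fun i => X i w) (fun i j => U i j w) r m).

(** The adjacency relation of the graph reads the mark of the ordered pair and
the distance in that order; symmetry of the distance identifies it with edge. *)
Lemma degree_graph (r : R) (m : nat) (v : 'I_m) w :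
  degree (graph r m w) v = deg r v m w.
Proof.
rewrite /degree /degree1 /others count_filter.
rewrite -(card_ord_count m); apply: eq_card => j; rewrite !inE /=.
rewrite /connection_graph /edge /pair_of /link.
case: (ltngtP v j) => //= h; rewrite ?eqxx ?andbF//.
by rewrite andbT torus_distC.
Qed.

Lemma le_edge (r r' : R) i j w : 0 < r -> r <= r' ->
  edge X U g r i j w -> edge X U g r' i j w.
Proof.
move=> r0 rr'; rewrite /edge => /le_trans; apply; apply: g_noninc.
  by rewrite divr_ge0 ?torus_dist_ge0// (le_trans (ltW r0)).
rewrite ler_wpM2l ?torus_dist_ge0// lef_pV2// posrE//.
exact: lt_le_trans rr'.
Qed.

Lemma le_degree1 (r r' : R) i m m' w : 0 < r -> r <= r' -> (m <= m')%N ->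
  (deg r i m w <= deg r' i m' w)%N.
Proof.
move=> r0 rr' /subnK <-.
rewrite /degree1 /others addnC iotaD filter_cat count_cat (leq_trans _ (leq_addr _ _))//.
by apply: sub_count => j; exact: le_edge.
Qed.

Lemma degree1_lt (r : R) i m w : (i < m)%N -> (deg r i m w < m)%N.
Proof.
move=> im; apply: (@leq_ltn_trans (size (others i m))); first exact: count_size.
by have := size_others i m; rewrite im; lia.
Qed.

Lemma min_degree_gt_of_some (r r' : R) M m n t w : 0 < r -> r <= r' ->
  (0 < m)%N -> (m <= n)%N -> (n <= M)%N ->
  ~ some_low_degree X U g r M m t w -> (t < min_degree (graph r' n w))%N.
Proof.
move=> r0 rr' m0 mn nM h.
have D i : (i < n)%N -> (t < deg r' i n w)%N.
  move=> ni; rewrite ltnNge; apply/negP => le; apply: h; exists i.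
    exact: leq_trans nM.
  exact: leq_trans (le_degree1 _ _ r0 rr' mn) le.
apply: min_degree_gt => [|v]; last by rewrite degree_graph; exact: D.
have n0 := leq_trans m0 mn; rewrite card_ord.
exact: ltn_trans (D _ n0) (degree1_lt _ _ n0).
Qed.

Lemma min_degree_le_of_no (r r' : R) M m n t w : 0 < r' -> r' <= r ->
  (m <= n)%N -> (n <= M)%N ->
  ~ no_low_degree X U g r M m t w -> (min_degree (graph r' n w) <= t)%N.
Proof.
move=> r0 rr' mn nM h; rewrite leqNgt; apply/negP => lt; apply: h => i im.
have ni := leq_trans im mn.
apply: leq_trans lt _; apply: leq_trans (min_degree_le _ (Ordinal ni)) _.
by rewrite degree_graph; exact: le_degree1.
Qed.

End graph_degrees.

(** * The connection radius along a geometric scale *)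

Section scales.
Context (R : realType).

Lemma near_expR_ge (h c : R) : 0 < h -> \forall k \near \oo, c <= expR (h * k%:R).
Proof.
move=> h0; near=> k; apply: le_trans (expR_ge1Dx _).
suff : c <= h * k%:R by lra.
by rewrite mulrC -ler_pdivrMr//; near: k; exact: nbhs_infty_ger.
Unshelve. all: by end_near. Qed.

(** The index is shifted by one so that the block k uses the scales k to k + 3:
one step of margin on each side absorbs the fluctuations of the number of
points. *)
Lemma scale_index (h : R) (K : nat) : 0 < h ->
  \forall n \near \oo, exists2 k, (K <= k)%N &
    expR (h * k.+1%:R) <= n%:R <= expR (h * k.+2%:R).
Proof.
move=> h0; near=> n.
have nK : expR (h * K.+1%:R) <= n%:R by near: n; exact: nbhs_infty_ger.
have n0 : 0 < n%:R :> R by apply: lt_le_trans nK; exact: expR_gt0.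
have l : h * K.+1%:R <= ln n%:R by rewrite -ler_expR lnK.
pose x := ln (n%:R : R) / h.
have xK : K.+1%:R <= x by rewrite ler_pdivlMr// mulrC.
have x0 : 0 <= x by apply: le_trans xK; rewrite ler0n.
have /andP[h1 h2] := truncn_itv x0.
have jK : (K.+1 <= Num.truncn x)%N by rewrite truncn_ge_nat.
exists (Num.truncn x).-1; first by rewrite -ltnS prednK// (leq_trans _ jK).
have xh : n%:R = expR (h * x) :> R by rewrite /x mulrCA mulfV ?gt_eqF// mulr1 lnK.
rewrite prednK ?(leq_trans _ jK)//.
by rewrite xh !ler_expR !ler_pM2l// h1 ltW.
Unshelve. all: by end_near. Qed.

(** The radius rhat with a real argument in place of n. *)
Definition conn_radius (d : nat) (alpha gamma x : R) : R :=
  (gamma * ln x / (alpha * x)) `^ d%:R^-1.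

Variables (d : nat) (alpha gamma : R).
Hypotheses (d0 : (0 < d)%N) (alpha0 : 0 < alpha) (gamma0 : 0 < gamma).
Local Notation rad := (conn_radius d alpha gamma).

Lemma conn_radius_base_gt0 x : 1 < x -> 0 < gamma * ln x / (alpha * x).
Proof.
move=> x1; have x0 : 0 < x by exact: lt_trans x1.
by rewrite divr_gt0 ?mulr_gt0 ?ln_gt0.
Qed.

Lemma conn_radius_gt0 x : 1 < x -> 0 < rad x.
Proof. by move=> x1; apply: powR_gt0; exact: conn_radius_base_gt0. Qed.

Lemma conn_radiusX x : 1 < x -> rad x ^+ d = gamma * ln x / (alpha * x).
Proof.
move=> x1; rewrite /conn_radius -powR_mulrn ?powR_ge0// -powRrM.
by rewrite mulVf ?pnatr_eq0 -?lt0n// powRr1// ltW// conn_radius_base_gt0.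
Qed.

(** ln x / x decreases on [e, +oo[. *)
Lemma le_conn_radius x y : expR 1 <= x -> x <= y -> rad y <= rad x.
Proof.
move=> ex xy.
have x1 : 1 < x by apply: lt_le_trans ex; rewrite -expR0 ltr_expR.
have y1 : 1 < y by exact: lt_le_trans xy.
have x0 : 0 < x by exact: lt_trans x1.
have y0 : 0 < y by exact: lt_trans y1.
have bx := ltW (conn_radius_base_gt0 x1); have by_ := ltW (conn_radius_base_gt0 y1).
apply: ge0_ler_powR; rewrite ?nnegrE ?invr_ge0//.
have E z : 0 < z -> gamma * ln z / (alpha * z) = gamma / alpha * (ln z / z).
  by move=> z0; field; rewrite !gt_eqF.
rewrite !E// ler_pM2l ?divr_gt0// ler_pdivrMr// mulrAC ler_pdivlMr//.
have lx : 1 <= ln x by rewrite -ler_expR lnK.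
have h1 : ln y <= ln x + (y / x - 1).
  have := ln_le_subr1 (divr_gt0 y0 x0); rewrite ln_div ?posrE//; lra.
have q : 0 <= y / x - 1 by rewrite subr_ge0 ler_pdivlMr// mul1r.
have h2 : ln y <= y / x * ln x by nra.
rewrite (_ : ln x * y = y / x * ln x * x); last by field; rewrite gt_eqF.
by rewrite ler_pM2r.
Qed.

Lemma near_conn_radius_lt (h r0 : R) : 0 < h -> 0 < r0 ->
  \forall k \near \oo, rad (expR (h * k%:R)) < r0.
Proof.
move=> h0 r00.
pose c := alpha * r0 ^+ d / (2 * gamma).
have c0 : 0 < c by rewrite divr_gt0 ?mulr_gt0 ?exprn_gt0.
have [x0 x00 lx] := ln_le_eps c0.
near=> k.
have xx : x0 <= expR (h * k%:R) by near: k; exact: near_expR_ge.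
have k0 : 0 < k%:R :> R by near: k; exact: nbhs_infty_gtr.
have x1 : 1 < expR (h * k%:R) by rewrite expR_gt1 mulr_gt0.
move: (expR _) xx x1 => x xx x1; have x0' : 0 < x by exact: lt_trans x1.
have rx := ltW (conn_radius_gt0 x1).
rewrite -(@ltr_pXn2r _ d) ?nnegrE ?(ltW r00)//.
rewrite conn_radiusX// ltr_pdivrMr ?mulr_gt0//.
apply: (@le_lt_trans _ _ (gamma * (c * x))); first by rewrite ler_pM2l// lx.
have -> : gamma * (c * x) = r0 ^+ d * (alpha * x) / 2.
  by rewrite /c; field; rewrite gt_eqF.
have : 0 < r0 ^+ d * (alpha * x) by rewrite !mulr_gt0 ?exprn_gt0.
lra.
Unshelve. all: by end_near. Qed.

End scales.

Section link_prob_scale.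
Context (R : realType) (d : nat) (g : R -> R).
Hypotheses (g01 : forall x : R, 0 <= x -> 0 <= g x <= 1)
  (g_noninc : forall x y : R, 0 <= x -> x <= y -> g y <= g x)
  (alpha_pos : (0 < radial_integral d g)%E)
  (alpha_fin : (radial_integral d g < +oo)%E).
Hypothesis d0 : (0 < d)%N.
Let alpha := fine (radial_integral d g).

Lemma fine_radial_gt0 : 0 < alpha.
Proof. by apply: fine_gt0; rewrite alpha_pos. Qed.

Lemma rhatE gamma n : rhat d g gamma n = conn_radius d alpha gamma n%:R.
Proof. by []. Qed.

(** Along the scale x = exp (h * k) the connection probability is
gamma * ln x / x up to a factor exp (- h). *)
Lemma near_link_prob (gamma h : R) : 0 < gamma -> 0 < h ->
  \forall k \near \oo,
    let r := conn_radius d alpha gamma (expR (h * k%:R)) in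
    let y := gamma * (h * k%:R) * expR (- (h * k%:R)) in
    [/\ 0 < r, 0 < y, expR (- h) * y <= link_prob d g r & link_prob d g r <= y].
Proof.
move=> gamma0 h0; have alpha0 := fine_radial_gt0.
have e0 : 0 < 1 - expR (- h) by rewrite subr_gt0 -expR0 ltr_expR oppr_lt0.
have [r0 r00 hr0] := link_prob_ge g01 g_noninc alpha_pos alpha_fin e0.
near=> k.
have rr0 : conn_radius d alpha gamma (expR (h * k%:R)) < r0.
  by near: k; exact: (near_conn_radius_lt d0 alpha0 gamma0 h0 r00).
set r := conn_radius _ _ _ _; set y := gamma * _ * _.
have k0 : 0 < k%:R :> R by near: k; exact: nbhs_infty_gtr.
have x1 : 1 < expR (h * k%:R) by rewrite expR_gt1 mulr_gt0.
have rp : 0 < r by exact: conn_radius_gt0.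
have yE : y = alpha * r ^+ d.
  by rewrite conn_radiusX// expRK /y expRN; field; rewrite !gt_eqF ?expR_gt0.
have yp : 0 < y by rewrite yE mulr_gt0 ?exprn_gt0.
split => //.
  have := hr0 r rp rr0; rewrite yE -/alpha; rewrite mulrA.
  by rewrite opprB addrCA subrr addr0.
by rewrite yE; exact: link_prob_le.
Unshelve. all: by end_near. Qed.

End link_prob_scale.

(** * The almost sure lower bound *)

Section almost_sure_bounds.
Context (R : realType) (d : nat) disp (T : measurableType disp)
  (P : probability T R) (g : R -> R) (X : nat -> {RV P >-> d.-tuple R})
  (N : nat -> {RV P >-> nat}) (U : nat -> nat -> {RV P >-> R}).
Hypotheses (d0 : (0 < d)%N)
  (g01 : forall x : R, 0 <= x -> 0 <= g x <= 1)
  (g_noninc : forall x y : R, 0 <= x -> x <= y -> g y <= g x)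
  (alpha_pos : (0 < radial_integral d g)%E)
  (alpha_fin : (radial_integral d g < +oo)%E)
  (model : coupled_poisson_model X N U).
Variable gamma : R.
Hypothesis gamma0 : 0 < gamma.
Let alpha := fine (radial_integral d g).
Local Notation rad j h := (conn_radius d alpha gamma (expR (h * j%:R))).
Local Notation pk j h := (link_prob d g (rad j h)).

Lemma truncn_expR_itv (x : R) :
  (Num.truncn (expR x))%:R <= expR x < (Num.truncn (expR x)).+1%:R.
Proof. exact/truncn_itv/expR_ge0. Qed.

(** For n in the k-th block, both the number of points and the radius lie between
values that depend on k only, provided the number of points is within a factor
exp h of n. *)
Lemma block_bounds (h : R) (k n v : nat) : 0 < h ->
  (expR 1 : R) <= expR (h * k.+1%:R) -> expR (h * k.+1%:R) <= n%:R <= expR (h * k.+2%:R) ->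
  n%:R / expR h < v%:R /\ v%:R < n%:R * expR h ->
  [/\ (Num.truncn (expR (h * k%:R)) <= v)%N,
      (v <= Num.truncn (expR (h * k.+3%:R)))%N,
      0 < rhat d g gamma n, rad k.+2 h <= rhat d g gamma n
    & rhat d g gamma n <= rad k.+1 h].
Proof.
move=> h0 e1 /andP[n1 n2] [v1 v2].
have alpha0 : 0 < alpha by exact: fine_radial_gt0.
have en : expR 1 <= n%:R :> R by exact: le_trans e1 n1.
have n1' : 1 < n%:R :> R by apply: lt_le_trans en; rewrite expR_gt1.
split.
- have : (Num.truncn (expR (h * k%:R)))%:R < v%:R :> R.
    have /andP[le _] := truncn_expR_itv (h * k%:R).
    apply: le_lt_trans le _; apply: le_lt_trans v1.
    rewrite ler_pdivlMr ?expR_gt0// -expRD; apply: le_trans _ n1.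
    by rewrite ler_expR -natr1; lra.
  by rewrite ltr_nat => /ltnW.
- rewrite truncn_ge_nat ?expR_ge0//; apply: le_trans (ltW v2) _.
  apply: (le_trans (ler_wpM2r (expR_ge0 _) n2)); rewrite -expRD ler_expR.
  by rewrite -(natr1 k.+2); lra.
- by rewrite rhatE; exact: conn_radius_gt0.
- by rewrite rhatE; apply: le_conn_radius.
- by rewrite rhatE; apply: le_conn_radius.
Qed.

(** In the k-th block the smallest graph has at least exp (h * k) points and
radius rad k.+2, hence mean degree at least tau k.  The union bound over
exp (h * (k + 3)) vertices leaves a geometric sequence of ratio z < 1. *)
Lemma as_min_degree_ge (a h : R) : 0 < a -> a <= 1 -> 0 < h ->
  1 < expR (- (4 * h)) * gamma * rateH a ->
  {ae P, forall w, \forall n \near \oo,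
    a * expR (- (4 * h)) * gamma * ln n%:R <= (delta g X N U gamma n w)%:R}.
Proof.
move=> a0 a1 h0 H1.
(* of the factor expR (- (4 * h)), two units come from using exp (h * k) points
   with the radius of scale k + 2, one from the bound on the connection
   probability, and one from rounding the number of points *)
pose tau (k : nat) := expR (- (4 * h)) * gamma * (h * k.+2%:R).
have tau0 k : 0 <= tau k by rewrite !mulr_ge0 ?expR_ge0// ltW.
pose t k := Num.truncn (a * tau k).
have tk k : (t k)%:R <= a * tau k < (t k).+1%:R.
  by apply: truncn_itv; rewrite mulr_ge0// ltW.
pose M k := Num.truncn (expR (h * k.+3%:R)).
pose m k := Num.truncn (expR (h * k%:R)).
pose F k := some_low_degree X U g (rad k.+2 h) (M k) (m k) (t k).
pose z := expR (h * (1 - expR (- (4 * h)) * gamma * rateH a)).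
have Hpos : 0 < rateH a.
  have c0 : 0 < expR (- (4 * h)) * gamma by rewrite mulr_gt0 ?expR_gt0.
  by rewrite -(pmulr_rgt0 (rateH a) c0) (lt_trans ltr01 H1).
have big : \forall k \near \oo, [/\ 0 < rad k.+2 h, (0 < m k)%N &
    tau k <= (m k).-1%:R * pk k.+2 h].
  near=> k.
  have [r0 y0 lo _] : [/\ 0 < rad k.+2 h, 0 < gamma * (h * k.+2%:R) * expR (- (h * k.+2%:R)),
     expR (- h) * (gamma * (h * k.+2%:R) * expR (- (h * k.+2%:R))) <= pk k.+2 h
     & pk k.+2 h <= gamma * (h * k.+2%:R) * expR (- (h * k.+2%:R))].
    near: k.
    have [K _ hK] := near_link_prob g01 g_noninc alpha_pos alpha_fin d0 gamma0 h0.
    by exists K => // k /= Kk; apply: hK => /=; rewrite (leq_trans Kk)// -addn2 leq_addr.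
  have Em : expR (h * k%:R) - 2 <= (m k).-1%:R.
    have /andP[_] := truncn_expR_itv (h * k%:R); rewrite -/(m k) => lt.
    have : (m k).+1%:R <= (m k).-1%:R + 2 :> R by rewrite -natrD ler_nat; lia.
    lra.
  have big2 : expR (- h) * expR (h * k%:R) <= expR (h * k%:R) - 2.
    have e0 : 0 < 1 - expR (- h) by rewrite subr_gt0 expR_lt1 oppr_lt0.
    have : 2 / (1 - expR (- h)) <= expR (h * k%:R) by near: k; exact: near_expR_ge.
    by rewrite ler_pdivrMr//; lra.
  split => //.
    rewrite truncn_gt0; have := expR_gt0 (h * k%:R).
    have := mulr_gt0 (expR_gt0 (- h)) (expR_gt0 (h * k%:R)); lra.
  apply: (@le_trans _ _ (expR (- h) * expR (h * k%:R) *
    (expR (- h) * (gamma * (h * k.+2%:R) * expR (- (h * k.+2%:R)))))).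
    rewrite /tau.
    have -> : expR (- h) * expR (h * k%:R) *
      (expR (- h) * (gamma * (h * k.+2%:R) * expR (- (h * k.+2%:R)))) =
      (expR (- h) * expR (h * k%:R) * expR (- h) * expR (- (h * k.+2%:R))) *
       (gamma * (h * k.+2%:R)) by ring.
    rewrite -mulrA -!expRD le_eqVlt; apply/orP; left; apply/eqP; congr (expR _ * _).
    by rewrite -(natr1 k.+1) -(natr1 k); ring.
  apply: ler_pM => //; rewrite ?mulr_ge0 ?expR_ge0 ?(ltW gamma0) ?(ltW h0)//.
  exact: le_trans Em.
have [k0 _ hk0] := big.
have ae1 : {ae P, forall w, \forall k \near \oo, ~ F k w}.
  apply: (@borel_cantelli_geometric _ _ _ P F (expR (3 * h)) z k0).
  - by move=> k /hk0[r0 _ _]; exact: measurable_some_low_degree.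
  - exact: expR_ge0.
  - exact: expR_ge0.
  - by rewrite expR_lt1 pmulr_rlt0// subr_lt0.
  - move=> k /hk0 [r0 m0 taum].
    apply: le_trans (P_some_low_degree model g01 g_noninc r0 (M k) (t k) m0) _.
    rewrite lee_fin.
    have p01 := link_prob01 d g01 g_noninc r0.
    have /andP[tle _] := tk k.
    have B := binom_cdf_le_expR p01 a0 a1 tle taum.
    have /andP[Mle _] := truncn_expR_itv (h * k.+3%:R).
    apply: (le_trans (ler_pM _ _ Mle B)); rewrite ?ler0n ?binom_cdf_ge0//.
    rewrite -expRD -expRM_natl -expRD ler_expR /tau.
    have : 0 <= expR (- (4 * h)) * gamma * rateH a * (h * 2).
      by rewrite !mulr_ge0 ?expR_ge0 ?(ltW h0) ?(ltW gamma0) ?(ltW Hpos).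
    rewrite -(natr1 k.+2) -(natr1 k.+1) -(natr1 k); lra.
have eh1 : 1 < expR h by rewrite expR_gt1.
apply: filterS2 ae1 (poisson_concentration eh1 (N_poisson model)) => w [k1 _ hk1] hN.
have kbig : \forall k \near \oo, (expR 1 : R) <= expR (h * k%:R) by exact: near_expR_ge.
have [k2 _ hk2] := kbig.
have si := scale_index (maxn k0 (maxn k1 k2)) h0.
near=> n.
have [k] : exists2 k, (maxn k0 (maxn k1 k2) <= k)%N &
    expR (h * k.+1%:R) <= n%:R <= expR (h * k.+2%:R) by near: n.
rewrite !geq_max => /and3P[kk0 kk1 kk2] nk.
have nN : n%:R / expR h < (N n w)%:R /\ (N n w)%:R < n%:R * expR h by near: n.
have [mN NM rn0 rr _] := block_bounds h0 (hk2 k.+1 (leqW kk2)) nk nN.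
have [r0 m0 _] := hk0 k kk0.
have := min_degree_gt_of_some g_noninc r0 rr m0 mN NM (hk1 k kk1).
rewrite -/(delta g X N U gamma n w) => tlt.
have /andP[_ /ltW ht] := tk k.
apply: (@le_trans _ _ (a * tau k)).
  have /andP[n1 n2] := nk.
  have n0 : 0 < n%:R :> R by apply: lt_le_trans n1; exact: expR_gt0.
  rewrite /tau -!mulrA ler_pM2l// ler_pM2l ?expR_gt0// ler_pM2l//.
  by rewrite -ler_expR lnK.
by apply: (le_trans ht); rewrite ler_nat.
Unshelve. all: by end_near. Qed.

End almost_sure_bounds.

(** * The almost sure upper bound *)

Section second_moment_numerics.
Context (R : realType).

(** The three error terms of the second moment bound: few expected low degree
vertices, the tilting factor, and the correlation of two vertices. *)
Lemma second_moment_bound_le (p beta : R) (m M t : nat) :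
  0 <= p -> p <= 2^-1 -> 0 < beta -> beta <= 1 -> (0 < m)%N ->
  8 * t.+1%:R * p <= 1 ->
  (m%:R * ((1 - p) * beta))^-1 +
  (1 - p) ^- (2 * t + 2) * (1 + 8 * M%:R * p ^+ 2 + 8 * M%:R * p ^+ 2 / beta) - 1 <=
  2 / (m%:R * beta) + 8 * t.+1%:R * p + 32 * (M%:R * p ^+ 2) / beta.
Proof.
move=> p0 p2 b0 b1 m0 tp.
have q0 : 0 < 1 - p by lra.
have m0' : 0 < m%:R :> R by rewrite ltr0n.
have mb0 : 0 < m%:R * beta by rewrite mulr_gt0.
have qV : (1 - p)^-1 <= 1 + 2 * p.
  rewrite -[leLHS]mul1r ler_pdivrMr//; nra.
have A : (m%:R * ((1 - p) * beta))^-1 <= 2 / (m%:R * beta).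
  rewrite mulrCA invfM ler_pM2r ?invr_gt0//; lra.
have B : (1 - p) ^- (2 * t + 2) <= 1 + 8 * t.+1%:R * p.
  rewrite -exprVn.
  have qV0 : 0 <= (1 - p)^-1 by rewrite invr_ge0 ltW.
  have p20 : 0 <= 2 * p by rewrite mulr_ge0.
  have e : (2 * t + 2)%N%:R * (2 * p) = 4 * t.+1%:R * p.
    by rewrite natrD natrM -(natr1 t); ring.
  have h : (2 * t + 2)%N%:R * (2 * p) <= 2^-1 by rewrite e; lra.
  apply: (@le_trans _ _ ((1 + 2 * p) ^+ (2 * t + 2))).
    by rewrite lerXn2r ?nnegrE ?addr_ge0.
  by apply: le_trans (exprD1_le p20 h) _; rewrite e; lra.
pose D := 8 * M%:R * p ^+ 2 / beta.
have Mp : 0 <= 8 * M%:R * p ^+ 2 by rewrite !mulr_ge0 ?exprn_ge0.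
have D0 : 0 <= D by rewrite divr_ge0// ltW.
have MD : 8 * M%:R * p ^+ 2 <= D by rewrite ler_pdivlMr// ler_piMr.
have DE : 32 * (M%:R * p ^+ 2) / beta = 4 * D by rewrite /D; field; rewrite gt_eqF.
rewrite DE -/D.
have K0 : 0 <= (1 - p) ^- (2 * t + 2) by rewrite invr_ge0 exprn_ge0// ltW.
have t0 : 0 <= 8 * t.+1%:R * p by rewrite !mulr_ge0.
have E1 : 1 + 8 * M%:R * p ^+ 2 + D <= 1 + 2 * D by lra.
have E2 : (1 - p) ^- (2 * t + 2) * (1 + 8 * M%:R * p ^+ 2 + D) <=
    (1 + 8 * t.+1%:R * p) * (1 + 2 * D).
  by apply: ler_pM => //; rewrite addr_ge0// addr_ge0.
have E3 : 8 * t.+1%:R * p * (2 * D) <= 2 * D by rewrite ler_piMl// mulr_ge0.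
move: A E2 E3; move: (_ * p) (_^-1) => u v; lra.
Qed.

Lemma poly_absorb (c0 c z x E : R) : 0 <= c0 -> 0 <= c -> 0 <= z -> 0 <= x ->
  1 <= E -> x <= z * E ->
  c0 * x * (c * c0 * x + 1) <= (c * c0 ^+ 2 * z ^+ 2 + c0 * z) * E ^+ 2.
Proof.
move=> c00 cp z0 x0 E1 xz.
have E0 : 0 <= E by lra.
have x2 : x ^+ 2 <= (z * E) ^+ 2 by rewrite lerXn2r ?nnegrE ?mulr_ge0.
have h1 := ler_wpM2l (mulr_ge0 cp (sqr_ge0 c0)) x2.
have h2 := ler_wpM2l c00 xz.
have h3 : c0 * (z * E) <= c0 * (z * E ^+ 2) by rewrite !ler_wpM2l// expr2 ler_peMl.
lra.
Qed.

End second_moment_numerics.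

Section almost_sure_upper_bound.
Context (R : realType) (d : nat) disp (T : measurableType disp)
  (P : probability T R) (g : R -> R) (X : nat -> {RV P >-> d.-tuple R})
  (N : nat -> {RV P >-> nat}) (U : nat -> nat -> {RV P >-> R}).
Hypotheses (d0 : (0 < d)%N)
  (g01 : forall x : R, 0 <= x -> 0 <= g x <= 1)
  (g_noninc : forall x y : R, 0 <= x -> x <= y -> g y <= g x)
  (alpha_pos : (0 < radial_integral d g)%E)
  (alpha_fin : (radial_integral d g < +oo)%E)
  (model : coupled_poisson_model X N U).
Variable gamma : R.
Hypothesis gamma0 : 0 < gamma.
Let alpha := fine (radial_integral d g).
Local Notation rad j h := (conn_radius d alpha gamma (expR (h * j%:R))).
Local Notation pk j h := (link_prob d g (rad j h)).

(** In the k-th block the largest graph has at most exp (h * (k + 3)) points and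
radius rad k.+1, hence mean degree mu k <= tau k.  A vertex has low degree with
probability at least exp (- theta * y k) where theta < 1, so the expected number
of such vertices grows like exp ((1 - theta) * y k), and each error term of the
second moment bound is a polynomial in y k times
exp (- (1 - theta) * y k). *)
Lemma as_min_degree_le (a h eps : R) : 0 <= a -> a < 1 -> 0 < h -> 0 < eps ->
  expR (2 * h) * gamma * (rateH a + eps) < 1 ->
  {ae P, forall w, \forall n \near \oo,
    (delta g X N U gamma n w)%:R <= a * expR (2 * h) * gamma * ln n%:R}.
Proof.
move=> a0 a1 h0 eps0 H1.
have Ha : 0 < rateH a.
  have /(rateH_decr a0 a1) := lexx (1 : R).
  by rewrite {1}rateHE ln1 subrr mulr0 addr0.
pose theta := expR (2 * h) * gamma * (rateH a + eps).
have theta0 : 0 < theta by rewrite !mulr_gt0 ?expR_gt0// addr_gt0.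
pose eta := (1 - theta) / 4.
have eta0 : 0 < eta by rewrite divr_gt0// subr_gt0.
have etaE : theta = 1 - 4 * eta by rewrite /eta; field.
pose y k : R := h * k.+1%:R.
have y0 k : 0 < y k by rewrite mulr_gt0.
pose M k := Num.truncn (expR (h * k.+3%:R)).
pose m k := Num.truncn (expR (h * k%:R)).
pose mu k := (M k - 2)%N%:R * pk k.+1 h.
pose t k := Num.truncn (a * mu k).
pose tau k := expR (2 * h) * gamma * y k.
pose beta k := binom_cdf (pk k.+1 h) (M k - 2) (t k).
pose F k := no_low_degree X U g (rad k.+1 h) (M k) (m k) (t k).
have [mu0 [p0 [p00 large]]] := binom_cdf_ge_expR a0 a1 eps0.
(* polynomial factors in y k are absorbed by exp (eta * y k), where
   4 * eta = 1 - theta; this leaves the summable bound W k *)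
have yle k : y k <= eta^-1 * expR (eta * y k).
  rewrite ler_pdivlMl//; apply: le_trans (expR_ge1Dx _); lra.
pose K1 := expR (2 * h) * gamma ^+ 2 * eta^-1 ^+ 2 + gamma * eta^-1.
have K10 : 0 <= K1.
  by rewrite addr_ge0// !mulr_ge0 ?expR_ge0 ?exprn_ge0 ?invr_ge0// ltW.
have poly k : gamma * y k * (tau k + 1) <= K1 * expR (2 * (eta * y k)).
  have -> : expR (2 * (eta * y k)) = expR (eta * y k) ^+ 2 by rewrite expRM_natl.
  apply: poly_absorb => //; rewrite ?invr_ge0 ?expR_ge0 ?(ltW gamma0) ?(ltW eta0) ?(ltW (y0 k))//.
  by rewrite -expR0 ler_expR mulr_ge0 ?ltW.
have mu_le k : pk k.+1 h <= gamma * y k * expR (- y k) -> mu k <= tau k.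
  move=> hi; have /andP[Mle _] := truncn_expR_itv (h * k.+3%:R).
  have M2 : (M k - 2)%N%:R <= expR (h * k.+3%:R).
    by apply: le_trans Mle; rewrite ler_nat leq_subr.
  apply: (@le_trans _ _ (expR (h * k.+3%:R) * (gamma * y k * expR (- y k)))).
    apply: (@le_trans _ _ ((M k - 2)%N%:R * (gamma * y k * expR (- y k)))).
      by rewrite ler_wpM2l.
    by rewrite ler_wpM2r// !mulr_ge0 ?expR_ge0// ltW.
  have -> : expR (h * k.+3%:R) * (gamma * y k * expR (- y k)) =
    expR (h * k.+3%:R) * expR (- y k) * gamma * y k by ring.
  rewrite -expRD /tau (_ : h * k.+3%:R + - y k = 2 * h)//.
  by rewrite /y -(natr1 k.+2) -(natr1 k.+1); ring.
have tau0 k : 0 <= tau k by rewrite !mulr_ge0 ?expR_ge0// ltW.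
pose W k := expR (- (2 * (eta * y k))).
have W0 k : 0 < W k by exact: expR_gt0.
have eta1 : 4 * eta < 1 by rewrite -subr_gt0 -etaE.
have smallW k : gamma * y k * (tau k + 1) * expR (- y k) <= K1 * W k.
  apply: (le_trans (ler_wpM2r (expR_ge0 _) (poly k))).
  rewrite -mulrA -expRD ler_wpM2l// ler_expR.
  by have := mulr_gt0 eta0 (y0 k); have := y0 k; nra.
have t_le k : pk k.+1 h <= gamma * y k * expR (- y k) -> (t k)%:R <= tau k /\ (t k)%:R <= a * tau k.
  move=> hi.
  have mu_ge0 : 0 <= mu k.
    rewrite mulr_ge0// link_prob_ge0//; apply: conn_radius_gt0 => //.
      exact: fine_radial_gt0.
    by rewrite expR_gt1 mulr_gt0.
  have /andP[tle _] := truncn_itv (mulr_ge0 a0 mu_ge0).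
  have h1 : a * mu k <= a * tau k by rewrite ler_wpM2l// mu_le.
  have h2 : a * tau k <= tau k by rewrite ler_piMl// ltW.
  by split; [apply: le_trans tle (le_trans h1 h2)|apply: le_trans tle h1].
have tp_le k : 0 < pk k.+1 h -> pk k.+1 h <= gamma * y k * expR (- y k) ->
    (t k).+1%:R * pk k.+1 h <= K1 * W k.
  move=> plo hi; apply: le_trans (smallW k).
  have [tt _] := t_le k hi.
  apply: (@le_trans _ _ ((tau k + 1) * (gamma * y k * expR (- y k)))); last first.
    by rewrite le_eqVlt; apply/orP; left; apply/eqP; ring.
  by apply: ler_pM => //; [exact: ltW|rewrite -natr1 lerD2r].
have Wz k : W k <= expR (- (2 * eta * h)) ^+ k.
  rewrite -expRM_natl ler_expR /y -(natr1 k).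
  by have := mulr_gt0 eta0 h0; lra.
have eW k : expR (theta * y k) * expR (- y k) <= W k.
  rewrite -expRD ler_expR etaE.
  by have := mulr_gt0 eta0 (y0 k); lra.
have e2h : 0 < 2 * eta * h by rewrite mulr_gt0// mulr_gt0.
have big : \forall k \near \oo, [/\ 0 < rad k.+1 h,
    pk k.+1 h <= gamma * y k * expR (- y k), 0 < pk k.+1 h,
    pk k.+1 h <= Num.min p0 2^-1 & mu0 <= mu k] /\
    [/\ (2 <= M k)%N, (m k <= M k)%N, expR (y k - 2 * h) <= (m k)%:R
     & 8 * (t k).+1%:R * pk k.+1 h <= 1].
  near=> k.
  have [r0 yy0 lo hi] : [/\ 0 < rad k.+1 h, 0 < gamma * y k * expR (- y k),
     expR (- h) * (gamma * y k * expR (- y k)) <= pk k.+1 h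
     & pk k.+1 h <= gamma * y k * expR (- y k)].
    near: k.
    have [K _ hK] := near_link_prob g01 g_noninc alpha_pos alpha_fin d0 gamma0 h0.
    by exists K => // k /= Kk; exact: (hK k.+1 (leqW Kk)).
  have plo : 0 < pk k.+1 h by apply: lt_le_trans lo; rewrite mulr_gt0 ?expR_gt0.
  have KW c : 0 < c -> K1 / c <= expR (2 * eta * h * k%:R) -> K1 * W k <= c.
    move=> c0 hc; have : K1 <= c * expR (2 * eta * h * k%:R) by rewrite mulrC -ler_pdivrMr.
    move=> /(ler_wpM2r (ltW (W0 k))) /le_trans; apply.
    rewrite -(mulrA c) /W -expRD ler_piMr ?(ltW c0)// expR_le1 /y -(natr1 k).
    by have := mulr_gt0 eta0 h0; lra.
  have p00' : 0 < Num.min p0 2^-1 by rewrite lt_min p00 invr_gt0 ltr0n.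
  have Kp : K1 / Num.min p0 2^-1 <= expR (2 * eta * h * k%:R).
    by near: k; exact: near_expR_ge.
  have K8 : K1 / 8^-1 <= expR (2 * eta * h * k%:R) by near: k; exact: near_expR_ge.
  have Ep : expR (h * k%:R) * (1 - expR (- h)) >= 3.
    have e0 : 0 < 1 - expR (- h) by rewrite subr_gt0 expR_lt1 oppr_lt0.
    by rewrite -ler_pdivrMr//; near: k; exact: near_expR_ge.
  have Ek : expR (h * k%:R) - expR (- h) * expR (h * k%:R) >= 3 by lra.
  have ek3 : expR (h * k%:R) <= expR (h * k.+3%:R).
    by rewrite ler_expR ler_pM2l// ler_nat -addn3 leq_addr.
  have ek2 : 3 <= expR (h * k.+3%:R) - expR (h * k.+2%:R).
    apply: (le_trans Ek).
    have -> : expR (h * k.+2%:R) = expR (- h) * expR (h * k.+3%:R).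
      by rewrite -expRD; congr expR; rewrite -(natr1 k.+2); ring.
    have : expR (- h) <= 1 by rewrite expR_le1 oppr_le0 ltW.
    move: (expR (- h)) (expR (h * k%:R)) (expR (h * k.+3%:R)) ek3 => A B C BC A1; nra.
  have /andP[Mle Mgt] := truncn_expR_itv (h * k.+3%:R).
  have /andP[mle mgt] := truncn_expR_itv (h * k%:R).
  have pos1 := expR_gt0 (h * k.+2%:R).
  have M2 : (2 <= M k)%N.
    by rewrite truncn_ge_nat ?expR_ge0//; lra.
  split; split => //.
  - apply: (le_trans hi); apply: (@le_trans _ _ (K1 * W k)).
      apply: le_trans (smallW k); apply: ler_wpM2r; first exact: expR_ge0.
      by apply: ler_peMr; [rewrite mulr_ge0 ?ltW|rewrite lerDr].
    by apply: KW.
  - have yk : mu0 <= gamma * y k.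
      have : mu0 / gamma / h <= k%:R by near: k; exact: nbhs_infty_ger.
      rewrite !ler_pdivrMr// => /le_trans; apply.
      rewrite (mulrC gamma) ler_wpM2r ?(ltW gamma0)// mulrC ler_wpM2l ?(ltW h0)//.
      by rewrite ler_nat.
    apply: (le_trans yk).
    have ME : expR (h * k.+2%:R) <= (M k - 2)%N%:R.
      rewrite natrB//; move: Mgt; rewrite -(natr1 (Num.truncn _)) -/(M k) => Mgt; lra.
    apply: (@le_trans _ _ (expR (h * k.+2%:R) * (expR (- h) * (gamma * y k * expR (- y k))))).
      have -> : expR (h * k.+2%:R) * (expR (- h) * (gamma * y k * expR (- y k))) =
         (expR (h * k.+2%:R) * expR (- h) * expR (- y k)) * (gamma * y k) by ring.
      rewrite -!expRD (_ : h * k.+2%:R + - h + - y k = 0) ?expR0 ?mul1r//.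
      by rewrite /y -(natr1 k.+1); ring.
    by apply: ler_pM => //; rewrite ?expR_ge0// mulr_ge0 ?expR_ge0// ltW.
  - by apply: le_truncn.
  - have -> : y k - 2 * h = - h + h * k%:R by rewrite /y -(natr1 k); ring.
    rewrite expRD; move: mgt; rewrite -(natr1 (Num.truncn _)) -/(m k) => mgt; lra.
  - have : K1 * W k <= 8^-1.
      by apply: KW; rewrite ?invr_gt0.
    by have := tp_le k plo hi; lra.
have [k0 _ hk0] := big.
have ae1 : {ae P, forall w, \forall k \near \oo, ~ F k w}.
  apply: (@borel_cantelli_geometric _ _ _ P F (2 * expR (2 * h) + 40 * K1)
    (expR (- (2 * eta * h))) k0).
  - by move=> k /hk0[[r0 _ _ _ _] _]; exact: measurable_no_low_degree.
  - by rewrite addr_ge0// mulr_ge0// expR_ge0.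
  - exact: expR_ge0.
  - by rewrite expR_lt1 oppr_lt0 mulr_gt0// mulr_gt0.
  - move=> k /hk0 [[r0 hi plo pmin muge] [M2 mM mge tp]].
    have [pp0 p2] : pk k.+1 h <= p0 /\ pk k.+1 h <= 2^-1.
      by move: pmin; rewrite le_min => /andP[].
    have p01 : 0 <= pk k.+1 h <= 1 by rewrite (ltW plo)/=; lra.
    have bge := large _ _ plo pp0 muge; rewrite -/(mu k) -/(t k) -/(beta k) in bge.
    have b0 : 0 < beta k by apply: lt_le_trans bge; exact: expR_gt0.
    have m0 : (0 < m k)%N by rewrite -(ltr0n R); apply: lt_le_trans mge; exact: expR_gt0.
    apply: le_trans (P_no_low_degree model g01 g_noninc r0 m0 mM M2 p2 b0) _.
    rewrite lee_fin -/(beta k).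
    have bl1 : beta k <= 1 by exact: binom_cdf_le1.
    have smb := second_moment_bound_le (M k - 2) (ltW plo) p2 b0 bl1 m0 tp.
    apply: (le_trans smb).
    have muk := mu_le k hi.
    have bge' : expR (- (theta * y k)) <= beta k.
      apply: le_trans bge; rewrite ler_expR mulNr lerN2.
      have -> : theta * y k = tau k * (rateH a + eps) by rewrite /theta /tau; ring.
      by rewrite ler_wpM2r// addr_ge0// ltW.
    have bV : (beta k)^-1 <= expR (theta * y k).
      by rewrite -[leRHS]invrK -expRN lef_pV2 ?posrE ?expR_gt0.
    apply: (@le_trans _ _ ((2 * expR (2 * h) + 40 * K1) * W k)); last first.
      by rewrite ler_wpM2l ?Wz// addr_ge0// mulr_ge0// expR_ge0.
    have A1 : 2 / ((m k)%:R * beta k) <= 2 * expR (2 * h) * W k.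
      rewrite -mulrA ler_pM2l// invfM.
      apply: (@le_trans _ _ (expR (2 * h - y k) * expR (theta * y k))).
        apply: ler_pM => //; rewrite ?invr_ge0 ?(ltW b0)//.
        by rewrite -[leRHS]invrK -expRN opprB lef_pV2 ?posrE ?expR_gt0 ?ltr0n.
      rewrite expRD -mulrA ler_wpM2l ?expR_ge0//.
      by apply: le_trans (eW k); rewrite mulrC.
    have A2 : 8 * (t k).+1%:R * pk k.+1 h <= 8 * (K1 * W k).
      by rewrite -mulrA ler_pM2l//; exact: tp_le.
    have A3 : 32 * ((M k - 2)%N%:R * pk k.+1 h ^+ 2) / beta k <= 32 * (K1 * W k).
      rewrite -mulrA ler_pM2l//.
      have -> : (M k - 2)%N%:R * pk k.+1 h ^+ 2 / beta k = mu k * pk k.+1 h * (beta k)^-1.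
        by rewrite /mu expr2 !mulrA.
      have h1 : mu k * pk k.+1 h <= tau k * (gamma * y k * expR (- y k)).
        by apply: ler_pM => //; rewrite ?mulr_ge0 ?(ltW plo).
      have h2 : mu k * pk k.+1 h * (beta k)^-1 <=
          tau k * (gamma * y k * expR (- y k)) * expR (theta * y k).
        by apply: ler_pM => //; rewrite ?mulr_ge0 ?invr_ge0 ?(ltW plo) ?(ltW b0).
      apply: (le_trans h2).
      have -> : tau k * (gamma * y k * expR (- y k)) * expR (theta * y k) =
        gamma * y k * tau k * (expR (theta * y k) * expR (- y k)) by ring.
      have pk1 : gamma * y k * tau k <= K1 * expR (2 * (eta * y k)).
        apply: le_trans (poly k); rewrite ler_wpM2l ?lerDl// mulr_ge0// ltW//.
      apply: (@le_trans _ _ (K1 * expR (2 * (eta * y k)) * (expR (theta * y k) * expR (- y k)))).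
        by rewrite ler_wpM2r// mulr_ge0// expR_ge0.
      rewrite -mulrA ler_wpM2l// -!expRD ler_expR etaE.
      by rewrite le_eqVlt; apply/orP; left; apply/eqP; ring.
    apply: le_trans (lerD (lerD A1 A2) A3) _.
    by rewrite le_eqVlt; apply/orP; left; apply/eqP; ring.
have eh1 : 1 < expR h by rewrite expR_gt1.
apply: filterS2 ae1 (poisson_concentration eh1 (N_poisson model)) => w [k1 _ hk1] hN.
have kbig : \forall k \near \oo, (expR 1 : R) <= expR (h * k%:R) by exact: near_expR_ge.
have [k2 _ hk2] := kbig.
have si := scale_index (maxn k0 (maxn k1 k2)) h0.
near=> n.
have [k] : exists2 k, (maxn k0 (maxn k1 k2) <= k)%N &
    expR (h * k.+1%:R) <= n%:R <= expR (h * k.+2%:R) by near: n.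
rewrite !geq_max => /and3P[kk0 kk1 kk2] nk.
have nN : n%:R / expR h < (N n w)%:R /\ (N n w)%:R < n%:R * expR h by near: n.
have [mN NM rn0 _ rr] := block_bounds alpha_pos alpha_fin gamma0 h0 (hk2 k.+1 (leqW kk2)) nk nN.
have [[r0 hi plo pmin muge] [M2 mM mge tp]] := hk0 k kk0.
have := min_degree_le_of_no g_noninc rn0 rr mN NM (hk1 k kk1).
rewrite -/(delta g X N U gamma n w) => dt.
apply: (@le_trans _ _ (t k)%:R); first by rewrite ler_nat.
have [_ tt] := t_le k hi.
apply: (le_trans tt).
have /andP[n1 _] := nk.
have n0 : 0 < n%:R :> R by apply: lt_le_trans n1; exact: expR_gt0.
rewrite /tau -!mulrA ler_wpM2l// ler_pM2l ?expR_gt0// ler_pM2l//.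
by rewrite -ler_expR lnK.
Unshelve. all: by end_near. Qed.

End almost_sure_upper_bound.

(** * Asymptotics of the minimum degree *)

Section passage_to_the_limit.
Context (R : realType).

Lemma limn_esup_le_eps (u : nat -> R) (L : R) :
  (forall e, 0 < e -> \forall n \near \oo, u n <= L + e) ->
  (limn_esup (fun n => (u n)%:E) <= L%:E)%E.
Proof.
move=> uL; apply/lee_addgt0Pr => e e0; rewrite -EFinD.
apply: (@le_trans _ _ (ereal_sup ((fun n => (u n)%:E) @` [set n | u n <= L + e]))).
  by apply: ereal_inf_lbound; exists [set n | u n <= L + e] => //; exact: uL.
by apply: ge_ereal_sup => _ [n /= nL <-]; rewrite lee_fin.
Qed.

Lemma limn_einf_ge_eps (u : nat -> R) (L : R) :
  (forall e, 0 < e -> \forall n \near \oo, L - e <= u n) ->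
  (L%:E <= limn_einf (fun n => (u n)%:E))%E.
Proof.
move=> uL; rewrite /limn_einf leeNr -EFinN.
apply: (@limn_esup_le_eps (fun n => - u n)) => e /uL; apply: filterS => n; lra.
Qed.

Lemma cvg_of_eps (u : nat -> R) (L : R) :
  (forall e, 0 < e -> \forall n \near \oo, L - e <= u n) ->
  (forall e, 0 < e -> \forall n \near \oo, u n <= L + e) -> u @ \oo --> L.
Proof.
move=> uL uU; apply/cvgrPdist_le => e e0.
by apply: filterS2 (uL e e0) (uU e e0) => n lo hi; rewrite ler_norml; lra.
Qed.

(** Uncountably many almost sure events that are monotone in the tolerance reduce
to the countably many tolerances 1/(l+1). *)
Lemma ae_forall_eps disp (T : measurableType disp) (P : probability T R)
    (Q : R -> T -> Prop) : (forall e e' w, e <= e' -> Q e w -> Q e' w) ->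
  (forall e, 0 < e -> {ae P, forall w, Q e w}) ->
  {ae P, forall w, forall e, 0 < e -> Q e w}.
Proof.
move=> Qmono aeQ.
have : {ae P, forall w, forall l : nat, Q l.+1%:R^-1 w}.
  by apply: ae_foralln => l; apply: aeQ; rewrite invr_gt0.
apply: filterS => w Qw e e0.
have [l _ /(_ l (leqnn l)) /= le] := near_infty_natSinv_lt (PosNum e0).
exact: Qmono (ltW le) (Qw l).
Qed.

(** The losses exp (O(h)) due to the blocks vanish as their logarithmic width h
tends to 0. *)
Lemma expR_scale_cvg (c x : R) : expR (c * h) * x @[h --> 0^'+] --> x.
Proof.
rewrite -[X in _ --> X]mul1r -expR0 -[X in expR X](mulr0 c).
apply: cvgMl; apply: (@cvg_comp _ _ _ (fun h => c * h) expR _ (nbhs (c * 0))).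
  by apply: cvg_at_right_filter; apply: cvgMr; exact: cvg_id.
exact: continuous_expR.
Qed.

Lemma near_expR_scale_gt (c x z : R) : z < x ->
  \forall h \near 0^'+, z < expR (c * h) * x.
Proof. by move=> zx; apply: (cvgr_gt x) => //; exact: expR_scale_cvg. Qed.

Lemma near_expR_scale_lt (c x z : R) : x < z ->
  \forall h \near 0^'+, expR (c * h) * x < z.
Proof. by move=> zx; apply: (cvgr_lt x) => //; exact: expR_scale_cvg. Qed.

End passage_to_the_limit.

Section growth_rate.
Context (R : realType) (d : nat) disp (T : measurableType disp)
  (P : probability T R) (g : R -> R) (X : nat -> {RV P >-> d.-tuple R})
  (N : nat -> {RV P >-> nat}) (U : nat -> nat -> {RV P >-> R}).
Hypotheses (d0 : (0 < d)%N)
  (g01 : forall x : R, 0 <= x -> 0 <= g x <= 1)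
  (g_noninc : forall x y : R, 0 <= x -> x <= y -> g y <= g x)
  (alpha_pos : (0 < radial_integral d g)%E)
  (alpha_fin : (radial_integral d g < +oo)%E)
  (model : coupled_poisson_model X N U).

(** The lower bound at a level a slightly below Hinv_minus gamma^-1, where
gamma * rateH a > 1. *)
Lemma as_rate_ge (gamma : R) : 1 < gamma ->
  {ae P, forall w, forall e, 0 < e -> \forall n \near \oo,
    gamma * Hinv_minus gamma^-1 - e <= (delta g X N U gamma n w)%:R / ln n%:R}.
Proof.
move=> gamma1; have gamma0 : 0 < gamma by exact: lt_trans gamma1.
have y0 : 0 < gamma^-1 by rewrite invr_gt0.
have y1 : gamma^-1 < 1 by rewrite invf_lt1.
have [/andP[H0 H1] HE] := Hinv_minusP y0 y1.
set b0 := Hinv_minus _ in H0 H1 HE *.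
apply: ae_forall_eps => [e e' w ee|e e0].
  by apply: filterS => n; apply: le_trans; rewrite lerB.
have [b_le0|b_gt0] := leP (gamma * b0 - e) 0.
  apply: aeW => w; exists 1%N => // n /= n1; apply: (le_trans b_le0).
  by rewrite divr_ge0// ln_ge0// ler1n.
pose a := b0 - e / gamma / 2.
have eg : 0 < e / gamma by rewrite divr_gt0.
have egE : gamma * (e / gamma) = e by rewrite mulrC divfK// gt_eqF.
have a0 : 0 < a.
  by rewrite -(pmulr_rgt0 _ gamma0) /a; lra.
have ab : a < b0 by rewrite /a; lra.
have /rateH_decr : 0 <= a by exact: ltW.
move=> /(_ _ ab (ltW H1)); rewrite HE => Ha.
have : \forall h \near 0^'+, [/\ 0 < h, 1 < expR (- 4 * h) * (gamma * rateH a)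
    & gamma * b0 - e < expR (- 4 * h) * (gamma * a)].
  near=> h; split.
  - by near: h; exact: nbhs_right_gt.
  - near: h; apply: near_expR_scale_gt.
    by rewrite mulrC -ltr_pdivrMr// mul1r.
  - near: h; apply: near_expR_scale_gt.
    by rewrite /a; lra.
move=> /filter_ex[h [h0]]; rewrite mulNr mulrA => h1 h2.
have := as_min_degree_ge d0 g01 g_noninc alpha_pos alpha_fin model gamma0 a0
  (ltW (lt_trans ab H1)) h0 h1.
apply: filterS => w; have : \forall n \near \oo, (1 : R) < n%:R by exact: nbhs_infty_gtr.
apply: filterS2 => n n1 dn; rewrite ler_pdivlMr ?ln_gt0//; apply: le_trans dn.
rewrite ler_wpM2r ?ln_ge0 ?(ltW n1)//; apply: (le_trans (ltW h2)).
by rewrite le_eqVlt; apply/orP; left; apply/eqP; ring.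
Unshelve. all: by end_near. Qed.

(** The upper bound at a level a slightly above Hinv_minus y, where
gamma * rateH a < gamma * y <= 1. *)
Lemma as_rate_le (gamma y : R) : 0 < gamma -> 0 < y -> y < 1 -> y <= gamma^-1 ->
  {ae P, forall w, forall e, 0 < e -> \forall n \near \oo,
    (delta g X N U gamma n w)%:R / ln n%:R <= gamma * Hinv_minus y + e}.
Proof.
move=> gamma0 y0 y1 yg.
have [/andP[H0 H1] HE] := Hinv_minusP y0 y1.
set b0 := Hinv_minus _ in H0 H1 HE *.
apply: ae_forall_eps => [e e' w ee|e e0].
  by apply: filterS => n /le_trans; apply; rewrite lerD2l.
pose a := Num.min (b0 + e / gamma / 2) ((b0 + 1) / 2).
have eg : 0 < e / gamma by rewrite divr_gt0.
have egE : gamma * (e / gamma) = e by rewrite mulrC divfK// gt_eqF.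
have ab : b0 < a by rewrite lt_min; apply/andP; split; lra.
have a1 : a < 1 by rewrite gt_min; apply/orP; right; lra.
have ae : gamma * a < gamma * b0 + e.
  have : a <= b0 + e / gamma / 2 by rewrite ge_min lexx.
  by move=> /(ler_wpM2l (ltW gamma0)); lra.
have a0 : 0 <= a by rewrite ltW// (lt_trans H0).
have := rateH_decr (ltW H0) ab (ltW a1); rewrite HE => Ha.
have /midf_lt[_ Heps] : rateH a < gamma^-1 by exact: lt_le_trans yg.
pose eps := (gamma^-1 - rateH a) / 2.
have eps0 : 0 < eps by rewrite divr_gt0// subr_gt0 (lt_le_trans Ha).
have : \forall h \near 0^'+, [/\ 0 < h, expR (2 * h) * (gamma * (rateH a + eps)) < 1
    & expR (2 * h) * (gamma * a) < gamma * b0 + e].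
  near=> h; split.
  - by near: h; exact: nbhs_right_gt.
  - near: h; apply: near_expR_scale_lt.
    rewrite mulrC -ltr_pdivlMr// div1r /eps; lra.
  - by near: h; exact: near_expR_scale_lt.
move=> /filter_ex[h [h0]]; rewrite mulrA => h1 h2.
have := as_min_degree_le d0 g01 g_noninc alpha_pos alpha_fin model gamma0 a0
  a1 h0 eps0 h1.
apply: filterS => w; have : \forall n \near \oo, (1 : R) < n%:R by exact: nbhs_infty_gtr.
apply: filterS2 => n n1 dn; rewrite ler_pdivrMr ?ln_gt0//; apply: (le_trans dn).
rewrite ler_wpM2r ?ln_ge0 ?(ltW n1)//; apply: le_trans (ltW h2).
by rewrite le_eqVlt; apply/orP; left; apply/eqP; ring.
Unshelve. all: by end_near. Qed.

(** The upper bound at level a = 0, where rateH 0 = 1: isolated vertices exist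
eventually, and a sequence of naturals bounded by 0 is constant. *)
Lemma as_min_degree_eq0 (gamma : R) : 0 < gamma -> gamma < 1 ->
  {ae P, forall w, (fun n => (delta g X N U gamma n w)%:R : R) @ \oo --> (0 : R)}.
Proof.
move=> gamma0 gamma1; pose eps := (gamma^-1 - 1) / 2.
have gV : 1 < gamma^-1 by rewrite invf_gt1.
have eps0 : 0 < eps by rewrite divr_gt0// subr_gt0.
have : \forall h \near 0^'+, 0 < h /\ expR (2 * h) * (gamma * (1 + eps)) < 1.
  near=> h; split; first by near: h; exact: nbhs_right_gt.
  near: h; apply: near_expR_scale_lt.
  rewrite mulrC -ltr_pdivlMr// div1r /eps; lra.
move=> /filter_ex[h [h0]]; rewrite mulrA => h1.
have H0 : rateH 0 = 1 :> R by rewrite /rateH eqxx.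
have {}h1 : expR (2 * h) * gamma * (rateH 0 + eps) < 1 by rewrite H0.
have := as_min_degree_le d0 g01 g_noninc alpha_pos alpha_fin model gamma0 (lexx 0)
  ltr01 h0 eps0 h1.
apply: filterS => w dw; apply: cvg_near_cst; apply: filterS dw => n.
by rewrite !mul0r => dn; apply/eqP; rewrite eq_le dn ler0n.
Unshelve. all: by end_near. Qed.

End growth_rate.

Theorem theorem2p6 (R : realType) (d : nat) (disp : measure_display)
    (T : measurableType disp) (P : probability T R) (g : R -> R)
    (X : nat -> {RV P >-> d.-tuple R}) (N : nat -> {RV P >-> nat})
    (U : nat -> nat -> {RV P >-> R})
    (d_ge2 : (2 <= d)%N)
    (g01 : forall x : R, 0 <= x -> 0 <= g x <= 1)
    (g_noninc : forall x y : R, 0 <= x -> x <= y -> g y <= g x)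
    (alpha_pos : (0 < radial_integral d g)%E)
    (alpha_fin : (radial_integral d g < +oo)%E)
    (model : coupled_poisson_model X N U) :
  [/\ (* (i) *)
      (exists2 c : R, 0 < c & g =o_+oo (fun r => expR (- c * r))) ->
      forall gamma : R, 0 < gamma -> gamma < 1 ->
        {ae P, forall w,
          (fun n => (delta g X N U gamma n w)%:R : R) @ \oo --> (0 : R)},
      (* (ii) *)
      (exists2 c : R, d%:R < c & g =o_+oo (fun r => r `^ (- c))) ->
      forall gamma : R, 1 < gamma ->
        {ae P, forall w,
          ((gamma * Hinv_minus gamma^-1)%:E <=
           limn_einf (fun n => ((delta g X N U gamma n w)%:R / ln n%:R)%:E))%E},
      (* (iii) *)
      (exists2 c : R, 0 < c & g =o_+oo (fun r => expR (- c * r))) ->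
      forall gamma : R, 1 < gamma ->
        {ae P, forall w,
          (fun n => (delta g X N U gamma n w)%:R / ln n%:R : R) @ \oo -->
          gamma * Hinv_minus gamma^-1}
    & (* (iv) *)
      forall c : R, 3 * d%:R < c -> g =o_+oo (fun r => r `^ (- c)) ->
      forall gamma : R, (c - 3 * d%:R) / (c - d%:R) < gamma ->
        {ae P, forall w,
          (limn_esup (fun n => ((delta g X N U gamma n w)%:R / ln n%:R)%:E) <=
           (gamma * Hinv_minus ((c - 3 * d%:R) / (gamma * (c - d%:R))))%:E)%E}].
Proof.
have d0 : (0 < d)%N by exact: ltnW.
split=> [_|_|_|c c3 _] gamma.
- move=> gamma0 gamma1; exact: as_min_degree_eq0.
- move=> gamma1; have := as_rate_ge d0 g01 g_noninc alpha_pos alpha_fin model gamma1.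
  by apply: filterS => w; exact: limn_einf_ge_eps.
- move=> gamma1; have gamma0 : 0 < gamma by exact: lt_trans gamma1.
  have y0 : 0 < gamma^-1 by rewrite invr_gt0.
  have y1 : gamma^-1 < 1 by rewrite invf_lt1.
  apply: filterS2 (as_rate_ge d0 g01 g_noninc alpha_pos alpha_fin model gamma1)
    (as_rate_le d0 g01 g_noninc alpha_pos alpha_fin model gamma0 y0 y1 (lexx _)).
  by move=> w; exact: cvg_of_eps.
move=> gammac.
have dR : 0 < d%:R :> R by rewrite ltr0n.
have cd : 0 < c - d%:R by lra.
have c3d : 0 < c - 3 * d%:R by lra.
have gamma0 : 0 < gamma by apply: lt_trans gammac; rewrite divr_gt0.
set y := _ / (gamma * _).
have yE : y = gamma^-1 * ((c - 3 * d%:R) / (c - d%:R)).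
  by rewrite /y; field; rewrite !gt_eqF.
have y0 : 0 < y by rewrite divr_gt0// mulr_gt0.
have y1 : y < 1 by rewrite yE mulrC ltr_pdivrMr// mul1r.
have yg : y <= gamma^-1.
  rewrite yE ler_piMr ?invr_ge0 ?(ltW gamma0)// ler_pdivrMr// mul1r; lra.
have := as_rate_le d0 g01 g_noninc alpha_pos alpha_fin model gamma0 y0 y1 yg.
by apply: filterS => w; exact: limn_esup_le_eps.
Qed.
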